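(* (Dynamic programming principle) Let $\Pi=\{0=t_0<\dots<t_n=T\}$ be an arbitrary partition of $[0,T]$ and $(t,x)\in[0,T]\times\mathbb R^d$. Then, for all $i,l$ such that $t_i\le t<t_{i+1}\le t_l$, $$V^\Pi(t,x)=\operatorname{esssup}_{\alpha\in\mathcal A^\Pi_{t,t_l}}\operatorname{essinf}_{\beta\in\mathcal B^\Pi_{t,t_l}}E\big[V^\Pi(t_l,X_{t_l}^{t,x,\alpha,\beta})\,\big|\,\mathcal F_i\big],\quad P\text{-a.s.},$$ $$U^\Pi(t,x)=\operatorname{essinf}_{\beta\in\mathcal B^\Pi_{t,t_l}}\operatorname{esssup}_{\alpha\in\mathcal A^\Pi_{t,t_l}}E\big[U^\Pi(t_l,X_{t_l}^{t,x,\alpha,\beta})\,\big|\,\mathcal F_i\big],\quad P\text{-a.s.}$$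
   Context: Setting. $T>0$ is fixed, $U,V$ are compact metric spaces, $f:[0,T]\times\mathbb R^d\times U\times V\to\mathbb R^d$ is bounded, continuous, and Lipschitz in $x$ uniformly with respect to $(t,u,v)$, and $g:\mathbb R^d\to\mathbb R$ is bounded and Lipschitz. Probability space. $(\Omega,\mathcal F,P)=\big(([0,1]^2)^{\mathbb N},\mathcal B([0,1]^2)^{\otimes\mathbb N},\lambda_2^{\otimes\mathbb N}\big)$, with $\mathbb N$ the positive integers and $\lambda_2$ two-dimensional Lebesgue (Borel) measure on $[0,1]^2$. The coordinate maps are $\zeta_j=(\zeta_{j,1},\zeta_{j,2}):\Omega\to[0,1]^2$, $j\ge1$. Put $\mathcal G_j=\sigma(\zeta_{j,1})$, $\mathcal H_j=\sigma(\zeta_{j,2})$, $\mathcal F_j=\sigma(\zeta_1,\dots,\zeta_j)$ for $j\ge1$, and $\mathcal F_0$ the trivial $\sigma$-field. $\mathbb F=(\mathcal F_j)$; a random time $\tau:\Omega\to\{0,1,2,\dots\}$ is an $\mathbb F$-stopping time if $\{\tau=j\}\in\mathcal F_j$ for all $j\ge0$. Admissible controls. Let $\Pi=\{0=t_0<\dots<t_n=T\}$. For a sub-$\sigma$-field $\mathcal K\subset\mathcal F$, $L^0_{\mathcal K}(a,b;E)$ denotes the (jointly) measurable $E$-valued processes $(u_s)$ on the time interval from $a$ to $b$ with $u_s$ $\mathcal K$-measurable for every $s$. $\mathcal U^\Pi_{0,T}$ is the set of $u\in L^0_{\mathcal F}(0,T;U)$ such that for each $1\le j\le n$, $u|_{[t_{j-1},t_j)}=\sum_{k\ge1}I_{\Gamma_{j,k}}u^{j,k}$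 (i.e. $u=u^{j,k}$ on $\Gamma_{j,k}$), where $(\Gamma_{j,k})_{k\ge1}\subset\mathcal F_{j-1}$ is a partition of $\Omega$ and $u^{j,k}\in L^0_{\mathcal G_j}(t_{j-1},t_j;U)$. $\mathcal V^\Pi_{0,T}$ is defined in the same way with $V$ and $\mathcal H_j$ in place of $U$ and $\mathcal G_j$. For $0\le t\le t_l\in\Pi$, $\mathcal U^\Pi_{t,t_l}$ and $\mathcal V^\Pi_{t,t_l}$ are the sets of restrictions of these controls to $[t,t_l]$. Dynamics. For $(u,v)\in\mathcal U^\Pi_{t,t_l}\times\mathcal V^\Pi_{t,t_l}$, $X^{t,x,u,v}$ is the unique pathwise solution of $X_s=x+\int_t^sf(r,X_r,u_r,v_r)\,dr$, $s\in[t,t_l]$. NAD-strategies. $\mathcal B^\Pi_{t,t_l}$ is the set of maps $\beta:\mathcal U^\Pi_{t,t_l}\to\mathcal V^\Pi_{t,t_l}$ such that for every $\mathbb F$-stopping time $\tau:\Omega\to\{0,\dots,n-1\}$ and all $u,u'\in\mathcal U^\Pi_{t,t_l}$ with $u=u'$ $dsdP$-a.s. on $\{(s,\omega):t\le s\le t_{\tau(\omega)}\}$, one has $\beta(u)=\beta(u')$ $dsdP$-a.s. on $\{(s,\omega):t\le s\le t_{\tau(\omega)+1}\}$ (times restricted to $[t,t_l]$). $\mathcal A^\Pi_{t,t_l}$ is the symmetric set of maps $\alpha:\mathcal V^\Pi_{t,t_l}\to\mathcal U^\Pi_{t,t_l}$. For every $(\alpha,\beta)\in\mathcal A^\Pi_{t,t_l}\times\mathcal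 B^\Pi_{t,t_l}$ there is a $dsdP$-a.s. unique $(u,v)\in\mathcal U^\Pi_{t,t_l}\times\mathcal V^\Pi_{t,t_l}$ with $\alpha(v)=u$, $\beta(u)=v$; one sets $X^{t,x,\alpha,\beta}:=X^{t,x,u,v}$. Value functions along $\Pi$. For $t_i\le t<t_{i+1}$ ($0\le i\le n-1$), $$V^\Pi(t,x)=\operatorname{esssup}_{\alpha\in\mathcal A^\Pi_{t,T}}\operatorname{essinf}_{\beta\in\mathcal B^\Pi_{t,T}}E[g(X_T^{t,x,\alpha,\beta})|\mathcal F_i],\quad U^\Pi(t,x)=\operatorname{essinf}_{\beta\in\mathcal B^\Pi_{t,T}}\operatorname{esssup}_{\alpha\in\mathcal A^\Pi_{t,T}}E[g(X_T^{t,x,\alpha,\beta})|\mathcal F_i],$$ and $V^\Pi(T,x)=U^\Pi(T,x)=g(x)$. A priori these are bounded $\mathcal F_i$-measurable random variables; $V^\Pi(t_l,\cdot)$ and $U^\Pi(t_l,\cdot)$ are a.s. Lipschitz in $x$ (with a deterministic constant), and when they are evaluated at the random point $X_{t_l}^{t,x,\alpha,\beta}$ a version of the random field that is Lipschitz continuous in $x$ is used. *)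

(* Defs.v *)
From HB Require Import structures.
From mathcomp Require Import all_boot all_order all_algebra.
From mathcomp Require Import all_classical all_reals all_analysis.
From mathcomp Require Import measurable_realfun.

Set Implicit Arguments.
Unset Strict Implicit.
Unset Printing Implicit Defensive.

Import Order.TTheory GRing.Theory Num.Theory.
Import numFieldNormedType.Exports.

Local Open Scope classical_set_scope.
Local Open Scope ring_scope.

(* Nonempty metric spaces. *)
#[short(type="pmetricType")]
HB.structure Definition PointedMetric (K : numDomainType) :=
  {M of Metric K M & isPointed M}.

Definition borel (E : ptopologicalType) := g_sigma_algebraType (@open E).

Section probability_space.
Context {R : realType}.

Definition unit_square : set (R * R) := `[0, 1] `*` `[0, 1].

Definition square := set_type unit_square.

HB.instance Definition _ := Choice.on square.

Let square0 : (0, 0) \in unit_square.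
Proof. by rewrite inE; split; rewrite /= in_itv /= lexx ler01. Qed.

HB.instance Definition _ := isPointed.Build square (exist _ (0, 0) square0).

End probability_space.
Arguments unit_square R : clear implicits.
Arguments square R : clear implicits.

(* The trace on [0, 1]^2 of the Borel sigma-algebra of R^2 is the preimage of
   the latter by the inclusion, so the product sigma-algebra on
   ([0, 1]^2)^N is generated by the maps omega |-> set_val (omega k).  *)
Definition cylinders (R : realType) : set (set (nat -> square R)) :=
  \bigcup_k preimage_set_system setT
    (fun omega => set_val (omega k) : R * R) measurable.

Definition Omega (R : realType) := g_sigma_algebraType (@cylinders R).

HB.instance Definition _ (R : realType) := Measurable.on (Omega R).

Section information.
Context {R : realType}.
Local Notation Omega := (Omega R).

(* Coordinates are numbered from 0: zeta k is the (k+1)-st coordinate map, and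
   infoU k, infoV k are the sigma-fields of its two components. *)
Definition zeta (k : nat) (omega : Omega) : R * R := set_val (omega k).

Definition infoU (k : nat) : set_system Omega :=
  g_sigma_algebra_preimage (fun omega => (zeta k omega).1).

Definition infoV (k : nat) : set_system Omega :=
  g_sigma_algebra_preimage (fun omega => (zeta k omega).2).

Definition filtration (j : nat) : set_system Omega :=
  <<s \bigcup_(k in `I_j) g_sigma_algebra_preimage (zeta k) >>.

(* The product measure of countably many copies of the Lebesgue measure on
   [0, 1]^2 is the only probability measure satisfying this. *)
Definition is_product_lebesgue (P : probability Omega R) :=
  forall (m : nat) (A : nat -> set (R * R)), (forall k, measurable (A k)) ->
  P (\bigcap_(k in `I_m) zeta k @^-1` A k) =
  (\big[*%E/1]_(k < m)
     (lebesgue_measure \x lebesgue_measure) (A k `&` unit_square R))%E.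

Definition stopping_time (tau : Omega -> nat) :=
  forall j, filtration j (tau @^-1` [set j]).

End information.

Section random_variables.
Context {R : realType} (P : probability (Omega R) R).
Local Notation Omega := (Omega R).

Definition is_cond_exp (K : set_system Omega) (X Y : Omega -> R) :=
  [/\ g_sigma_algebra_preimage Y `<=` K,
      P.-integrable setT (EFin \o Y) &
      forall A, K A ->
        (\int[P]_(w in A) (Y w)%:E = \int[P]_(w in A) (X w)%:E)%E].

(* Conditional expectations and essential suprema are only determined up to
   almost sure equality: an arbitrary version is chosen. *)
Definition cond_exp (K : set_system Omega) (X : Omega -> R) : Omega -> R :=
  get (is_cond_exp K X).

Definition is_esssup (I : Type) (A : set I) (X : I -> Omega -> \bar R)
    (Y : Omega -> \bar R) :=
  [/\ measurable_fun setT Y,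
      forall a, A a -> {ae P, forall w, (X a w <= Y w)%E} &
      forall Z : Omega -> \bar R, measurable_fun setT Z ->
        (forall a, A a -> {ae P, forall w, (X a w <= Z w)%E}) ->
        {ae P, forall w, (Y w <= Z w)%E}].

Definition is_essinf (I : Type) (A : set I) (X : I -> Omega -> \bar R)
    (Y : Omega -> \bar R) :=
  [/\ measurable_fun setT Y,
      forall a, A a -> {ae P, forall w, (Y w <= X a w)%E} &
      forall Z : Omega -> \bar R, measurable_fun setT Z ->
        (forall a, A a -> {ae P, forall w, (Z w <= X a w)%E}) ->
        {ae P, forall w, (Z w <= Y w)%E}].

Definition esssup (I : Type) (A : set I) (X : I -> Omega -> \bar R) :=
  get (is_esssup A X).

Definition essinf (I : Type) (A : set I) (X : I -> Omega -> \bar R) :=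
  get (is_essinf A X).

Definition is_lip_version (d : nat) (Z : 'rV[R]_d -> Omega -> \bar R)
    (W : 'rV[R]_d -> Omega -> R) :=
  [/\ forall x, measurable_fun setT (W x),
      forall x, {ae P, forall w, (W x w)%:E = Z x w} &
      exists L : R, forall w x y, `|W x w - W y w| <= L * `|x - y|].

(* Used to evaluate a random field at a random point; two Lipschitz versions
   of Z agree almost surely, simultaneously at all points. *)
Definition lip_version (d : nat) (Z : 'rV[R]_d -> Omega -> \bar R) :=
  get (is_lip_version Z).

End random_variables.

Definition is_partition (R : realType) (T : R) (n : nat) (p : nat -> R) :=
  [/\ p 0%N = 0, p n = T & forall j, (j < n)%N -> p j < p j.+1].

Section controls.
Context {R : realType} (n : nat) (p : nat -> R).
Context {E : pmetricType R} (info : nat -> set_system (Omega R)).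
Local Notation Omega := (Omega R).

Definition L0 (K : set_system Omega) (a b : R) : set (R -> Omega -> E) :=
  [set u |
    measurable_fun (`[a, b] `*` setT)
      (fun z : R * Omega => u z.1 z.2 : borel E) /\
    forall s, a <= s <= b ->
      g_sigma_algebra_preimage (u s : Omega -> borel E) `<=` K].

Definition admissible : set (R -> Omega -> E) :=
  [set u | L0 measurable (p 0%N) (p n) u /\
    forall j, (j < n)%N ->
    exists (Gamma : nat -> set Omega) (w : nat -> R -> Omega -> E),
      [/\ forall k, filtration j (Gamma k),
          trivIset setT Gamma,
          \bigcup_k Gamma k = setT,
          forall k, L0 (info j) (p j) (p j.+1) (w k) &
          forall k s omega, p j <= s < p j.+1 -> Gamma k omega ->
            u s omega = w k s omega]].

(* A function on [a, b] is encoded as a function on R that takes the default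
   value of its codomain outside [a, b]. *)
Definition controls (a b : R) : set (R -> Omega -> E) :=
  [set u \_ `[a, b] | u in admissible].

End controls.

Section game.
Context {R : realType} {d : nat} {U V : pmetricType R}.
Context (P : probability (Omega R) R) (n : nat) (p : nat -> R).
Context (f : R -> 'rV[R]_d -> U -> V -> 'rV[R]_d).
Local Notation Omega := (Omega R).

Definition ae_equal_on (E : Type) (D : set (R * Omega))
    (u u' : R -> Omega -> E) :=
  {ae (lebesgue_measure \x P)%E, forall z, D z -> u z.1 z.2 = u' z.1 z.2}.

(* Only the values of a strategy on C1 matter. *)
Definition nad_strategies (E1 E2 : Type) (a b : R)
    (C1 : set (R -> Omega -> E1)) (C2 : set (R -> Omega -> E2)) :
    set ((R -> Omega -> E1) -> (R -> Omega -> E2)) :=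
  [set beta | (forall u, C1 u -> C2 (beta u)) /\
    forall tau : Omega -> nat, stopping_time tau ->
      (forall omega, (tau omega < n)%N) ->
    forall u u', C1 u -> C1 u' ->
      ae_equal_on [set z | a <= z.1 <= b /\ z.1 <= p (tau z.2)] u u' ->
      ae_equal_on [set z | a <= z.1 <= b /\ z.1 <= p (tau z.2).+1]
        (beta u) (beta u')].

Definition controlsU a b : set (R -> Omega -> U) := controls n p infoU a b.

Definition controlsV a b : set (R -> Omega -> V) := controls n p infoV a b.

Definition strategiesA a b :=
  nad_strategies a b (controlsV a b) (controlsU a b).

Definition strategiesB a b :=
  nad_strategies a b (controlsU a b) (controlsV a b).

Definition is_trajectory (a b : R) (x : 'rV[R]_d) (c : R -> U) (e : R -> V)
    (X : R -> 'rV[R]_d) :=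
  {within `[a, b], continuous X} /\
  forall s, a <= s <= b ->
    X s = x + \row_k \int[lebesgue_measure]_(r in `[a, s])
                 (f r (X r) (c r) (e r)) 0 k.

Definition trajectory a b x c e : R -> 'rV[R]_d :=
  get (is_trajectory a b x c e).

(* The fixed-point equations are understood almost everywhere: strategies are
   only constrained up to null sets, so they need not hold pointwise. *)
Definition outcome (a b : R)
    (alpha : (R -> Omega -> V) -> (R -> Omega -> U))
    (beta : (R -> Omega -> U) -> (R -> Omega -> V)) :
    (R -> Omega -> U) * (R -> Omega -> V) :=
  get [set uv |
    [/\ controlsU a b uv.1, controlsV a b uv.2,
        ae_equal_on (`[a, b] `*` setT) (alpha uv.2) uv.1 &
        ae_equal_on (`[a, b] `*` setT) (beta uv.1) uv.2]].

Definition state_at_end a b x alpha beta (omega : Omega) : 'rV[R]_d :=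
  let uv := outcome a b alpha beta in
  trajectory a b x (uv.1 ^~ omega) (uv.2 ^~ omega) b.

Definition payoff (i : nat) a b x (h : 'rV[R]_d -> Omega -> R) alpha beta
    (omega : Omega) : \bar R :=
  (cond_exp P (filtration i)
     (fun w => h (state_at_end a b x alpha beta w) w) omega)%:E.

Definition sup_inf i a b x h : Omega -> \bar R :=
  esssup P (strategiesA a b) (fun alpha =>
  essinf P (strategiesB a b) (fun beta => payoff i a b x h alpha beta)).

Definition inf_sup i a b x h : Omega -> \bar R :=
  essinf P (strategiesB a b) (fun beta =>
  esssup P (strategiesA a b) (fun alpha => payoff i a b x h alpha beta)).

(* The i such that p i <= t < p i.+1. *)
Definition cell (t : R) : nat := find (fun i => t < p i.+1) (iota 0 n).

Context (g : 'rV[R]_d -> R).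

Definition lower_value (t : R) (x : 'rV[R]_d) : Omega -> \bar R :=
  if t < p n then sup_inf (cell t) t (p n) x (fun y _ => g y)
  else cst (g x)%:E.

Definition upper_value (t : R) (x : 'rV[R]_d) : Omega -> \bar R :=
  if t < p n then inf_sup (cell t) t (p n) x (fun y _ => g y)
  else cst (g x)%:E.

End game.

(* Main.v *)
Require Import Defs.
From mathcomp Require Import all_boot all_order all_algebra.
From mathcomp Require Import all_classical all_reals all_analysis.
From mathcomp Require Import measurable_realfun.
From mathcomp Require Import ring lra.

Set Implicit Arguments.
Unset Strict Implicit.
Unset Printing Implicit Defensive.

Import Order.TTheory GRing.Theory Num.Theory.
Import numFieldNormedType.Exports.

Local Open Scope classical_set_scope.
Local Open Scope ring_scope.

(** The reason for the principle is that the values are deterministic and given by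
  an explicit backward recursion, which is trivially compatible with cutting the
  horizon.

  On each interval of the partition both players choose, knowing the past, random
  actions that use one component of a fresh coordinate each. Resampling the
  coordinates of the future ([splice]) shows that, once the past is fixed, the
  conditional expectation of a deterministic reward is the payoff of a stage game
  that only depends on the current position ([one_step]). For a reward [h] at the
  end of stage [j] and a position [y] at its start, the lower value of the stage
  game ([stage_value]) is the supremum over the actions of player 1 of the infimum
  over the actions of player 2 of the expectation of [h] at the end of the
  trajectory from [y]. Iterating backwards gives [value], a deterministic function
  that is bounded and Lipschitz if the terminal reward is.

  The lower game from time [t] to [p l] with a deterministic Lipschitz reward has
  this value almost surely ([sup_inf_value]). Every strategy [alpha] can be held
  down to it up to an error ([best_response]): one builds, stage after stage, a
  control that answers almost optimally what [alpha] is about to play, which is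
  already settled as strategies are nonanticipative with delay; the response is the
  constant strategy that plays this control. Conversely player 1 secures it up to
  an error by a feedback ([feedback_strategy]): on each stage it plays an action
  chosen in advance for the cell of a fine grid that contains the current position,
  and this position is computed from what the opponent has played before. Both
  estimates are proved in integrated form, over the events of the past, and only in
  the end turned into bounds on conditional expectations ([cond_exp_le],
  [cond_exp_ge]). The strategies of the two players determine a pair of controls
  because playing them against each other settles one more interval at each round
  ([outcome_exists]). The upper game is the lower game of the other player for the
  opposite reward ([inf_sup_value]).

  For the principle itself, [sup_inf_value] applies on the horizon [p n] with reward
  [g], and on the horizon [p l] with the value at [p l] as reward: almost surely and
  at all points at once, the Lipschitz version of the latter is the deterministic
  function of the recursion ([lip_version_ae]). The two recursions coincide
  ([value_split]).

  The measurability of trajectories rests on approximations by countably-valued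
  maps ([caratheodory_measurable]); that the position at [p j] is known from the
  first [j] coordinates rests on the description of [filtration j] as the measurable
  sets that depend on them only ([filtrationP]). *)

(** * The coordinate space and resampling *)

Section coordinates.
Context {R : realType}.
Local Notation Omega := (Omega R).

Definition depends_below (j : nat) (A : set Omega) := forall w w' : Omega,
  (forall k, (k < j)%N -> w k = w' k) -> A w -> A w'.

Definition coordinate_event (j : nat) (A : set Omega) :=
  measurable A /\ forall w w' : Omega, w j = w' j -> A w -> A w'.

(** Resampling the coordinates from [j] on, independently of the earlier ones, is
  how expectations conditional on [filtration j] are computed below. *)
Definition splice (j : nat) (w w' : Omega) : Omega :=
  fun k => if (k < j)%N then w k else w' k.

Lemma measurable_zeta k : measurable_fun setT (@zeta R k).
Proof.
move=> _ B mB; rewrite setTI; apply: sub_sigma_algebra.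
by exists k => //; exists B => //; rewrite setTI.
Qed.

Lemma measurable_fun_Omega d (T : measurableType d) (F : T -> Omega) :
  (forall k, measurable_fun setT (zeta k \o F)) -> measurable_fun setT F.
Proof.
move=> mF; refine (@measurability _ _ T Omega setT F (@cylinders R) _ _) => //.
move=> _ [_ [k _ [B mB <-]] <-].
by rewrite !setTI; have := mF k measurableT B mB; rewrite setTI.
Qed.

Lemma measurable_splice j :
  measurable_fun setT (fun z : Omega * Omega => splice j z.1 z.2).
Proof.
apply: measurable_fun_Omega => k.
have [kj|jk] := ltnP k j.
  rewrite (_ : _ \o _ = zeta k \o fst).
    exact: measurableT_comp (measurable_zeta k) _.
  by apply/funext => z; rewrite /zeta /splice /= kj.
rewrite (_ : _ \o _ = zeta k \o snd).
  exact: measurableT_comp (measurable_zeta k) _.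
by apply/funext => z; rewrite /zeta /splice /= ltnNge jk.
Qed.

Lemma measurable_splice1 j w : measurable_fun setT (splice j w).
Proof.
rewrite (_ : splice j w = (fun z => splice j z.1 z.2) \o pair w)//.
by apply: measurableT_comp => //; exact: measurable_splice.
Qed.

(** A measurable set that depends only on the first coordinates is its own
  preimage by [fun w => splice j w w0], and this map only reads the first [j]
  coordinates. *)
Lemma filtrationP j (A : set Omega) :
  filtration j A <-> measurable A /\ depends_below j A.
Proof.
split.
- apply: (@smallest_sub _ _ _ [set A | measurable A /\ depends_below j A]).
  + split.
    * by split.
    * move=> B [mB dB]; split; first by rewrite setTD; exact: measurableC.
      move=> w w' ww' [_ nB]; split => // Bw'; apply: nB.
      by apply: dB Bw' => k kj; rewrite ww'.
    * move=> B mB; split; first by apply: bigcup_measurable => k _; case: (mB k).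
      by move=> w w' ww' [k _ Bw]; exists k => //; apply: (mB k).2 Bw.
  + move=> _ [k kj [B mB <-]]; split.
      exact: (measurable_zeta k) measurableT B mB.
    by move=> w w' ww'; rewrite !setTI /preimage /zeta /= ww'.
- move=> [mA dA].
  pose G : set (set Omega) := \bigcup_(k in `I_j) g_sigma_algebra_preimage (@zeta R k).
  pose F : g_sigma_algebraType G -> Omega := fun w => splice j w point.
  have mF : measurable_fun setT F.
    apply: measurable_fun_Omega => k; have [kj|jk] := ltnP k j.
      rewrite (_ : _ \o _ = zeta k); last first.
        by apply/funext => w; rewrite /zeta /F /splice /= kj.
      move=> _ B mB; apply: sub_sigma_algebra.
      by exists k => //; exists B.
    rewrite (_ : _ \o _ = cst (zeta k point)); first exact: measurable_cst.
    by apply/funext => w; rewrite /zeta /F /splice /= ltnNge jk.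
  have := mF measurableT A mA; rewrite setTI.
  suff -> : F @^-1` A = A by [].
  by apply/seteqP; split => w; apply: dA => k kj; rewrite /F /splice kj.
Qed.

Lemma infoU_coordinate j A : @infoU R j A -> coordinate_event j A.
Proof.
move=> [B mB <-]; split.
  have m1 : measurable_fun setT (fst \o @zeta R j).
    by apply: measurableT_comp => //; exact: measurable_zeta.
  exact: (m1 measurableT B mB).
by move=> w w' ww'; rewrite !setTI /preimage /zeta /= ww'.
Qed.

Lemma infoV_coordinate j A : @infoV R j A -> coordinate_event j A.
Proof.
move=> [B mB <-]; split.
  have m2 : measurable_fun setT (snd \o @zeta R j).
    by apply: measurableT_comp => //; exact: measurable_zeta.
  exact: (m2 measurableT B mB).
by move=> w w' ww'; rewrite !setTI /preimage /zeta /= ww'.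
Qed.

Lemma filtration_le j k : (j <= k)%N -> @filtration R j `<=` filtration k.
Proof.
move=> jk A /filtrationP[mA dA]; apply/filtrationP; split => // w w' ww'.
by apply: dA => m mj; apply: ww'; exact: leq_trans jk.
Qed.

End coordinates.

Section resampling.
Context {R : realType} (P : probability (Omega R) R).
Hypothesis P_product : is_product_lebesgue P.
Local Notation Omega := (Omega R).
Local Open Scope ereal_scope.

Let cyl (mA : nat * (nat -> set (R * R))) : set Omega :=
  \bigcap_(k in `I_mA.1) zeta k @^-1` mA.2 k.

Let rectangles : set (set Omega) :=
  [set cyl mA | mA in [set mA | forall k, measurable (mA.2 k)]].

Let measurable_rectangle B : rectangles B -> measurable B.
Proof.
move=> [[m A] /= mA <-]; apply: bigcap_measurableType => k _.
by rewrite -[X in measurable X]setTI; exact: measurable_zeta.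
Qed.

Let measurable_rectangles : @measurable _ Omega = <<s rectangles >>.
Proof.
apply/seteqP; split.
  apply: smallest_sub; first exact: smallest_sigma_algebra.
  move=> _ [k _ [B mB <-]]; apply: sub_sigma_algebra.
  exists (k.+1, fun i => if i == k then B else setT).
    by move=> i /=; case: ifP.
  rewrite setTI; apply/seteqP; split => w.
    by move=> /(_ k); rewrite /= eqxx; apply; rewrite /= ltnS.
  by move=> Bw i _ /=; case: eqP => [->//|].
by apply: smallest_sub; [exact: sigma_algebra_measurable|exact: measurable_rectangle].
Qed.

Let rectangles_setI : setI_closed rectangles.
Proof.
move=> _ _ [[m A] /= mA <-] [[m' A'] /= mA' <-].
exists (maxn m m', fun k => (if (k < m)%N then A k else setT) `&`
                            (if (k < m')%N then A' k else setT)).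
  by move=> k /=; apply: measurableI; case: ifP.
apply/seteqP; split => w /=.
  move=> H; split => k /= km.
    have [|+ _] := H k _; first by rewrite /= (leq_trans km)// leq_maxl.
    by rewrite /= km.
  have [|_ +] := H k _; first by rewrite /= (leq_trans km)// leq_maxr.
  by rewrite /= km.
by move=> [H H'] k /= _; split; case: ifP => // km; [exact: H|exact: H'].
Qed.

Let mass_unit_square :
  (lebesgue_measure \x lebesgue_measure) (unit_square R) = 1.
Proof.
have := P_product 1%N (fun=> @measurableT _ (R * R)%type).
rewrite big_ord_recl big_ord0 mule1 setTI => <-.
rewrite (_ : \bigcap_(_ in _) _ = setT) ?probability_setT//.
by apply/seteqP; split.
Qed.

(** The preimage of a rectangle is a product of two rectangles: one constrains the
  coordinates before [j] and the other one the coordinates from [j] on. The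
  unconstrained coordinates have mass one, so the two masses multiply to that of
  the given rectangle, and rectangles determine the measure. *)
Lemma splice_measure_preserving j (B : set Omega) : measurable B ->
  (P \x P) ((fun z : Omega * Omega => splice j z.1 z.2) @^-1` B) = P B.
Proof.
move=> mB.
pose phi := fun z : Omega * Omega => splice j z.1 z.2.
have mphi : measurable_fun setT phi by exact: measurable_splice.
apply/esym; rewrite -[RHS]/(pushforward (P \x P) phi B).
apply: (measure_unique rectangles (fun=> setT)) => //.
- move=> _; exists (0%N, fun=> setT); last by apply/seteqP; split.
  by move=> k; exact: measurableT.
- by apply/seteqP; split => // w _; exists 0%N.
- move=> _ [[m A] /= mA <-].
  pose A1 k := if (k < j)%N then A k else setT.
  pose A2 k := if (k < j)%N then setT else A k.
  rewrite /pushforward.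
  have -> : phi @^-1` cyl (m, A) = cyl (m, A1) `*` cyl (m, A2).
    apply/seteqP; split => -[w w'] /=.
      move=> H; split => k /= km; have := H k km;
        rewrite /zeta /phi /= /splice /A1 /A2; by case: ifP.
    move=> [H1 H2] k /= km; have := H1 k km; have := H2 k km.
    by rewrite /zeta /phi /= /splice /A1 /A2; case: ifP.
  have mA1 k : measurable (A1 k) by rewrite /A1; case: ifP.
  have mA2 k : measurable (A2 k) by rewrite /A2; case: ifP.
  have mc C : (forall k, measurable (C k)) -> measurable (cyl (m, C)).
    by move=> mC; apply: measurable_rectangle; exists (m, C).
  rewrite product_measure1E; [|exact: mc|exact: mc].
  rewrite /cyl/= !P_product// -big_split/=; apply: eq_bigr => k _.
  rewrite /A1 /A2; case: ifP => _.
    by rewrite setTI mass_unit_square mule1.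
  by rewrite setTI mass_unit_square mul1e.
- move=> k; have := probability_le1 P (@measurableT _ Omega).
  by move=> /le_lt_trans; apply; rewrite ltry.
Qed.

End resampling.

(** * Integration of bounded functions and conditional expectations *)

Section almost_everywhere.
Context d (T : measurableType d) {R : realType} (mu : {measure set T -> \bar R}).

Lemma ae_impl (Q Q' : T -> Prop) : (forall w, Q w -> Q' w) ->
  {ae mu, forall w, Q w} -> {ae mu, forall w, Q' w}.
Proof. by move=> QQ'; apply: negligibleS => w /= nQ' /QQ'. Qed.

Lemma ae_conj (Q Q' : T -> Prop) :
  {ae mu, forall w, Q w} -> {ae mu, forall w, Q' w} ->
  {ae mu, forall w, Q w /\ Q' w}.
Proof.
move=> aQ aQ'; have := negligibleU aQ aQ'; apply: negligibleS => w /= /not_andP[].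
  by left.
by right.
Qed.

Lemma ae_forall_nat (Q : nat -> T -> Prop) :
  (forall k, {ae mu, forall w, Q k w}) -> {ae mu, forall w, forall k, Q k w}.
Proof.
move=> aQ; have := negligible_bigcup aQ; apply: negligibleS => w /= /existsNP[k nQ].
by exists k.
Qed.

End almost_everywhere.

Section bounded_integration.
Context d (T : measurableType d) {R : realType} (mu : {measure set T -> \bar R}).

Lemma bounded_integrable (D : set T) (Y : T -> R) M : measurable D ->
  (mu D < +oo)%E -> measurable_fun D Y -> (forall w, D w -> `|Y w| <= M) ->
  mu.-integrable D (EFin \o Y).
Proof.
move=> mD fD mY YM; apply: measurable_bounded_integrable => //.
by exists M; split; [exact: num_real|move=> m Mm w Dw; exact: le_trans (YM _ Dw) (ltW Mm)].
Qed.

End bounded_integration.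

Definition bounded_measurable d (T : measurableType d) (R : realType) (Y : T -> R) :=
  measurable_fun setT Y /\ exists M, forall w, `|Y w| <= M.

Section probability_integration.
Context d (T : measurableType d) {R : realType} (P : probability T R).

Lemma mass_total : (P : {measure set T -> \bar R}) setT = 1%E.
Proof. exact: probability_setT. Qed.

Lemma probability_lty A : measurable A -> (P A < +oo)%E.
Proof.
move=> mA; apply: le_lt_trans (probability_le1 P mA) _; exact: ltry.
Qed.

Lemma bounded_measurable_integrable A Y : measurable A -> bounded_measurable Y ->
  P.-integrable A (EFin \o Y).
Proof.
move=> mA [mY [M YM]]; apply: (bounded_integrable (M := M)) => //.
- exact: probability_lty.
- exact: measurable_funTS.
Qed.

Lemma le_bounded_integral A Y Z : measurable A ->
  bounded_measurable Y -> bounded_measurable Z -> (forall w, A w -> Y w <= Z w) ->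
  \int[P]_(w in A) Y w <= \int[P]_(w in A) Z w.
Proof.
by move=> mA bY bZ; apply: le_Rintegral => //; exact: bounded_measurable_integrable.
Qed.

Lemma ae_eq_bounded_integral A Y Z : measurable A ->
  measurable_fun setT Y -> measurable_fun setT Z -> {ae P, forall w, Y w = Z w} ->
  \int[P]_(w in A) Y w = \int[P]_(w in A) Z w.
Proof.
move=> mA mY mZ YZ; rewrite /Rintegral; congr fine.
apply: ae_eq_integral => //; try by apply/measurable_EFinP; exact: measurable_funTS.
by apply: ae_impl YZ => w + _ => ->.
Qed.

Lemma bounded_measurable_cst c : bounded_measurable (fun _ : T => c : R).
Proof. by split; [exact: measurable_cst|exists `|c| => _]. Qed.

Lemma bounded_measurableD (Y Z : T -> R) :
  bounded_measurable Y -> bounded_measurable Z ->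
  bounded_measurable (fun w => Y w + Z w).
Proof.
move=> [mY [M YM]] [mZ [N ZN]]; split; first exact: measurable_funD.
by exists (M + N) => w; apply: le_trans (ler_normD _ _) _; exact: lerD.
Qed.

Lemma bounded_measurableN (Y : T -> R) :
  bounded_measurable Y -> bounded_measurable (fun w => - Y w).
Proof.
move=> [mY [M YM]]; split; first exact: measurableT_comp.
by exists M => w; rewrite normrN.
Qed.

Lemma probability_integral_cst A c : measurable A ->
  \int[P]_(w in A) c = c * fine (P A).
Proof. by move=> mA; rewrite Rintegral_cst. Qed.

Lemma bounded_integral_le Y M : bounded_measurable Y -> (forall w, `|Y w| <= M) ->
  `|\int[P]_w Y w| <= M.
Proof.
move=> bY YM.
apply: le_trans (le_normr_Rintegral _ _) _ => //.
  exact: bounded_measurable_integrable.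
have -> : M = \int[P]_w M by rewrite Rintegral_cst// mass_total mulr1.
apply: le_bounded_integral => //; last exact: bounded_measurable_cst.
case: bY => mY _; split; first exact: measurableT_comp.
by exists M => w; rewrite normr_id.
Qed.

End probability_integration.

Section splice_integral.
Context {R : realType} (P : probability (Omega R) R).
Hypothesis P_product : is_product_lebesgue P.
Local Notation Omega := (Omega R).

Lemma integrable_prod_bounded (Y : Omega * Omega -> R) :
  bounded_measurable Y -> (P \x P)%E.-integrable setT (EFin \o Y).
Proof.
move=> [mY [M YM]]; apply: (bounded_integrable (M := M)) => //.
suff E : (P \x P)%E setT = 1%E by apply: le_lt_trans (ltry 1); rewrite -E.
by rewrite -setXTT product_measure1E// !mass_total mule1.
Qed.

Lemma fin_inner_integral (Y : Omega * Omega -> R) w : bounded_measurable Y ->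
  (\int[P]_w' (Y (w, w'))%:E)%E = (\int[P]_w' Y (w, w'))%:E.
Proof.
move=> [mY [M YM]]; rewrite /Rintegral fineK//.
apply: integrable_fin_num => //.
apply: bounded_measurable_integrable => //; split; last by exists M.
exact: measurableT_comp.
Qed.

Lemma bounded_measurable_inner (Y : Omega * Omega -> R) : bounded_measurable Y ->
  bounded_measurable (fun w => \int[P]_w' Y (w, w')).
Proof.
move=> bY; have [mY [M YM]] := bY; split.
  apply/measurable_EFinP.
  have := measurable_fubini_F (integrable_prod_bounded bY).
  congr measurable_fun; apply/funext => w.
  by rewrite /fubini_F /= fin_inner_integral.
exists M => w; apply: bounded_integral_le => //; split; last by exists M.
exact: measurableT_comp.
Qed.

Lemma prod_integralE (Y : Omega * Omega -> R) : bounded_measurable Y ->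
  (\int[P \x P]_z (Y z)%:E)%E = (\int[P]_w \int[P]_w' Y (w, w'))%:E.
Proof.
move=> bY; have iY := integrable_prod_bounded bY.
rewrite -[LHS](integral12_prod_meas1 iY) /Rintegral fineK; last first.
  apply: integrable_fin_num => //.
  apply: bounded_measurable_integrable => //.
  exact: bounded_measurable_inner.
by apply: eq_integral => w _; rewrite /fubini_F /= fin_inner_integral.
Qed.

(** Conditioning on [filtration j] amounts to resampling the coordinates from
  [j] on: the inner integral is the conditional expectation. *)
Lemma integral_splice j (A : set Omega) (Y : Omega -> R) :
  filtration j A -> bounded_measurable Y ->
  \int[P]_(w in A) Y w = \int[P]_(w in A) \int[P]_w' Y (splice j w w').
Proof.
move=> /filtrationP[mA dA] [mY [M YM]].
have mYA : measurable_fun setT (Y \_ A) by apply/(measurable_restrictT _ mA); exact: measurable_funTS.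
have YAM w : `|(Y \_ A) w| <= `|M|.
  rewrite patchE; case: ifP => _; last by rewrite normr0.
  by rewrite (le_trans (YM w))// ler_norm.
have bYA : bounded_measurable (Y \_ A) by split => //; exists `|M|.
rewrite Rintegral_mkcond [RHS]Rintegral_mkcond.
rewrite /Rintegral.
pose phi := fun z : Omega * Omega => splice j z.1 z.2.
have mphi : measurable_fun setT phi by exact: measurable_splice.
have bYphi : bounded_measurable (fun z => (Y \_ A) (phi z)).
  by split; [exact: measurableT_comp|exists `|M|].
have -> : (\int[P]_w ((Y \_ A) w)%:E = \int[P \x P]_z ((Y \_ A) (phi z))%:E)%E.
  rewrite -[RHS](@integral_pushforward _ _ _ _ _ phi mphi _ setT (EFin \o (Y \_ A))) //.
  - apply: eq_measure_integral => B mB _.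
    exact: esym (splice_measure_preserving P_product j mB).
  - exact/measurable_EFinP.
  - exact: integrable_prod_bounded.
rewrite prod_integralE//=; apply: eq_Rintegral => w _.
rewrite patchE; case: ifPn => [|nAw].
  rewrite inE => Aw; apply: eq_Rintegral => w' _.
  rewrite patchE mem_set//; apply: dA Aw => k kj.
  by rewrite /phi /splice /= kj.
rewrite -[RHS](_ : \int[P]_w 0 = 0); last by rewrite Rintegral_cst// mul0r.
apply: eq_Rintegral => w' _; rewrite patchE memNset// => Aw.
move: nAw; rewrite mem_set//; apply: dA Aw => k kj.
by rewrite /phi /splice /= kj.
Qed.

Lemma depends_below_measurable_fun j (Z : Omega -> R) :
  measurable_fun setT Z ->
  (forall w w' : Omega, (forall k, (k < j)%N -> w k = w' k) -> Z w = Z w') ->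
  g_sigma_algebra_preimage Z `<=` filtration j.
Proof.
move=> mZ dZ _ [B mB <-]; apply/filtrationP; split; first exact: mZ.
by move=> w w' /dZ; rewrite !setTI /preimage /= => ->.
Qed.

(** Gives the existence of conditional expectations, with a version that reads the
  first [j] coordinates only. *)
Lemma is_cond_exp_splice j (Y : Omega -> R) : bounded_measurable Y ->
  is_cond_exp P (filtration j) Y (fun w => \int[P]_w' Y (splice j w w')).
Proof.
move=> bY; have [mY [M YM]] := bY.
have bI : bounded_measurable (fun w => \int[P]_w' Y (splice j w w')).
  apply: (@bounded_measurable_inner (fun z => Y (splice j z.1 z.2))).
  by split; [exact: measurableT_comp mY (measurable_splice j)|exists M].
split.
- apply: depends_below_measurable_fun; first by case: bI.
  move=> w w' ww'; apply: eq_Rintegral => v _; congr Y.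
  by apply/funext => k; rewrite /splice; case: ifP => // /ww'.
- exact: bounded_measurable_integrable.
- move=> A FA; have mA : measurable A by case/filtrationP: FA.
  rewrite -[LHS]fineK; last by apply: integrable_fin_num => //; exact: bounded_measurable_integrable.
  rewrite -[RHS]fineK; last by apply: integrable_fin_num => //; exact: bounded_measurable_integrable.
  by congr EFin; rewrite -!/(Rintegral _ _ _) -integral_splice.
Qed.

(** The set where [Y] exceeds [c] by a fixed amount is itself a test set. *)
Lemma le_of_integral_le (K : set_system Omega) (Y : Omega -> R) c :
  K `<=` measurable -> g_sigma_algebra_preimage Y `<=` K ->
  P.-integrable setT (EFin \o Y) ->
  (forall A, K A -> \int[P]_(w in A) Y w <= c * fine (P A)) ->
  {ae P, forall w, Y w <= c}.
Proof.
move=> Km YK iY IY.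
pose A n := [set w | c + n.+1%:R^-1 <= Y w].
have KA n : K (A n).
  apply: YK; exists `[c + n.+1%:R^-1, +oo[%classic; first exact: measurable_itv.
  by rewrite setTI; apply/seteqP; split => w; rewrite /A /= in_itv/= andbT.
have mA n : measurable (A n) by exact: Km _ (KA n).
have A0 n : P (A n) = 0%E.
  have := IY _ (KA n).
  have : (c + n.+1%:R^-1) * fine (P (A n)) <= \int[P]_(w in A n) Y w.
    rewrite -probability_integral_cst//; apply: le_Rintegral => //.
    - by apply: bounded_measurable_integrable => //; exact: bounded_measurable_cst.
    - exact: integrableS iY.
  move=> /le_trans/[apply]; rewrite mulrDl gerDl pmulr_rle0// => PA0.
  apply/eqP; rewrite eq_le measure_ge0 andbT.
  by rewrite -[P _]fineK ?lee_fin// ge0_fin_numE// probability_lty.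
have : P.-negligible (\bigcup_n A n).
  by apply: negligible_bigcup => n; exists (A n); split; [exact: mA|exact: A0|].
apply: negligibleS => w /= /negP; rewrite -ltNge -subr_gt0 => cY.
have [n _ nY] := near_infty_natSinv_lt (PosNum cY).
by exists n => //; rewrite /A /= -lerBrDl ltW// nY /=.
Qed.

End splice_integral.

(** * Discretization and measurability *)

Lemma open_mball {R : realType} (E : metricType R) (z : E) (e : R) :
  open (ball z e).
Proof.
rewrite ballEmdist openE => y /= zy; apply/nbhs_ballP.
exists (e - mdist z y); first by rewrite /= subr_gt0.
move=> v /=; rewrite ballEmdist /= => yv.
by apply: le_lt_trans (metric_triangle z y v) _; rewrite -ltrBrDl.
Qed.

Section discretization.
Context d (T : measurableType d) {R : realType}.

(** A form of strong measurability: it is stable under products and survives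
  composition with continuous maps without any study of product Borel
  sigma-algebras. *)
Definition discretizable (S : pseudoMetricType R) (D : set T) (Z : T -> S) :=
  forall e : R, 0 < e -> exists (Y : T -> nat) (s : nat -> S),
    (forall k, measurable (D `&` Y @^-1` [set k])) /\
    forall w, D w -> ball (s (Y w)) e (Z w).

Lemma discretizable_pair (S1 S2 : pseudoMetricType R) (D : set T)
    (Z1 : T -> S1) (Z2 : T -> S2) :
  discretizable D Z1 -> discretizable D Z2 ->
  discretizable D (fun w => (Z1 w, Z2 w)).
Proof.
move=> h1 h2 e e0.
have [Y1 [s1 [mY1 b1]]] := h1 e e0; have [Y2 [s2 [mY2 b2]]] := h2 e e0.
exists (fun w => pickle (Y1 w, Y2 w)), (fun k =>
  if unpickle k is Some ij then (s1 ij.1, s2 ij.2) else (s1 0%N, s2 0%N)).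
split=> [k|w Dw]; last by rewrite pickleK; split; [exact: b1|exact: b2].
case E : (@pickle_inv (nat * nat)%type k) => [[i j]|]; last first.
  rewrite (_ : _ `&` _ = set0)//; apply/seteqP; split => // w [_ /= Yk].
  by rewrite -Yk pickleK_inv in E.
rewrite (_ : _ `&` _ = (D `&` Y1 @^-1` [set i]) `&` (D `&` Y2 @^-1` [set j])).
  exact: measurableI.
have := @pickle_invK (nat * nat)%type k; rewrite E /= => Ek.
apply/seteqP; split => w /=; rewrite -Ek.
  by move=> [Dw /(pcan_inj pickleK)[-> ->]].
by move=> [[Dw ->] [_ ->]].
Qed.

(** If [Z] is replaced by a discretization, then [F] is only used at countably many
  fixed first arguments; continuity allows to pass to the limit. *)
Lemma caratheodory_measurable (S : pseudoMetricType R) (D : set T) (Z : T -> S)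
    (F : S -> T -> R) :
  measurable D -> discretizable D Z -> (forall s, measurable_fun D (F s)) ->
  (forall w, D w -> {for Z w, continuous (F ^~ w)}) ->
  measurable_fun D (fun w => F (Z w) w).
Proof.
move=> mD dZ mF cF.
have /choice[Y /choice[s H]] : forall m : nat, exists (Y : T -> nat) (s : nat -> S),
    (forall k, measurable (D `&` Y @^-1` [set k])) /\
    forall w, D w -> ball (s (Y w)) m.+1%:R^-1 (Z w).
  by move=> m; apply: dZ; rewrite invr_gt0.
apply: (@measurable_fun_cvg _ _ _ _ (fun m w => F (s m (Y m w)) w)).
- move=> m _ B mB.
  rewrite (_ : _ `&` _ = \bigcup_k ((D `&` Y m @^-1` [set k]) `&`
                                   (D `&` F (s m k) @^-1` B))).
    apply: bigcup_measurable => k _; apply: measurableI; first exact: (H m).1.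
    exact: mF.
  apply/seteqP; split => w /=; first by move=> [Dw FB]; exists (Y m w).
  by move=> [k _ [[Dw <-] [_ FB]]].
- move=> w Dw; apply: (@cvg_comp _ _ _ (fun m => s m (Y m w)) (F ^~ w)); last exact: cF.
  apply/cvg_ballP => e e0; near=> m.
  apply: (@le_ball _ _ _ m.+1%:R^-1); last exact/ball_sym/(H m).2.
  apply/ltW; near: m; exact: (near_infty_natSinv_lt (PosNum e0)).
Unshelve. all: by end_near. Qed.

(** A point is coded by the first ball of a finite net that contains it. *)
Lemma discretizable_compact (E : pmetricType R) (D : set T) (Z : T -> E) :
  measurable D -> compact [set: E] -> measurable_fun D (Z : T -> borel E) ->
  discretizable D Z.
Proof.
move=> mD; rewrite compact_cover => cE mZ e e0.
have [|z _|F _ Fcov] := cE E setT (fun z => ball z e).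
- by move=> z _; exact: open_mball.
- by exists z => //; exact: ballxx.
pose l : seq E := finmap.enum_fset F.
exists (fun w => index true [seq `[< ball z e (Z w) >] | z <- l]), (nth point l).
have mball z : measurable (D `&` Z @^-1` ball z e).
  by apply: mZ => //; apply: sub_sigma_algebra; exact: open_mball.
split=> [k|w Dw].
  elim: l k => [|z l IH] k /=.
    case: k => [|k].
      by rewrite (_ : _ @^-1` _ = setT) ?setIT//; apply/seteqP; split.
    by rewrite (_ : _ @^-1` _ = set0) ?setI0//; apply/seteqP; split.
  case: k => [|k].
    rewrite (_ : _ `&` _ = D `&` Z @^-1` ball z e)//.
    apply/seteqP; split => w /= [Dw]; case: (asboolP (ball z e (Z w))) => //.
  rewrite (_ : _ `&` _ = (D `&` (fun w => index true [seq `[< ball z e (Z w) >] | z <- l])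
      @^-1` [set k]) `\` (D `&` Z @^-1` ball z e)).
    by apply: measurableD => //; exact: IH.
  apply/seteqP; split => w /=; case: (asboolP (ball z e (Z w))) => //.
  - by move=> _ [].
  - by move=> nb [Dw [kE]]; split => // -[].
  - by move=> b [[Dw _] /not_andP[]].
  - by move=> nb [[Dw ->] _].
have [z zF zb] := Fcov (Z w) Logic.I.
have ht : true \in [seq `[< ball z e (Z w) >] | z <- l].
  by apply/mapP; exists z => //; apply/esym/asboolP.
have := nth_index false ht.
have : (index true [seq `[< ball z e (Z w) >] | z <- l] < size l)%N.
  by rewrite -(size_map (fun z => `[< ball z e (Z w) >])) index_mem.
by move=> sl; rewrite (nth_map point)// => /asboolP.
Qed.

End discretization.

Section row_vectors.
Context {R : realType} {n : nat}.
Implicit Types (y : 'rV[R]_n) (e : R).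

Lemma normr_row_le y M : 0 <= M -> (forall k, `|y 0 k| <= M) -> `|y| <= M.
Proof.
move=> M0 yM; rewrite [leLHS]/Num.norm/= mx_normrE.
by apply: bigmax_le => // -[i j] _; rewrite /= (ord1 i).
Qed.

Lemma normr_row_ge y k : `|y 0 k| <= `|y|.
Proof.
rewrite [leRHS]/Num.norm/= mx_normrE.
by apply: (le_bigmax _ (fun ij => `|y ij.1 ij.2|) (0, k)).
Qed.

(** The cells of the cubic grid of mesh [e] are numbered by natural numbers, as the
  pieces of the partitions in the definition of admissible controls are. *)
Definition grid_cell e y : nat := pickle (\row_i Num.floor (y 0 i / e)).

Definition grid_point e (k : nat) : 'rV[R]_n :=
  if unpickle k is Some v then \row_i (e * ((v : 'rV[int]_n) 0 i)%:~R) else 0.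

Lemma grid_point_near e y : 0 < e -> `|grid_point e (grid_cell e y) - y| <= e.
Proof.
move=> e0; rewrite /grid_point /grid_cell pickleK.
apply: normr_row_le => [|k]; first exact: ltW.
rewrite !mxE; set a := y 0 k / e.
have -> : y 0 k = e * a by rewrite mulrC divfK ?lt0r_neq0.
have /andP[fl] := real_floor_itv (num_real a); rewrite intrD1 => fu.
rewrite distrC -mulrBr normrM gtr0_norm// ger0_norm ?subr_ge0//.
by rewrite ler_piMr ?lerBlDl ?(ltW e0)// ltW.
Qed.

Lemma measurable_grid_cell d (T : measurableType d) (D : set T)
    (Z : T -> 'rV[R]_n) e k : 0 < e -> measurable D ->
  (forall i, measurable_fun D (fun w => Z w 0 i)) ->
  measurable (D `&` (fun w => grid_cell e (Z w)) @^-1` [set k]).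
Proof.
move=> e0 mD mZ.
case E : (@pickle_inv 'rV[int]_n k) => [v|]; last first.
  rewrite (_ : _ `&` _ = set0)//; apply/seteqP; split => // w [_ /= Yk].
  by rewrite -Yk pickleK_inv in E.
have := @pickle_invK 'rV[int]_n k; rewrite E /= => Ek.
rewrite (_ : _ `&` _ = D `&` \bigcap_(i in [set: 'I_n])
    (D `&` (fun w => Z w 0 i) @^-1` `[e * (v 0 i)%:~R, e * (v 0 i + 1)%:~R[)).
  apply: measurableI => //; apply: fin_bigcap_measurable => // i _.
  by apply: mZ => //; exact: measurable_itv.
apply/seteqP; split => w /=; rewrite -Ek.
  move=> [Dw /(pcan_inj pickleK) vE]; split => // i _; split => //=.
  rewrite -vE mxE in_itv/=.
  have /andP[fl fu] := real_floor_itv (num_real (Z w 0 i / e)).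
  by rewrite mulrC -ler_pdivlMr// fl mulrC -ltr_pdivrMr.
move=> [Dw vw]; split => //; congr pickle; apply/rowP => i; rewrite mxE.
have [_ /=] := vw i Logic.I; rewrite in_itv /= => /andP[fl fu].
apply: floor_def; rewrite ler_pdivlMr// mulrC fl/=.
by rewrite ltr_pdivrMr// mulrC.
Qed.

Lemma discretizable_row d (T : measurableType d) (D : set T) (Z : T -> 'rV[R]_n) :
  measurable D -> (forall i, measurable_fun D (fun w => Z w 0 i)) ->
  discretizable D Z.
Proof.
move=> mD mZ e e0; have e20 : 0 < e / 2 by rewrite divr_gt0.
exists (fun w => grid_cell (e / 2) (Z w)), (grid_point (e / 2)); split.
  by move=> k; exact: measurable_grid_cell.
move=> w _; rewrite mx_norm_ball /ball_ /=.
by apply: le_lt_trans (grid_point_near _ e20) _; rewrite ltr_pdivrMr// ltr_pMr// ltr1n.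
Qed.

End row_vectors.

Lemma discretizable_real {R : realType} d (T : measurableType d) (D : set T) (Z : T -> R) :
  measurable D -> measurable_fun D Z -> discretizable D Z.
Proof.
move=> mD mZ e e0.
have mZ' (i : 'I_1) : measurable_fun D (fun w => (\row_(_ < 1) Z w) 0 i).
  by under eq_fun do rewrite mxE.
have [Y [s [mY bs]]] := discretizable_row mD mZ' e0.
exists Y, (fun k => s k 0 0); split => // w /bs; rewrite mx_norm_ball /ball_/=.
move=> sZ; rewrite /ball/=; apply: le_lt_trans sZ.
by have := normr_row_ge (s (Y w) - \row_(_ < 1) Z w) 0; rewrite !mxE.
Qed.

(** * Differential equations with measurable coefficients *)

Section caratheodory_ode.
Context {R : realType} {n : nat}.
Local Notation mu := (@lebesgue_measure R).
Implicit Types (a b s r K M L : R) (X Y : R -> 'rV[R]_n).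

Definition carath_field a b M L (phi : R -> 'rV[R]_n -> 'rV[R]_n) :=
  [/\ forall y k, measurable_fun `[a, b] (fun r => phi r y 0 k),
      forall r y, a <= r <= b -> `|phi r y| <= M &
      forall r y y', a <= r <= b -> `|phi r y - phi r y'| <= L * `|y - y'|].

Definition solution a b (x : 'rV[R]_n) (phi : R -> 'rV[R]_n -> 'rV[R]_n) X :=
  {within `[a, b], continuous X} /\
  forall s, a <= s <= b ->
    X s = x + \row_k \int[mu]_(r in `[a, s]) phi r (X r) 0 k.

Lemma lipschitz_continuous_at (S : pseudoMetricNormedZmodType R)
    (F : 'rV[R]_n -> S) L z :
  (forall y, `|F y - F z| <= L * `|y - z|) -> {for z, continuous F}.
Proof.
move=> FL; suff : F y @[y --> z] --> F z by [].
apply/(@cvgrPdist_le _ S _ (nbhs z) (nbhs_filter z)) => e e0.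
have M0 : 0 < `|L| + 1 by rewrite ltr_pwDr.
apply/nbhs_ballP; exists ((`|L| + 1)^-1 * e); first by rewrite /= mulr_gt0// invr_gt0.
move=> y; rewrite mx_norm_ball /ball_ /= => /ltW yz; rewrite distrC; apply: le_trans (FL y) _.
apply: (@le_trans _ _ ((`|L| + 1) * `|y - z|)).
  by rewrite ler_wpM2r// (le_trans (ler_norm L))// lerDl.
by rewrite -ler_pdivlMl// distrC.
Qed.

Lemma lipschitz_within (S : pseudoMetricNormedZmodType R) (X : R -> S) a b M :
  (forall s s', a <= s <= b -> a <= s' <= b -> `|X s - X s'| <= M * `|s - s'|) ->
  {within `[a, b], continuous X}.
Proof.
move=> XM; apply/subspace_continuousP => s /= sab.
apply/cvgrPdist_le => e e0.
have M0 : 0 < `|M| + 1 by rewrite ltr_pwDr.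
rewrite near_withinE; near=> s' => s'ab.
apply: (@le_trans _ _ ((`|M| + 1) * `|s - s'|)).
  apply: le_trans (XM _ _ _ _) _; [by rewrite in_itv in sab|by rewrite /= in_itv in s'ab|].
  by rewrite ler_wpM2r// (le_trans (ler_norm M))// lerDl.
rewrite -ler_pdivlMl//; apply: ltW; near: s'.
apply/nbhs_normP; exists ((`|M| + 1)^-1 * e) => //=.
by rewrite mulr_gt0// invr_gt0.
Unshelve. all: by end_near. Qed.

Lemma within_continuous_coord a b X k : {within `[a, b], continuous X} ->
  measurable_fun `[a, b] (fun r => X r 0 k).
Proof.
move=> cX; apply: subspace_continuous_measurable_fun => //.
move=> s; apply: (@continuous_comp (subspace `[a, b]) _ _ X (fun y : 'rV[R]_n => y 0 k) s (cX s)).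
exact: coord_continuous.
Qed.

Section weight.
Variables (a L : R).
Hypothesis L_gt0 : 0 < L.

(** In the norm weighted by the inverse of [growth] the integral operator of an
  [L]-Lipschitz field is a contraction of ratio 1/2 on the whole interval, however
  long it is. *)
Definition growth s := expR (2 * L * (s - a)).

Lemma growth_gt0 s : 0 < growth s. Proof. exact: expR_gt0. Qed.

Lemma growth_ge1 s : a <= s -> 1 <= growth s.
Proof.
by move=> sa; rewrite -expR0 ler_expR mulr_ge0 ?subr_ge0// mulr_ge0// ltW.
Qed.

Let is_derive_growth K s :
  is_derive s (1 : R) (fun r => K / 2 * growth r) (L * K * growth s).
Proof.
have dg : is_derive s (1 : R) (fun r => 2 * L * (r - a)) (2 * L).
  have d1 : is_derive s (1 : R) (id - cst a : R -> R) (1 - 0) by exact: is_deriveB.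
  by have := @is_deriveZ _ _ _ _ (2 * L) _ _ _ d1; rewrite subr0 [_ *: _]mulr1.
have dG := @is_derive1_comp _ expR _ s _ _ (is_derive_expR _) dg.
have := @is_deriveZ _ _ _ _ (K / 2) s 1 _ dG.
rewrite [_ *: (_ * _)](_ : _ = L * K * growth s)//.
by rewrite /growth /GRing.scale/=; field.
Qed.

Let derivable_growth K s : derivable (fun r => K / 2 * growth r) s (1 : R).
Proof. by case: (is_derive_growth K s). Qed.

Let continuous_growth K : continuous (fun r => K / 2 * growth r : R).
Proof.
move=> s; apply: differentiable_continuous; apply/derivable1_diffP.
exact: derivable_growth.
Qed.

Let continuous_growth' K : continuous (fun r => L * K * growth r : R).
Proof.
rewrite (_ : (fun r => _) = (fun r => (2 * L * K) / 2 * growth r)).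
  exact: continuous_growth.
by apply/funext => r; field.
Qed.

Lemma integrable_growth K b : mu.-integrable `[a, b] (EFin \o (fun r => L * K * growth r)).
Proof.
apply: continuous_compact_integrable; first exact: segment_compact.
by apply: continuous_subspaceT; exact: continuous_growth'.
Qed.

Lemma integral_growth_le K s : 0 <= K -> a <= s ->
  \int[mu]_(r in `[a, s]) (L * K * growth r) <= K / 2 * growth s.
Proof.
move=> K0; rewrite le_eqVlt => /predU1P[<-|sa].
  by rewrite set_itv1 Rintegral_set1 mulr_ge0 ?divr_ge0// ltW// growth_gt0.
rewrite /Rintegral (@continuous_FTC2 _ _ (fun r => K / 2 * growth r)) //=.
- by rewrite gerBl mulr_ge0 ?divr_ge0// ltW// growth_gt0.
- by apply: continuous_subspaceT; exact: continuous_growth'.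
- split.
  + by move=> r _; exact: derivable_growth.
  + by apply: cvg_at_right_filter; exact: continuous_growth.
  + by apply: cvg_at_left_filter; exact: continuous_growth.
- move=> r _; rewrite derive1E; have dr := is_derive_growth K r.
  exact: derive_val.
Qed.

End weight.

Section field.
Variables (a b M L : R) (phi : R -> 'rV[R]_n -> 'rV[R]_n).
Hypotheses (L_gt0 : 0 < L) (phiP : carath_field a b M L phi).

Definition path_measurable X := forall k, measurable_fun `[a, b] (fun r => X r 0 k).

Lemma field_path_measurable X : path_measurable X ->
  path_measurable (fun r => phi r (X r)).
Proof.
move=> mX k; case: phiP => mphi _ Lphi.
apply: (@caratheodory_measurable _ _ _ _ _ X (fun y r => phi r y 0 k)) => //.
  exact: discretizable_row.
move=> r; rewrite /= in_itv/= => rab; apply: lipschitz_continuous_at => y.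
apply: le_trans (Lphi r y (X r) rab).
by have := normr_row_ge (phi r y - phi r (X r)) k; rewrite !mxE.
Qed.

Lemma itv_lebesgue_lty (c e : R) : (mu `[c, e]%classic < +oo)%E.
Proof. by rewrite lebesgue_measure_itv/=; case: ifP => _; rewrite ?ltry// -EFinB ltry. Qed.

Lemma sub_itv s r : a <= s <= b -> r \in `[a, s] -> a <= r <= b.
Proof. by rewrite in_itv/= => /andP[as_ sb] /andP[ar rs]; rewrite ar (le_trans rs). Qed.

Lemma field_integrable X s k : path_measurable X -> a <= s <= b ->
  mu.-integrable `[a, s] (EFin \o (fun r => phi r (X r) 0 k)).
Proof.
move=> mX sab; apply: (bounded_integrable (M := M)) => //.
- exact: itv_lebesgue_lty.
- apply: measurable_funS (field_path_measurable mX k) => //.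
  by move=> r /= rs; rewrite /= in_itv/=; exact: sub_itv rs.
- move=> r rs; case: phiP => _ Mphi _.
  by have := Mphi r (X r) (sub_itv sab rs); apply: le_trans; exact: normr_row_ge.
Qed.

(** This contraction property serves for both uniqueness and existence. *)
Lemma field_integral_close X Y K s k : path_measurable X -> path_measurable Y ->
  0 <= K -> a <= s <= b ->
  (forall r, a <= r <= b -> `|X r - Y r| <= K * growth a L r) ->
  `|\int[mu]_(r in `[a, s]) phi r (X r) 0 k - \int[mu]_(r in `[a, s]) phi r (Y r) 0 k|
    <= K / 2 * growth a L s.
Proof.
move=> mX mY K0 sab XY; have /andP[as_ sb] := sab.
have iX := field_integrable k mX sab; have iY := field_integrable k mY sab.
rewrite -RintegralB//; apply: le_trans _ (integral_growth_le L K0 as_).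
have iB : mu.-integrable `[a, s]
    (EFin \o (fun r => phi r (X r) 0 k - phi r (Y r) 0 k)).
  exact: (@integrableB _ _ _ mu _ _ _ _ iX iY).
apply: le_trans (le_normr_Rintegral _ _) _ => //.
apply: le_Rintegral => //.
- exact: (integrable_norm iB).
- exact: integrable_growth.
- move=> r rs; have rab := sub_itv sab rs; case: phiP => _ _ Lphi.
  apply: (@le_trans _ _ `|phi r (X r) - phi r (Y r)|).
    by have := normr_row_ge (phi r (X r) - phi r (Y r)) k; rewrite !mxE.
  apply: le_trans (Lphi _ _ _ rab) _.
  by rewrite -mulrA ler_wpM2l ?XY// ltW.
Qed.

Lemma field_integral_le X s s' k : path_measurable X ->
  a <= s <= b -> a <= s' <= b -> s <= s' ->
  `|\int[mu]_(r in `[a, s']) phi r (X r) 0 k - \int[mu]_(r in `[a, s]) phi r (X r) 0 k|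
    <= M * (s' - s).
Proof.
move=> mX /andP[as_ sb] s'ab ss'.
have iX := field_integrable k mX s'ab.
rewrite (Rintegral_itvB iX); [|by rewrite bnd_simp|by rewrite bnd_simp].
have iX' : mu.-integrable `]s, s'] (EFin \o (fun r => phi r (X r) 0 k)).
  apply: integrableS iX => //.
  by apply: subset_itvr; rewrite bnd_simp.
apply: le_trans (le_normr_Rintegral _ _) _ => //.
have -> : M * (s' - s) = \int[mu]_(r in `]s, s']) M.
  rewrite Rintegral_cst//; congr (_ * _).
  rewrite -[LHS]/(fine (s' - s)%:E); congr fine; apply/esym.
  apply: etrans (lebesgue_measure_itv _) _; rewrite /= lte_fin.
  case: ltP => //= s's; have -> : s' = s by apply/le_anti; rewrite s's.
  by rewrite subrr.
apply: le_Rintegral => //.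
- exact: (integrable_norm iX').
- apply: (bounded_integrable (M := `|M|)) => //.
  by apply: le_lt_trans (itv_lebesgue_lty s s'); apply: le_measure;
     rewrite ?inE//; apply: subset_itvr; rewrite bnd_simp.
- move=> r; rewrite /= in_itv/= => /andP[sr rs']; case: phiP => _ Mphi _.
  have rab : a <= r <= b.
    by rewrite (le_trans as_ (ltW sr)) (le_trans rs')//; case/andP: s'ab.
  by have := Mphi r (X r) rab; apply: le_trans; exact: normr_row_ge.
Qed.

Lemma solution_lipschitz x X : path_measurable X ->
  (forall s, a <= s <= b ->
    X s = x + \row_k \int[mu]_(r in `[a, s]) phi r (X r) 0 k) ->
  forall s s', a <= s <= b -> a <= s' <= b -> `|X s - X s'| <= M * `|s - s'|.
Proof.
move=> mX XE s s' sab s'ab.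
wlog ss' : s s' sab s'ab / s <= s'.
  move=> H; case: (leP s s') => [|/ltW] ss'; first exact: H.
  by rewrite distrC [X in _ * X]distrC; exact: H.
have M0 : 0 <= M by case: phiP => _ Mphi _; exact: le_trans (normr_ge0 _) (Mphi s 0 sab).
apply: normr_row_le => [|k]; first by rewrite mulr_ge0.
rewrite XE// [X in _ - X]XE// !mxE opprD addrACA subrr add0r distrC [X in M * X]distrC.
by rewrite [X in M * X]ger0_norm ?subr_ge0//; exact: field_integral_le.
Qed.

End field.

End caratheodory_ode.

Lemma le_of_le_geometric {R : realType} (D A B : R) :
  (forall m : nat, D <= A + B / 2 ^+ m) -> D <= A.
Proof.
move=> H.
have cA : (fun m : nat => A + geometric B (2^-1) m) @ \oo --> A + 0.
  apply: cvgD; first exact: cvg_cst.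
  by apply: cvg_geometric; rewrite gtr0_norm ?invr_gt0// invf_lt1// ltr1n.
rewrite -[A]addr0 -(cvg_lim _ cA)//.
apply: limr_ge; first by apply/cvg_ex; exists (A + 0).
by near=> m; have := H m; rewrite /geometric/= exprVn.
Unshelve. all: by end_near. Qed.

Section solutions.
Context {R : realType} {n : nat}.
Local Notation mu := (@lebesgue_measure R).
Implicit Types (a b c s r M L : R) (X : R -> 'rV[R]_n) (phi : R -> 'rV[R]_n -> 'rV[R]_n).

Lemma solution_path_measurable a b x phi X :
  solution a b x phi X -> path_measurable a b X.
Proof. by move=> [cX _] k; exact: within_continuous_coord. Qed.

Lemma solution_start a b x phi X : a <= b -> solution a b x phi X -> X a = x.
Proof.
move=> ab [_ XE]; rewrite XE ?lexx//; apply/rowP => k; rewrite !mxE.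
by rewrite set_itv1 Rintegral_set1 addr0.
Qed.

Lemma solution_restrict a b c x phi X : c <= b ->
  solution a b x phi X -> solution a c x phi X.
Proof.
move=> cb [cX XE]; split.
  by apply: continuous_subspaceW cX; apply: subset_itvl; rewrite bnd_simp.
by move=> s /andP[as_ sc]; apply: XE; rewrite as_ (le_trans sc).
Qed.

Lemma solution_flow a b c x M L phi X : carath_field a b M L phi ->
  a <= c <= b -> solution a b x phi X -> solution c b (X c) phi X.
Proof.
move=> phiP cab sX; have mX := solution_path_measurable sX.
case: sX => cX XE; split.
  apply: continuous_subspaceW cX; apply: subset_itvr; rewrite bnd_simp.
  by case/andP: cab.
move=> s /andP[cs sb].
have sab : a <= s <= b by rewrite sb (le_trans _ cs)//; case/andP: cab.
rewrite (XE _ sab) (XE _ cab) -addrA; congr (_ + _); apply/rowP => k.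
rewrite !mxE; have iX := field_integrable phiP k mX sab.
have /andP[ac _] := cab.
rewrite -[X in _ + X]Rintegral_itv_obnd_cbnd; last first.
  by apply: integrableS iX => //; apply: subset_itvr; rewrite bnd_simp.
by rewrite -(Rintegral_itvB iX) ?bnd_simp// addrC subrK.
Qed.

(** Iterating the integral inequality halves the error that is not due to the
  initial values, so this error vanishes. *)
Lemma solution_stable a b M L phi phi' x x' X X' : 0 < L ->
  carath_field a b M L phi -> carath_field a b M L phi' ->
  {ae mu, forall r, a <= r <= b -> forall y, phi r y = phi' r y} ->
  solution a b x phi X -> solution a b x' phi' X' ->
  forall s, a <= s <= b -> `|X s - X' s| <= 2 * `|x - x'| * growth a L s.
Proof.
move=> L0 phiP phiP' eq_phi sX sX'.
have mX := solution_path_measurable sX; have mX' := solution_path_measurable sX'.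
have lX := solution_lipschitz phiP mX sX.2.
have lX' := solution_lipschitz phiP' mX' sX'.2.
have eqX' s k : a <= s <= b -> \int[mu]_(r in `[a, s]) phi' r (X' r) 0 k =
    \int[mu]_(r in `[a, s]) phi r (X' r) 0 k.
  move=> sab; rewrite /Rintegral; congr fine; apply: ae_eq_integral => //.
  - by case/integrableP: (field_integrable phiP' k mX' sab).
  - by case/integrableP: (field_integrable phiP k mX' sab).
  - apply: ae_impl eq_phi => r H rs; congr (_%:E); rewrite H//.
    exact: sub_itv rs.
suff H : forall (m : nat) s, a <= s <= b -> `|X s - X' s| <=
    (2 * `|x - x'| + (`|x - x'| + 2 * (M * (b - a))) / 2 ^+ m) * growth a L s.
  move=> s sab; apply: (@le_of_le_geometric _ _ _
    ((`|x - x'| + 2 * (M * (b - a))) * growth a L s)) => m.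
  by rewrite [_ * growth _ _ _ / _]mulrAC -mulrDl; exact: H.
have M0 s : a <= s <= b -> 0 <= M.
  by move=> sab; case: phiP => _ Mphi _; exact: le_trans (normr_ge0 _) (Mphi s 0 sab).
elim=> [|m IH] s sab; have /andP[as_ sb] := sab.
- have ab := le_trans as_ sb.
  have aab : a <= a <= b by rewrite lexx.
  have := lX s a sab aab; have := lX' s a sab aab.
  rewrite (solution_start ab sX) (solution_start ab sX') ger0_norm ?subr_ge0// => h' h.
  have Msb : M * (s - a) <= M * (b - a) by rewrite ler_wpM2l ?(M0 s)// lerB.
  apply: (@le_trans _ _ (`|x - x'| + 2 * (M * (b - a)))).
    have -> : X s - X' s = (x - x') + (X s - x) - (X' s - x').
      by rewrite [x - x' + _]addrC addrA subrK opprB addrA subrK.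
    apply: le_trans (ler_normB _ _) _; rewrite mulr_natl mulr2n [leRHS]addrA.
    apply: lerD; last exact: le_trans h' Msb.
    by apply: le_trans (ler_normD _ _) _; rewrite lerD2l; exact: le_trans h Msb.
  have g1 := growth_ge1 L0 as_.
  have P0 : 0 <= `|x - x'| + 2 * (M * (b - a)).
    by rewrite addr_ge0// mulr_ge0// mulr_ge0 ?(M0 s)// subr_ge0.
  rewrite expr0 divr1 -[leLHS]mulr1; apply: ler_pM => //.
  by rewrite lerDr mulr_ge0.
- set K := (2 * `|x - x'| + (`|x - x'| + 2 * (M * (b - a))) / 2 ^+ m) in IH *.
  have ab := le_trans as_ sb.
  have K0 : 0 <= K.
    rewrite /K addr_ge0 ?mulr_ge0// ?invr_ge0 ?exprn_ge0//.
    by rewrite addr_ge0// mulr_ge0// mulr_ge0 ?(M0 s)// subr_ge0.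
  have cl k := field_integral_close L0 phiP k mX mX' K0 sab IH.
  apply: (@le_trans _ _ (`|x - x'| + K / 2 * growth a L s)).
    rewrite sX.2// sX'.2// opprD addrACA.
    apply: le_trans (ler_normD _ _) _; rewrite lerD2l.
    apply: normr_row_le => [|k]; first by rewrite mulr_ge0 ?divr_ge0// ltW// growth_gt0.
    by rewrite !mxE eqX'.
  rewrite (_ : _ + _ / 2 ^+ m.+1 = `|x - x'| + K / 2); last first.
    by rewrite /K exprS; field; rewrite expf_neq0.
  by rewrite [leRHS]mulrDl lerD2r ler_peMr//; exact: growth_ge1.
Qed.

Lemma solution_unique a b x M L phi X X' s : 0 < L -> carath_field a b M L phi ->
  solution a b x phi X -> solution a b x phi X' -> a <= s <= b -> X s = X' s.
Proof.
move=> L0 cf sX sX' sab.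
have ae_id : {ae mu, forall r, a <= r <= b -> forall y, phi r y = phi r y}.
  exact: aeW.
have := solution_stable L0 cf cf ae_id sX sX' sab.
by rewrite subrr normr0 mulr0 mul0r normr_le0 subr_eq0 => /eqP.
Qed.

End solutions.

(** * Existence of solutions, measurably in a parameter *)

(** Tonelli's theorem applies to the positive and to the negative part. *)
Lemma measurable_partial_Rintegral {R : realType} d1 d2 (T1 : measurableType d1)
    (T2 : measurableType d2) (m : {sigma_finite_measure set T1 -> \bar R})
    (F : T1 * T2 -> R) : measurable_fun setT F ->
  measurable_fun setT (fun w => \int[m]_r F (r, w)).
Proof.
move=> mF; rewrite /Rintegral; apply: (@measurableT_comp _ _ _ _ _ _ fine) => //.
have mFE : measurable_fun setT (EFin \o F) by exact/measurable_EFinP.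
rewrite (_ : (fun w => _) = (fun w => (\int[m]_r ((EFin \o F)^\+ (r, w)))
                              - (\int[m]_r ((EFin \o F)^\- (r, w))))%E); last first.
  apply/funext => w; rewrite -[fun r => _]/((EFin \o F) \o (fun r => (r, w))).
  by rewrite integralE funepos_comp funeneg_comp.
apply: emeasurable_funB.
- apply: (measurable_fun_fubini_tonelli_G (funepos (EFin \o F))) => //.
  exact: measurable_funepos.
- apply: (measurable_fun_fubini_tonelli_G (funeneg (EFin \o F))) => //.
  exact: measurable_funeneg.
Qed.

Section picard.
Context {R : realType} {n : nat} d (T : measurableType d).
Local Notation mu := (@lebesgue_measure R).
Variables (a b M L : R) (x : 'rV[R]_n) (phi : T -> R -> 'rV[R]_n -> 'rV[R]_n).
Hypotheses (ab : a <= b) (L_gt0 : 0 < L)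
  (phiP : forall w, carath_field a b M L (phi w))
  (mphi : forall y k, measurable_fun (`[a, b] `*` setT)
     (fun z : R * T => phi z.2 z.1 y 0 k)).

Let D : set (R * T) := `[a, b] `*` setT.

Let mD : measurable D. Proof. exact: measurableX. Qed.

Fixpoint picard m (w : T) (s : R) : 'rV[R]_n :=
  if m is m'.+1 then
    x + \row_k \int[mu]_(r in `[a, s]) phi w r (picard m' w r) 0 k
  else x.

Let M_ge0 (w : T) : 0 <= M.
Proof.
by case: (phiP w) => _ Mphi _; apply: le_trans (normr_ge0 _) (Mphi a 0 _); rewrite lexx.
Qed.

Let picard_lipschitz m w s s' : a <= s <= b -> a <= s' <= b ->
  `|picard m w s - picard m w s'| <= M * `|s - s'|.
Proof.
elim: m s s' => [|m IH] s s' sab s'ab; first by rewrite subrr normr0 mulr_ge0 ?(M_ge0 w).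
have mP : path_measurable a b (picard m w).
  by move=> k; apply: within_continuous_coord; exact: lipschitz_within IH.
rewrite /=; wlog ss' : s s' sab s'ab / s <= s'.
  move=> H; case: (leP s s') => [|/ltW] ss'; first exact: H.
  by rewrite distrC [X in _ * X]distrC; exact: H.
apply: normr_row_le => [|k]; first by rewrite mulr_ge0 ?(M_ge0 w).
rewrite !mxE opprD addrACA subrr add0r distrC [X in M * X]distrC.
by rewrite [X in M * X]ger0_norm ?subr_ge0//; exact: field_integral_le.
Qed.

Let picard_path_measurable m w : path_measurable a b (picard m w).
Proof.
by move=> k; apply: within_continuous_coord; apply: lipschitz_within => s s'; exact: picard_lipschitz.
Qed.

Let clamp s := Num.max a (Num.min s b).

Let clamp_in s : a <= clamp s <= b.
Proof. by rewrite /clamp le_max lexx/= ge_max ab/= ge_min lexx orbT. Qed.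

Let clamp_id s : a <= s <= b -> clamp s = s.
Proof.
by move=> /andP[as_ sb]; rewrite /clamp (min_idPl sb) (max_idPr as_).
Qed.

Let clamp_dist s s' : `|clamp s - clamp s'| <= `|s - s'|.
Proof.
rewrite /clamp; wlog ss' : s s' / s <= s'.
  move=> H; case: (leP s s') => [|/ltW] ss'; first exact: H.
  by rewrite distrC [leRHS]distrC; exact: H.
rewrite distrC [leRHS]distrC [leRHS]ger0_norm ?subr_ge0// ler_norml.
rewrite !maxEle !minEle; do 4 ?[case: ifPn; rewrite -?ltNge]; move=> *; lra.
Qed.

(** By continuity in time, a discretization of the time suffices. *)
Let joint_measurable m k :
  (forall s, a <= s <= b -> measurable_fun setT (fun w => picard m w s 0 k)) ->
  measurable_fun D (fun z => picard m z.2 z.1 0 k).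
Proof.
move=> mP.
have : measurable_fun D (fun z : R * T => picard m z.2 (clamp z.1) 0 k).
  apply: (@caratheodory_measurable _ _ R R D fst (fun s z => picard m z.2 (clamp s) 0 k)) => //.
  - by apply: discretizable_real => //; exact: measurable_funTS.
  - move=> s; apply: measurable_funTS.
    exact: (measurableT_comp (mP _ (clamp_in s)) measurable_snd).
  - move=> [s w] _ /=; suff : picard m w (clamp r) 0 k @[r --> s] --> picard m w (clamp s) 0 k by [].
    apply/cvgrPdist_le => e e0.
    have M1 : 0 < M + 1 by rewrite ltr_wpDl// (M_ge0 w).
    near=> r; apply: (@le_trans _ _ ((M + 1) * `|s - r|)).
      apply: (@le_trans _ _ (M * `|clamp s - clamp r|)).
        apply: le_trans _ (picard_lipschitz m w (clamp_in s) (clamp_in r)).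
        by have := normr_row_ge (picard m w (clamp s) - picard m w (clamp r)) k; rewrite !mxE.
      by rewrite ler_pM ?(M_ge0 w)// ?lerDl// clamp_dist.
    rewrite -ler_pdivlMl//; apply: ltW; near: r.
    by apply/nbhs_normP; exists ((M + 1)^-1 * e) => //=; rewrite mulr_gt0// invr_gt0.
apply: eq_measurable_fun => -[s w]; rewrite inE /D /= in_itv/= => -[sab _].
by rewrite clamp_id.
Unshelve. all: by end_near. Qed.

Let picard_measurable m s k : a <= s <= b ->
  measurable_fun setT (fun w => picard m w s 0 k).
Proof.
elim: m s k => [|m IH] s k sab; first exact: measurable_cst.
have mF : measurable_fun D (fun z => phi z.2 z.1 (picard m z.2 z.1) 0 k).
  apply: (@caratheodory_measurable _ _ R _ D (fun z => picard m z.2 z.1)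
    (fun y z => phi z.2 z.1 y 0 k)) => //.
    apply: discretizable_row => // i; apply: joint_measurable => s' s'ab; exact: IH.
  move=> [r w]; rewrite /D /= in_itv/= => -[rab _]; case: (phiP w) => _ _ Lphi.
  apply: lipschitz_continuous_at => y.
  apply: le_trans _ (Lphi r y (picard m w r) rab).
  by have := normr_row_ge (phi w r y - phi w r (picard m w r)) k; rewrite !mxE.
have mE : measurable (`[a, s] `*` [set: T] : set (R * T)) by exact: measurableX.
have sD : `[a, s] `*` [set: T] `<=` D.
  by move=> [r w] /= [rs _]; split => //=; rewrite in_itv/=; exact: sub_itv rs.
under eq_fun do rewrite !mxE.
apply: measurable_funD; first exact: measurable_cst.
have := @measurable_partial_Rintegral R _ _ _ T mu
  ((fun z => phi z.2 z.1 (picard m z.2 z.1) 0 k) \_ (`[a, s] `*` setT)).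
have mr : measurable_fun setT
    ((fun z => phi z.2 z.1 (picard m z.2 z.1) 0 k) \_ (`[a, s] `*` setT)).
  by apply/(measurable_restrictT _ mE); exact: measurable_funS mF.
move=> /(_ mr); congr (measurable_fun _ _); apply/funext => w.
rewrite [RHS]Rintegral_mkcond; apply: eq_Rintegral => r _; rewrite !patchE.
by rewrite in_setX/= in_setT andbT.
Qed.

Let errC := M * (b - a).

Let errC_ge0 (w : T) : 0 <= errC. Proof. by rewrite mulr_ge0 ?(M_ge0 w)// subr_ge0. Qed.

Let picard_step m w s : a <= s <= b ->
  `|picard m.+1 w s - picard m w s| <= errC / 2 ^+ m * growth a L s.
Proof.
elim: m s => [|m IH] s sab; have /andP[as_ sb] := sab.
  have : `|picard 1 w s - picard 1 w a| <= M * `|s - a|.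
    by apply: picard_lipschitz; rewrite // lexx.
  have -> : picard 1 w a = x.
    by apply/rowP => k; rewrite /= !mxE set_itv1 Rintegral_set1 addr0.
  move=> h; rewrite expr0 divr1 -[leLHS]mulr1 ler_pM//; last exact: growth_ge1.
  apply: le_trans h _; rewrite ger0_norm ?subr_ge0// ler_wpM2l ?(M_ge0 w)//.
  by rewrite lerB.
have K0 : 0 <= errC / 2 ^+ m by rewrite divr_ge0 ?(errC_ge0 w)// exprn_ge0.
rewrite [picard m.+2 w s]/= [picard m.+1 w s]/= opprD addrACA subrr add0r.
rewrite (_ : errC / 2 ^+ m.+1 = errC / 2 ^+ m / 2); last first.
  by rewrite exprS; field; rewrite expf_neq0.
apply: normr_row_le => [|k].
  by rewrite mulr_ge0 ?divr_ge0// ?exprn_ge0 ?(errC_ge0 w)// ltW// growth_gt0.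
rewrite !mxE.
exact: (field_integral_close L_gt0 (phiP w) k (@picard_path_measurable m.+1 w)
  (@picard_path_measurable m w) K0 sab IH).
Qed.

Let limit w s : 'rV[R]_n := \row_k lim (picard m w s 0 k @[m --> \oo]).

Let picard_coord_step m w s k : a <= s <= b ->
  `|picard m.+1 w s 0 k - picard m w s 0 k| <= errC / 2 ^+ m * growth a L s.
Proof.
move=> sab; apply: le_trans _ (picard_step m w sab).
by have := normr_row_ge (picard m.+1 w s - picard m w s) k; rewrite !mxE.
Qed.

Let picard_cvg w s k : a <= s <= b ->
  picard m w s 0 k @[m --> \oo] --> limit w s 0 k.
Proof.
move=> sab; rewrite mxE.
pose u m := picard m w s 0 k.
suff : cvgn u by [].
have -> : u = (fun m => u 0%N + series (telescope u) m).
  by apply/funext => m; rewrite telescopeK /= addrC subrK.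
apply: is_cvgD; first exact: is_cvg_cst.
apply: normed_cvg; apply: (@series_le_cvg _ _ (geometric (errC * growth a L s) 2^-1)) => //.
- move=> m /=; exact: normr_ge0.
- move=> m; apply: geometric_ge0; last by rewrite invr_ge0.
  by rewrite mulr_ge0 ?(errC_ge0 w)// ltW// growth_gt0.
- move=> m; rewrite /geometric/= exprVn mulrAC; exact: picard_coord_step.
- apply: is_cvg_geometric_series.
  by rewrite gtr0_norm ?invr_gt0// invf_lt1// ltr1n.
Qed.

Let picard_tail m j w s : a <= s <= b ->
  `|picard (m + j) w s - picard m w s| <= 2 * errC / 2 ^+ m * growth a L s.
Proof.
move=> sab; have g0 : 0 <= growth a L s by rewrite ltW// growth_gt0.
suff : `|picard (m + j) w s - picard m w s| <=
    2 * (errC / 2 ^+ m - errC / 2 ^+ (m + j)) * growth a L s.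
  move=> /le_trans; apply; rewrite ler_wpM2r// -mulrA ler_wpM2l// gerBl.
  by rewrite divr_ge0 ?(errC_ge0 w)// exprn_ge0.
elim: j => [|j IH]; first by rewrite addn0 !subrr mulr0 mul0r normr0.
rewrite addnS -(subrK (picard (m + j) w s) (picard (m + j).+1 w s)) -addrA.
apply: le_trans (ler_normD _ _) _.
apply: le_trans (lerD (picard_step _ _ sab) IH) _.
rewrite -mulrDl ler_wpM2r// exprS.
suff -> : errC / (2 * 2 ^+ (m + j)) = errC / 2 ^+ (m + j) / 2 by lra.
by field; rewrite expf_neq0.
Qed.

Let limit_close m w s : a <= s <= b ->
  `|limit w s - picard m w s| <= 2 * errC / 2 ^+ m * growth a L s.
Proof.
move=> sab; have g0 : 0 <= growth a L s by rewrite ltW// growth_gt0.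
apply: normr_row_le => [|k].
  by rewrite mulr_ge0// divr_ge0 ?exprn_ge0// mulr_ge0// (errC_ge0 w).
rewrite [in leLHS]mxE [X in _ + X]mxE.
have cv : `|picard j w s 0 k - picard m w s 0 k| @[j --> \oo] -->
    `|limit w s 0 k - picard m w s 0 k|.
  by apply: cvg_norm; apply: cvgB; [exact: picard_cvg|exact: cvg_cst].
rewrite -(cvg_lim _ cv)//; apply: limr_le; first by apply/cvg_ex; eexists; exact: cv.
near=> j; have mj : (m <= j)%N by near: j; exact: nbhs_infty_ge.
rewrite -(subnKC mj); apply: le_trans _ (picard_tail m (j - m) w sab).
by have := normr_row_ge (picard (m + (j - m)) w s - picard m w s) k; rewrite !mxE.
Unshelve. all: by end_near. Qed.

Let limit_path_measurable w : path_measurable a b (limit w).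
Proof.
move=> k; apply: (@measurable_fun_cvg _ _ _ _ (fun m r => picard m w r 0 k)).
  by move=> m; exact: picard_path_measurable.
by move=> r /=; rewrite in_itv/=; exact: picard_cvg.
Qed.

Let limit_solution w : solution a b x (phi w) (limit w).
Proof.
have LE s : a <= s <= b ->
    limit w s = x + \row_k \int[mu]_(r in `[a, s]) phi w r (limit w r) 0 k.
  move=> sab; apply/eqP; rewrite -subr_eq0 -normr_le0.
  have g0 : 0 <= growth a L s by rewrite ltW// growth_gt0.
  apply: (@le_of_le_geometric _ _ _ (2 * errC * growth a L s)) => m; rewrite add0r.
  set Y := x + _; rewrite -(subrK (picard m.+1 w s) (limit w s)) -addrA.
  apply: le_trans (ler_normD _ _) _.
  have K0 : 0 <= 2 * errC / 2 ^+ m.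
    by rewrite divr_ge0 ?exprn_ge0// mulr_ge0// (errC_ge0 w).
  have cl : `|picard m.+1 w s - Y| <= 2 * errC / 2 ^+ m / 2 * growth a L s.
    rewrite /Y [picard m.+1 w s]/= opprD addrACA subrr add0r.
    apply: normr_row_le => [|k]; first by apply: mulr_ge0 => //; exact: divr_ge0.
    rewrite !mxE distrC.
    exact: (field_integral_close L_gt0 (phiP w) k (@limit_path_measurable w)
      (@picard_path_measurable m w) K0 sab (@limit_close m w)).
  apply: le_trans (lerD (limit_close m.+1 w sab) cl) _.
  rewrite le_eqVlt; apply/orP; left; apply/eqP.
  by rewrite exprS; field; rewrite expf_neq0.
split => //; apply: lipschitz_within.
exact: (solution_lipschitz (phiP w) (@limit_path_measurable w) LE).
Qed.

(** The parameter is carried along the Picard iteration because measurability in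
  [w] cannot be read off the solutions: it passes to the limit from the iterates. *)
Lemma solution_exists : exists X : T -> R -> 'rV[R]_n,
  (forall w, solution a b x (phi w) (X w)) /\
  forall s k, a <= s <= b -> measurable_fun setT (fun w => X w s 0 k).
Proof.
exists limit; split => // s k sab.
apply: (@measurable_fun_cvg _ _ _ _ (fun m w => picard m w s 0 k)).
  by move=> m; exact: picard_measurable.
by move=> w _; exact: picard_cvg.
Qed.

End picard.

(** * Essential bounds *)

Section essential_bounds.
Context {R : realType} (P : probability (Omega R) R).
Local Notation Omega := (Omega R).

Lemma ae_le_of_integral (Y Z : Omega -> R) :
  bounded_measurable Y -> bounded_measurable Z -> (forall w, Z w <= Y w) ->
  \int[P]_w Y w <= \int[P]_w Z w -> {ae P, forall w, Y w <= Z w}.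
Proof.
move=> bY bZ ZY IYZ.
have bD : bounded_measurable (fun w => Y w - Z w).
  by apply: bounded_measurableD => //; exact: bounded_measurableN.
have : {ae P, forall w, Y w - Z w <= 0}.
  apply: (@le_of_integral_le _ P measurable) => //.
  - move=> _ [B mB <-]; exact: bD.1.
  - exact: bounded_measurable_integrable.
  - move=> A mA; rewrite mul0r.
    apply: (@le_trans _ _ (\int[P]_w (Y w - Z w))).
      rewrite Rintegral_mkcond; apply: le_bounded_integral => //.
        split; first by apply/(measurable_restrictT _ mA); exact: measurable_funTS bD.1.
        have [_ [M HM]] := bD; exists M => w; rewrite patchE; case: ifP => // _.
        by rewrite normr0; exact: le_trans (normr_ge0 _) (HM w).
      move=> w _; rewrite patchE; case: ifP => // _.
      by rewrite subr_ge0.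
    rewrite RintegralB//; [|exact: bounded_measurable_integrable..].
    by rewrite subr_le0.
by apply: ae_impl => w; rewrite subr_le0.
Qed.

(** The infimum of a suitable countable subfamily: one whose infimum has the
  least integral among all countable subfamilies. *)
Lemma essinf_exists (I : Type) (A : set I) (X : I -> Omega -> \bar R)
    (x : I -> Omega -> R) M :
  (forall a, A a -> measurable_fun setT (x a)) ->
  (forall a w, A a -> `|x a w| <= M) ->
  (forall a, A a -> {ae P, forall w, X a w = (x a w)%:E}) ->
  exists Y, is_essinf P A X Y.
Proof.
move=> mx xM Xx.
have [[a0 Aa0]|A0] := pselect (A !=set0); last first.
  exists (cst +oo%E); split; first exact: measurable_cst.
    by move=> a Aa; exfalso; apply: A0; exists a.
  by move=> Z _ _; apply: aeW => w; exact: leey.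
pose m (s : nat -> I) w := inf (range (fun k => x (s k) w)).
pose S := [set s : nat -> I | forall k, A (s k)].
have lb s w : S s -> has_lbound (range (fun k => x (s k) w)).
  by move=> Ss; exists (- M) => _ [k _ <-]; have := xM _ w (Ss k); rewrite ler_norml => /andP[].
have mle s w k : S s -> m s w <= x (s k) w.
  by move=> Ss; apply: ge_inf; [exact: lb|exists k].
have lem s w c : (forall k, c <= x (s k) w) -> c <= m s w.
  by move=> cx; apply: lb_le_inf; [exists (x (s 0%N) w), 0%N|move=> _ [k _ <-]].
have bm s : S s -> bounded_measurable (m s).
  move=> Ss; split.
    have := @measurable_fun_infs _ _ R setT (fun k => x (s k)) 0%N
      (fun w _ => lb s w Ss) (fun k => mx _ (Ss k)).
    congr (measurable_fun _ _); apply/funext => w; congr inf.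
    by apply/seteqP; split => _ [k _ <-]; exists k.
  exists M => w; rewrite ler_norml; apply/andP; split.
    by apply: lem => k; have := xM _ w (Ss k); rewrite ler_norml => /andP[].
  apply: le_trans (mle s w 0%N Ss) _.
  by have := xM _ w (Ss 0%N); rewrite ler_norml => /andP[].
pose v s := \int[P]_w m s w.
pose vs := inf (v @` S).
have vlb : has_lbound (v @` S).
  exists (- M) => _ [s Ss <-].
  have : `|v s| <= M; last by rewrite ler_norml => /andP[].
  apply: bounded_integral_le; first exact: bm.
  move=> w; rewrite ler_norml; apply/andP; split.
    by apply: lem => k; have := xM _ w (Ss k); rewrite ler_norml => /andP[].
  apply: le_trans (mle s w 0%N Ss) _.
  by have := xM _ w (Ss 0%N); rewrite ler_norml => /andP[].
have vn0 : (v @` S) !=set0 by exists (v (fun=> a0)), (fun=> a0).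
have /choice[sj sjP] : forall j : nat, exists s, S s /\ v s < vs + j.+1%:R^-1.
  move=> j; have [_ [s Ss <-] sv] := @inf_adherent R _ j.+1%:R^-1 (ltac:(by [])) (conj vn0 vlb).
  by exists s.
pose s k := if @pickle_inv (nat * nat)%type k is Some (j, i) then sj j i else a0.
have Ss : S s.
  by move=> k; rewrite /s; case: pickle_inv => [[j i]|//]; exact: (sjP j).1.
have vsE : v s <= vs.
  apply/ler_addgt0Pl => e e0.
  have [j _ je] := near_infty_natSinv_lt (PosNum e0).
  rewrite addrC; apply: (@le_trans _ _ (v (sj j))).
    apply: le_bounded_integral => //; [exact: bm|by apply: bm; exact: (sjP j).1|].
    move=> w _; apply: lem => i.
    have := mle s w (pickle (j, i)) Ss.
    by rewrite {2}/s pickleK_inv.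
  apply: ltW; apply: lt_trans (sjP j).2 _; rewrite ltrD2l.
  by apply: je => /=.
exists (fun w => (m s w)%:E); split.
- by apply/measurable_EFinP; exact: (bm s Ss).1.
- move=> a Aa.
  pose s' k := if k is k'.+1 then s k' else a.
  have Ss' : S s' by move=> [|k] //=; exact: Ss.
  have : {ae P, forall w, m s w <= m s' w}.
    apply: ae_le_of_integral; [exact: bm|exact: bm| |].
      by move=> w; apply: lem => k; exact: (mle s' w k.+1).
    by apply: le_trans vsE _; apply: ge_inf => //; exists s'.
  move=> H; apply: ae_impl (ae_conj H (Xx a Aa)) => w [h ->].
  by rewrite lee_fin; exact: le_trans h (mle s' w 0%N Ss').
- move=> Z mZ HZ.
  have : {ae P, forall w, forall k, (Z w <= X (s k) w)%E /\ X (s k) w = (x (s k) w)%:E}.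
    by apply: ae_forall_nat => k; apply: ae_conj; [exact: HZ|exact: Xx].
  apply: ae_impl => w H.
  case EZ : (Z w) => [z| |].
  + rewrite lee_fin; apply: lem => k; have [+ Xk] := H k.
    by rewrite Xk EZ lee_fin.
  + by have [+ Xk] := H 0%N; rewrite Xk EZ leye_eq.
  + exact: leNye.
Qed.

Lemma is_essinfN (I : Type) (A : set I) (X : I -> Omega -> \bar R) Y :
  is_essinf P A (fun a w => - X a w)%E Y -> is_esssup P A X (fun w => - Y w)%E.
Proof.
move=> [mY YX YZ]; split.
- exact: measurableT_comp.
- by move=> a /YX; apply: ae_impl => w; rewrite leeNr.
- move=> Z mZ XZ.
  have := YZ (fun w => - Z w)%E; have mNZ : measurable_fun setT (fun w => - Z w)%E.
    exact: measurableT_comp.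
  move=> /(_ mNZ); have HZ a : A a -> {ae P, forall w, (- Z w <= - X a w)%E}.
    by move=> /XZ; apply: ae_impl => w; rewrite leeN2.
  by move=> /(_ HZ); apply: ae_impl => w; rewrite leeNl.
Qed.

Lemma ae_le_cst (Y : Omega -> \bar R) (c : R) :
  (forall e : R, 0 < e -> {ae P, forall w, (Y w <= (c + e)%:E)%E}) ->
  {ae P, forall w, (Y w <= c%:E)%E}.
Proof.
move=> H.
have : {ae P, forall w, forall k : nat, (Y w <= (c + k.+1%:R^-1)%:E)%E}.
  by apply: ae_forall_nat => k; apply: H; rewrite invr_gt0.
apply: ae_impl => w Hw; apply/lee_addgt0Pr => e e0.
have [j _ je] := near_infty_natSinv_lt (PosNum e0).
apply: le_trans (Hw j) _; rewrite -EFinD lee_fin lerD2l.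
by apply: ltW; apply: je => /=.
Qed.

Lemma ae_ge_cst (Y : Omega -> \bar R) (c : R) :
  (forall e : R, 0 < e -> {ae P, forall w, ((c - e)%:E <= Y w)%E}) ->
  {ae P, forall w, (c%:E <= Y w)%E}.
Proof.
move=> H.
have : {ae P, forall w, (- Y w <= (- c)%:E)%E}.
  apply: ae_le_cst => e /H; apply: ae_impl => w.
  by rewrite leeNl -EFinN opprD opprK.
by apply: ae_impl => w; rewrite EFinN leeN2.
Qed.

Section sup_inf.
Variables (I J : Type) (A : set I) (B : set J) (c : R).

(** The essential infima are chosen versions, so that nothing can be said of them
  unless they exist; the constant [c] is then an essential supremum by squeezing. *)
Lemma esssup_essinf_cst (X : I -> J -> Omega -> \bar R) :
  (forall a, A a -> exists Y, is_essinf P B (X a) Y) ->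
  (forall a (e : R), A a -> 0 < e ->
     exists2 b, B b & {ae P, forall w, (X a b w <= (c + e)%:E)%E}) ->
  (forall e : R, 0 < e -> exists2 a, A a &
     forall b, B b -> {ae P, forall w, ((c - e)%:E <= X a b w)%E}) ->
  {ae P, forall w, esssup P A (fun a => essinf P B (X a)) w = c%:E}.
Proof.
move=> ex up low.
have infP a : A a -> is_essinf P B (X a) (essinf P B (X a)).
  by move=> /ex exY; apply: getPex.
have cP : is_esssup P A (fun a => essinf P B (X a)) (cst c%:E).
  split; first exact: measurable_cst.
  - move=> a Aa; apply: ae_le_cst => e e0; have [b Bb Xb] := up a e Aa e0.
    have [_ leX _] := infP a Aa.
    by apply: ae_impl (ae_conj (leX b Bb) Xb) => w [/le_trans]; apply.
  - move=> Z mZ XZ; apply: ae_ge_cst => e e0; have [a Aa Xa] := low e e0.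
    have [_ _ glb] := infP a Aa.
    have := glb _ (measurable_cst _) Xa => le1.
    by apply: ae_impl (ae_conj le1 (XZ a Aa)) => w [/le_trans]; apply.
have [mS ub lub] : is_esssup P A (fun a => essinf P B (X a))
    (esssup P A (fun a => essinf P B (X a))) by apply: getPex; exists (cst c%:E).
have [mc ubc lubc] := cP.
apply: ae_impl (ae_conj (lub _ mc ubc) (lubc _ mS ub)) => w [h1 h2].
by apply/le_anti; rewrite h1 h2.
Qed.

Lemma essinf_esssup_cst (X : I -> J -> Omega -> \bar R) :
  (forall a, A a -> exists Y, is_esssup P B (X a) Y) ->
  (forall a (e : R), A a -> 0 < e ->
     exists2 b, B b & {ae P, forall w, ((c - e)%:E <= X a b w)%E}) ->
  (forall e : R, 0 < e -> exists2 a, A a &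
     forall b, B b -> {ae P, forall w, (X a b w <= (c + e)%:E)%E}) ->
  {ae P, forall w, essinf P A (fun a => esssup P B (X a)) w = c%:E}.
Proof.
move=> ex low up.
have supP a : A a -> is_esssup P B (X a) (esssup P B (X a)).
  by move=> /ex exY; apply: getPex.
have cP : is_essinf P A (fun a => esssup P B (X a)) (cst c%:E).
  split; first exact: measurable_cst.
  - move=> a Aa; apply: ae_ge_cst => e e0; have [b Bb Xb] := low a e Aa e0.
    have [_ leX _] := supP a Aa.
    by apply: ae_impl (ae_conj Xb (leX b Bb)) => w [/le_trans]; apply.
  - move=> Z mZ XZ; apply: ae_le_cst => e e0; have [a Aa Xa] := up e e0.
    have [_ _ lub] := supP a Aa.
    have := lub _ (measurable_cst _) Xa => le1.
    by apply: ae_impl (ae_conj (XZ a Aa) le1) => w [/le_trans]; apply.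
have [mS lb glb] : is_essinf P A (fun a => esssup P B (X a))
    (essinf P A (fun a => esssup P B (X a))) by apply: getPex; exists (cst c%:E).
have [mc lbc glbc] := cP.
apply: ae_impl (ae_conj (glb _ mc lbc) (glbc _ mS lb)) => w [h1 h2].
by apply/le_anti; rewrite h1 h2.
Qed.

End sup_inf.

End essential_bounds.

(** * Controls *)

Section sections_of_controls.
Context {R : realType} {E : pmetricType R}.
Local Notation Omega := (Omega R).
Implicit Types (u : R -> Omega -> E) (a b : R).

Definition jointly_measurable a b u :=
  measurable_fun (`[a, b] `*` setT) (fun z : R * Omega => u z.1 z.2 : borel E).

Lemma measurable_strip a b : measurable (`[a, b] `*` setT : set (R * Omega)).
Proof. exact: measurableX. Qed.

Lemma jointly_measurable_sub a b a' b' u : a <= a' -> b' <= b ->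
  jointly_measurable a b u -> jointly_measurable a' b' u.
Proof.
move=> aa' bb'; apply: measurable_funS; first exact: measurable_strip.
move=> [s w] /= [+ _]; rewrite !in_itv/= => /andP[as_ sb]; split=> //.
by rewrite (le_trans aa')// (le_trans sb).
Qed.

Lemma jointly_measurable_at a b u s : jointly_measurable a b u -> a <= s <= b ->
  measurable_fun setT (u s : Omega -> borel E).
Proof.
move=> mu_ sab; apply: (@measurable_comp _ _ _ _ _ _ (`[a, b] `*` setT)
  (fun z : R * Omega => u z.1 z.2 : borel E) _ (fun w => (s, w))) => //.
- exact: measurable_strip.
- by move=> _ [w _ <-]; split => //=; rewrite in_itv.
- by apply: measurable_fun_pair.
Qed.

(** Singletons are Borel sets, so the event that [u s] takes the value [u s w]
  cannot distinguish [w] from [w']. Being pointwise, this replaces a joint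
  measurability of the control with respect to the coordinate. *)
Lemma L0_depends (K : set_system Omega) j a b u : K `<=` coordinate_event j ->
  L0 K a b u -> forall s (w w' : Omega), a <= s <= b -> w j = w' j -> u s w = u s w'.
Proof.
move=> Kj [_ Ku] s w w' sab ww'.
have m1 : measurable ([set u s w] : set (borel E)).
  rewrite -(setCK [set u s w]); apply: measurableC; apply: sub_sigma_algebra.
  apply: closed_openC; apply: accessible_closed_set1.
  exact/hausdorff_accessible/metric_hausdorff.
have /Kj[_ H] : K (setT `&` (u s : Omega -> borel E) @^-1` [set u s w]).
  by apply: (Ku s sab); exists [set u s w].
by have [_ /= ->] := H w w' ww' (conj Logic.I erefl).
Qed.

Lemma L0_measurable a b u : jointly_measurable a b u -> L0 measurable a b u.
Proof.
move=> mu_; split => // s sab _ [B mB <-].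
exact: (jointly_measurable_at mu_ sab).
Qed.

Lemma L0_point (K : set_system Omega) a b : K set0 -> K setT ->
  L0 K a b (fun _ _ => point : E).
Proof.
move=> K0 KT; split; first exact: measurable_cst.
move=> s _ _ [B mB <-]; rewrite setTI.
have [pB|pB] := pselect (B point).
  by rewrite (_ : _ @^-1` _ = setT)//; apply/seteqP; split.
by rewrite (_ : _ @^-1` _ = set0)//; apply/seteqP; split.
Qed.

End sections_of_controls.

(** What is used of the sigma-fields [infoU] and [infoV]. *)
Definition information {R : realType} (info : nat -> set_system (Omega R)) :=
  [/\ forall j, info j `<=` coordinate_event j,
      forall j, info j set0 & forall j, info j setT].

Section control_sets.
Context {R : realType} (n : nat) (p : nat -> R) (T : R).
Hypothesis p_partition : is_partition T n p.
Context {E : pmetricType R} (info : nat -> set_system (Omega R)).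
Hypothesis info_coordinate : forall j, info j `<=` coordinate_event j.
Hypotheses (info_set0 : forall j, info j set0) (info_setT : forall j, info j setT).
Local Notation Omega := (Omega R).
Implicit Types (u : R -> Omega -> E).

Lemma partition_le j k : (j <= k)%N -> (k <= n)%N -> p j <= p k.
Proof.
case: p_partition => _ _ plt; elim: k => [|k IH].
  by rewrite leqn0 => /eqP ->.
rewrite leq_eqVlt => /predU1P[->//|jk] kn.
by apply: le_trans (IH jk (ltnW kn)) _; apply/ltW/plt.
Qed.

Lemma stage_unique j k s : (j < n)%N -> (k < n)%N ->
  p j <= s < p j.+1 -> p k <= s < p k.+1 -> j = k.
Proof.
wlog jk : j k / (j <= k)%N.
  move=> H; case: (leqP j k) => [|/ltnW] jk; first exact: H.
  by move=> jn kn js ks; apply/esym; apply: H.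
move=> jn kn /andP[_ sj] /andP[ks _].
move: jk; rewrite leq_eqVlt => /predU1P[//|jk].
by have := partition_le jk (ltnW kn); rewrite leNgt (le_lt_trans ks sj).
Qed.

Lemma admissible_joint u : admissible n p info u -> jointly_measurable (p 0%N) (p n) u.
Proof. by case=> -[]. Qed.

(** The countable partition as the level sets of an index. *)
Lemma admissible_index u j : admissible n p info u -> (j < n)%N ->
  exists (kappa : Omega -> nat) (c : nat -> R -> Omega -> E),
    [/\ forall k, filtration j (kappa @^-1` [set k]),
        forall k, L0 (info j) (p j) (p j.+1) (c k) &
        forall s w, p j <= s < p j.+1 -> u s w = c (kappa w) s w].
Proof.
move=> [_ /(_ j)] + jn => /(_ jn)[G [c [FG tG UG Lc uc]]].
have /choice[kappa kP] : forall w, exists k, G k w.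
  by move=> w; have : setT w by []; rewrite -UG => -[k _ Gk]; exists k.
exists kappa, c; split => // [k|s w sj]; last exact: uc.
suff -> : kappa @^-1` [set k] = G k by [].
apply/seteqP; split => w /= => [<-|Gk]; first exact: kP.
by move/trivIsetP : tG => /(_ (kappa w) k Logic.I Logic.I) H;
   apply: contrapT => /eqP /H; rewrite -subset0 => /(_ w); apply; split.
Qed.

Lemma admissible_depends u j s (w w' : Omega) : admissible n p info u ->
  (j <= n)%N -> p 0%N <= s < p j -> (forall k, (k < j)%N -> w k = w' k) ->
  u s w = u s w'.
Proof.
move=> Au jn /andP[s0 sj] ww'.
have [k kj /andP[ks sk]] : exists2 k, (k < j)%N & p k <= s < p k.+1.
  elim: j jn sj {ww'} => [|j IH] jn sj; first by move: sj; rewrite ltNge s0.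
  have [js|js] := leP (p j) s; first by exists j => //; rewrite js.
  by have [k kj H] := IH (ltnW jn) js; exists k => //; exact: ltnW.
have [kappa [c [Fk Lc uc]]] := admissible_index Au (leq_trans kj jn).
rewrite !uc ?ks//.
have -> : kappa w' = kappa w.
  have /filtrationP[_ H] := Fk (kappa w).
  by apply: (H w w') => // m mk; apply: ww'; exact: ltn_trans kj.
apply: (L0_depends (@info_coordinate k) (Lc _)) => //; last exact: ww'.
by rewrite ks ltW.
Qed.

(** Controls are built stage after stage; the new piece on stage [j] is chosen
  among countably many by an index known at the start of the stage. *)
Definition replace_stage j (kappa : Omega -> nat) (c : nat -> R -> Omega -> E) u :=
  fun s w => if p j <= s < p j.+1 then c (kappa w) s w else u s w.

Lemma admissible_replace_stage j kappa c u : (j < n)%N ->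
  (forall k, filtration j (kappa @^-1` [set k])) ->
  (forall k, L0 (info j) (p j) (p j.+1) (c k)) ->
  admissible n p info u -> admissible n p info (replace_stage j kappa c u).
Proof.
move=> jn Fk Lc Au; split.
  apply: L0_measurable => _ B mB.
  pose D : set (R * Omega) := `[p 0%N, p n] `*` setT.
  pose Dj : set (R * Omega) := `[p j, p j.+1[ `*` setT.
  rewrite (_ : _ `&` _ =
      (\bigcup_k ((setT `*` (kappa @^-1` [set k])) `&` (Dj `&`
         ((`[p j, p j.+1] `*` setT) `&` (fun z : R * Omega => c k z.1 z.2) @^-1` B))))
      `|` ((D `&` (fun z : R * Omega => u z.1 z.2) @^-1` B) `\` Dj)).
    have mDj : measurable Dj by exact: measurableX.
    apply: measurableU.
      apply: bigcup_measurable => k _; apply: measurableI.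
        by apply: measurableX => //; have /filtrationP[] := Fk k.
      apply: measurableI => //; apply: (Lc k).1 => //.
      exact: measurable_strip.
    apply: measurableD => //; apply: (admissible_joint Au) => //.
    exact: measurable_strip.
  apply/seteqP; split => -[s w] /=; rewrite /replace_stage /D /Dj /= !in_itv/=.
    case: ifP => [sj [[s0 _] Bc]|sj [[s0 _] Bu]].
      have /andP[js js'] := sj.
      by left; exists (kappa w) => //; repeat split; rewrite //= ?in_itv/= ?js ?js' ?(ltW js').
    by right; split => //; rewrite ?in_itv/= ?sj => -[].
  move=> [[k _ [[_ kw] [[sj _] [_ Bc]]]]|[[[s0 _] Bu] nsj]].
    rewrite /= in_itv/= in sj; split; last by rewrite sj kw.
    split => //; case/andP: sj => js sj; rewrite /= ?in_itv/=.
    rewrite (le_trans _ js) ?partition_le ?(ltnW jn)//= (le_trans (ltW sj))//.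
    exact: partition_le.
  split => //; case: ifPn => // sj; exfalso; apply: nsj.
  by split => //; rewrite /= ?in_itv.
move=> m mn; have [mj|mj] := eqVneq m j.
  rewrite mj; exists (fun k => kappa @^-1` [set k]), c; split => //.
  - by apply/trivIsetP => k k' _ _ kk'; apply/seteqP; split => // w [/= -> /eqP]; rewrite (negbTE kk').
  - by apply/seteqP; split => // w _; exists (kappa w).
  - by move=> k s w sj /= kw; rewrite /replace_stage sj kw.
have [G [c' [FG tG UG Lc' uc']]] := Au.2 m mn; exists G, c'; split => //.
move=> k s w sm Gk; rewrite /replace_stage; case: ifPn => sj; last exact: uc'.
by exfalso; move/eqP: mj; apply; exact: stage_unique sm sj.
Qed.

Lemma admissible_point : admissible n p info (fun _ _ => point : E).
Proof.
split; first exact: L0_point measurable0 measurableT.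
move=> j jn; exists (fun k => if k is 0%N then setT else set0), (fun _ _ _ => point).
split => //.
- move=> [|k]; apply/filtrationP; split => //.
- by apply/trivIsetP => -[|k] [|k'] //= _ _ _; rewrite ?setI0 ?set0I.
- by apply/seteqP; split => // w _; exists 0%N.
- by move=> k; exact: L0_point.
Qed.

Lemma controls_of_admissible a b u : admissible n p info u ->
  controls n p info a b (u \_ `[a, b]).
Proof. by move=> Au; exists u. Qed.

Lemma restrict_control a b u s w : a <= s <= b -> (u \_ `[a, b]) s w = u s w.
Proof. by move=> sab; rewrite patchE mem_set//= in_itv. Qed.

End control_sets.

(** * Controlled dynamics *)

Lemma continuous_pair_at {X Y Z : topologicalType} (f : X -> Y) (g : X -> Z) x :
  {for x, continuous f} -> {for x, continuous g} ->
  {for x, continuous (fun x => (f x, g x))}.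
Proof.
move=> cf cg.
exact: (@cvg_pair _ _ _ (nbhs x) (nbhs (f x)) (nbhs (g x)) _ _ _ f g cf cg).
Qed.

(** Used to freeze some of the variables of the dynamics, which is continuous only
  on a strip of times. *)
Lemma within_cvg_comp {X Y Z : topologicalType} (A : set X) (B : set Y)
    (g : X -> Y) (f : Y -> Z) x (l : Z) :
  {for x, continuous g} -> (forall x', A x' -> B (g x')) ->
  f y @[y --> within B (nbhs (g x))] --> l ->
  f (g x') @[x' --> within A (nbhs x)] --> l.
Proof.
move=> cg AB fl U lU; have := cg _ (fl U lU); rewrite /within /= nbhs_simpl/=.
by apply: filterS => x' H /AB; exact: H.
Qed.

Lemma cvg_comp_within {X Y Z : topologicalType} (B : set Y)
    (g : X -> Y) (f : Y -> Z) x (l : Z) :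
  {for x, continuous g} -> (forall x', B (g x')) ->
  f y @[y --> within B (nbhs (g x))] --> l -> f (g x') @[x' --> x] --> l.
Proof.
move=> cg gB fl U lU; have := cg _ (fl U lU); rewrite /within /= nbhs_simpl/=.
by apply: filterS => x'; apply; exact: gB.
Qed.

Lemma lipschitz_measurable {R : realType} {k : nat} d (T : measurableType d)
    (D : set T) (Z : T -> 'rV[R]_k) (h : 'rV[R]_k -> T -> R) (L : R) :
  measurable D -> (forall i, measurable_fun D (fun w => Z w 0 i)) ->
  (forall y, measurable_fun D (h y)) ->
  (forall w x y, D w -> `|h x w - h y w| <= L * `|x - y|) ->
  measurable_fun D (fun w => h (Z w) w).
Proof.
move=> mD mZ mh hL; apply: caratheodory_measurable => //.
  exact: discretizable_row.
by move=> w Dw; apply: lipschitz_continuous_at => y; exact: hL.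
Qed.

Record game_dynamics {R : realType} {d : nat} {E1 E2 : pmetricType R} (T M L : R)
    (F : R -> 'rV[R]_d -> E1 -> E2 -> 'rV[R]_d) : Prop := GameDynamics {
  dynamics_compact1 : compact [set: E1] ;
  dynamics_compact2 : compact [set: E2] ;
  dynamics_bounded : forall (t : R) x c e, 0 <= t <= T -> `|F t x c e| <= M ;
  dynamics_continuous :
    {within [set z : R * 'rV[R]_d * E1 * E2 | 0 <= z.1.1.1 <= T],
       continuous (fun z => F z.1.1.1 z.1.1.2 z.1.2 z.2)} ;
  dynamics_gt0 : 0 < L ;
  dynamics_lipschitz : forall (t : R) x y c e, 0 <= t <= T ->
    `|F t x c e - F t y c e| <= L * `|x - y| }.

Section dynamics.
Context {R : realType} {d : nat} {E1 E2 : pmetricType R}.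
Local Notation Omega := (Omega R).
Local Notation mu := (@lebesgue_measure R).
Variables (T M L : R) (F : R -> 'rV[R]_d -> E1 -> E2 -> 'rV[R]_d).
Hypothesis dynF : game_dynamics T M L F.

Let E1_compact := dynamics_compact1 dynF.
Let E2_compact := dynamics_compact2 dynF.
Let F_bounded := dynamics_bounded dynF.
Let F_continuous := dynamics_continuous dynF.
Let L_gt0 := dynamics_gt0 dynF.
Let F_lipschitz := dynamics_lipschitz dynF.

Let strip : set (R * 'rV[R]_d * E1 * E2) := [set z | 0 <= z.1.1.1 <= T].

Let F_within z : strip z ->
  (F z'.1.1.1 z'.1.1.2 z'.1.2 z'.2) @[z' --> within strip (nbhs z)]
    --> F z.1.1.1 z.1.1.2 z.1.2 z.2.
Proof. by move=> sz; move/subspace_continuousP : F_continuous => /(_ z sz). Qed.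

Implicit Types (a b r s : R) (x y : 'rV[R]_d).

Let F_measurable_time a b x c e k : 0 <= a -> b <= T ->
  measurable_fun `[a, b] (fun r => F r x c e 0 k).
Proof.
move=> a0 bT; apply: (@within_continuous_coord _ _ _ _ (fun r => F r x c e)).
apply/subspace_continuousP => r; rewrite /= in_itv/= => /andP[ar rb].
have sr : strip (r, x, c, e) by rewrite /strip/= (le_trans a0)// (le_trans rb).
apply: (@within_cvg_comp _ _ _ _ strip (fun r' => (r', x, c, e))
  (fun z => F z.1.1.1 z.1.1.2 z.1.2 z.2)); last exact: F_within sr.
- apply: continuous_pair_at; last exact: cvg_cst.
  apply: continuous_pair_at; last exact: cvg_cst.
  by apply: continuous_pair_at; [exact: cvg_id|exact: cvg_cst].
- move=> r'; rewrite /strip /= in_itv/= => /andP[ar' rb'].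
  by rewrite (le_trans a0)// (le_trans rb').
Qed.

Let F_continuous_controls r x ce k : 0 <= r <= T ->
  {for ce, continuous (fun ce : E1 * E2 => F r x ce.1 ce.2 0 k)}.
Proof.
move=> rT; have sr : strip (r, x, ce.1, ce.2) by [].
suff H : F r x ce'.1 ce'.2 @[ce' --> ce] --> F r x ce.1 ce.2.
  exact: (@continuous_comp _ _ _ (fun ce : E1 * E2 => F r x ce.1 ce.2)
    (fun y : 'rV[R]_d => y 0 k) ce H (@coord_continuous _ _ _ _ _ _)).
have c1 : {for ce, continuous (fun ce : E1 * E2 => (r, x, ce.1, ce.2))}.
  apply: continuous_pair_at; last exact: cvg_snd.
  apply: continuous_pair_at; last exact: cvg_fst.
  exact: cvg_cst.
exact: (@cvg_comp_within _ _ _ strip (fun ce : E1 * E2 => (r, x, ce.1, ce.2))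
  (fun z => F z.1.1.1 z.1.1.2 z.1.2 z.2) ce _ c1 (fun=> rT) (F_within sr)).
Qed.

Implicit Types (u : R -> Omega -> E1) (v : R -> Omega -> E2).

(** The dynamics is measurable in time and jointly continuous in the actions, and
  controls in compact spaces are discretizable. *)
Lemma field_joint a b u v y k : 0 <= a -> b <= T ->
  jointly_measurable a b u -> jointly_measurable a b v ->
  measurable_fun (`[a, b] `*` setT)
    (fun z : R * Omega => F z.1 y (u z.1 z.2) (v z.1 z.2) 0 k).
Proof.
move=> a0 bT mu_ mv.
have mD : measurable (`[a, b] `*` setT : set (R * Omega)) by exact: measurable_strip.
apply: (@caratheodory_measurable _ _ R (E1 * E2)%type _
  (fun z : R * Omega => (u z.1 z.2, v z.1 z.2)) (fun ce z => F z.1 y ce.1 ce.2 0 k)) => //.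
- by apply: discretizable_pair; exact: discretizable_compact.
- move=> [c e] /=.
  apply: (@measurable_comp _ _ _ _ _ _ `[a, b] (fun r => F r y c e 0 k) _ fst) => //.
  + by move=> _ [[s w] /= [sab _] <-].
  + exact: F_measurable_time.
  + exact: measurable_funTS.
- move=> [s w] /= [+ _]; rewrite in_itv/= => /andP[as_ sb].
  by apply: F_continuous_controls; rewrite (le_trans a0)// (le_trans sb).
Qed.

Lemma field_carath a b u v w : 0 <= a -> b <= T ->
  jointly_measurable a b u -> jointly_measurable a b v ->
  carath_field a b M L (fun r y => F r y (u r w) (v r w)).
Proof.
move=> a0 bT mu_ mv.
have sub r : a <= r <= b -> 0 <= r <= T.
  by move=> /andP[ar rb]; rewrite (le_trans a0)// (le_trans rb).
split.
- move=> y k; apply: (@measurable_comp _ _ _ _ _ _ (`[a, b] `*` setT)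
    (fun z : R * Omega => F z.1 y (u z.1 z.2) (v z.1 z.2) 0 k) _ (fun r => (r, w))) => //.
  + exact: measurable_strip.
  + by move=> _ [r rab <-].
  + exact: field_joint.
  + by apply: measurable_funTS; exact: measurable_fun_pair.
- by move=> r y /sub; exact: F_bounded.
- by move=> r y y' /sub; exact: F_lipschitz.
Qed.

Definition state a b x u v (w : Omega) : R -> 'rV[R]_d :=
  trajectory F a b x (u ^~ w) (v ^~ w).

Lemma state_exists a b x u v : 0 <= a -> a <= b -> b <= T ->
  jointly_measurable a b u -> jointly_measurable a b v ->
  (forall w, solution a b x (fun r y => F r y (u r w) (v r w)) (state a b x u v w)) /\
  forall s k, a <= s <= b -> measurable_fun setT (fun w => state a b x u v w s 0 k).
Proof.
move=> a0 ab bT mu_ mv.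
have cf w := @field_carath a b u v w a0 bT mu_ mv.
have [X [sX mX]] := solution_exists x ab L_gt0 cf
  (fun y k => field_joint y k a0 bT mu_ mv).
have sS w : solution a b x (fun r y => F r y (u r w) (v r w)) (state a b x u v w).
  have : exists Y, is_trajectory F a b x (u ^~ w) (v ^~ w) Y by exists (X w); exact: sX.
  by move=> /getPex.
split=> // s k sab; have := mX s k sab; congr (measurable_fun _ _).
apply/funext => w; congr (fun_of_matrix _ 0 k).
have ae_id : {ae mu, forall r, a <= r <= b ->
    forall y, F r y (u r w) (v r w) = F r y (u r w) (v r w)} by apply: aeW.
have := solution_stable L_gt0 (cf w) (cf w) ae_id (sX w) (sS w) sab.
by rewrite subrr normr0 mulr0 mul0r normr_le0 subr_eq0 => /eqP.
Qed.

Lemma stateP a b x u v w : 0 <= a -> a <= b -> b <= T ->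
  jointly_measurable a b u -> jointly_measurable a b v ->
  solution a b x (fun r y => F r y (u r w) (v r w)) (state a b x u v w).
Proof. by move=> a0 ab bT mu_ mv; have [] := state_exists x a0 ab bT mu_ mv. Qed.

Lemma state_measurable a b x u v s k : 0 <= a -> b <= T ->
  jointly_measurable a b u -> jointly_measurable a b v -> a <= s <= b ->
  measurable_fun setT (fun w => state a b x u v w s 0 k).
Proof.
move=> a0 bT mu_ mv sab; have ab : a <= b by case/andP: sab => ? /(le_trans _); apply.
by have [_] := state_exists x a0 ab bT mu_ mv; apply.
Qed.

Definition flow_lipschitz_constant := 2 * expR (2 * L * T).

(** With equal initial values: the position depends on the controls only through
  their values at almost every time. *)
Lemma state_stable a b x x' u u' v v' w w' s : 0 <= a -> b <= T ->
  jointly_measurable a b u -> jointly_measurable a b v ->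
  jointly_measurable a b u' -> jointly_measurable a b v' ->
  {ae mu, forall r, a <= r <= b -> u r w = u' r w' /\ v r w = v' r w'} ->
  a <= s <= b ->
  `|state a b x u v w s - state a b x' u' v' w' s| <= flow_lipschitz_constant * `|x - x'|.
Proof.
move=> a0 bT mu_ mv mu' mv' ae_eq sab; have /andP[as_ sb] := sab.
have ab := le_trans as_ sb.
have cf := @field_carath a b u v w a0 bT mu_ mv.
have cf' := @field_carath a b u' v' w' a0 bT mu' mv'.
have ae_F : {ae mu, forall r, a <= r <= b ->
    forall y, F r y (u r w) (v r w) = F r y (u' r w') (v' r w')}.
  by apply: ae_impl ae_eq => r H /H[-> ->].
apply: le_trans (solution_stable L_gt0 cf cf' ae_F (stateP _ _ _ _ _ _ _)
  (stateP _ _ _ _ _ _ _) sab) _ => //.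
rewrite /flow_lipschitz_constant mulrAC ler_wpM2r// ler_wpM2l// ler_expR.
rewrite ler_wpM2l ?mulr_ge0 ?(ltW L_gt0)//.
by rewrite lerBlDr (le_trans sb)// (le_trans bT)// lerDl.
Qed.

Lemma state_congr a b x u u' v v' w w' s : 0 <= a -> b <= T ->
  jointly_measurable a b u -> jointly_measurable a b v ->
  jointly_measurable a b u' -> jointly_measurable a b v' ->
  {ae mu, forall r, a <= r <= b -> u r w = u' r w' /\ v r w = v' r w'} ->
  a <= s <= b -> state a b x u v w s = state a b x u' v' w' s.
Proof.
move=> a0 bT mu_ mv mu' mv' ae_eq sab.
have := state_stable x x a0 bT mu_ mv mu' mv' ae_eq sab.
by rewrite subrr normr0 mulr0 normr_le0 subr_eq0 => /eqP.
Qed.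

Lemma state_restrict a b c x u v w s : 0 <= a -> b <= T -> c <= b ->
  jointly_measurable a b u -> jointly_measurable a b v -> a <= s <= c ->
  state a c x u v w s = state a b x u v w s.
Proof.
move=> a0 bT cb mu_ mv sac; have /andP[as_ sc] := sac.
have ac := le_trans as_ sc; have ab := le_trans ac cb.
have mu' := jointly_measurable_sub (lexx a) cb mu_.
have mv' := jointly_measurable_sub (lexx a) cb mv.
have cT := le_trans cb bT.
apply: (solution_unique L_gt0 (field_carath w a0 cT mu' mv')) sac; first exact: stateP.
by apply: (solution_restrict cb); exact: stateP.
Qed.

Lemma state_flow a b c x u v w s : 0 <= a -> b <= T -> a <= c -> c <= s <= b ->
  jointly_measurable a b u -> jointly_measurable a b v ->
  state a b x u v w s = state c b (state a b x u v w c) u v w s.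
Proof.
move=> a0 bT ac scb mu_ mv; have /andP[cs sb] := scb; have cb := le_trans cs sb.
have mu' := jointly_measurable_sub ac (lexx b) mu_.
have mv' := jointly_measurable_sub ac (lexx b) mv.
have c0 := le_trans a0 ac; have ab := le_trans ac cb.
apply: (solution_unique L_gt0 (field_carath w c0 bT mu' mv')) scb; last exact: stateP.
apply: (solution_flow (field_carath w a0 bT mu_ mv)); first by rewrite ac.
exact: stateP.
Qed.

Lemma state_start a b x u v w : 0 <= a -> a <= b -> b <= T ->
  jointly_measurable a b u -> jointly_measurable a b v -> state a b x u v w a = x.
Proof.
by move=> a0 ab bT mu_ mv; apply: (solution_start ab); exact: stateP.
Qed.

End dynamics.

(** * Strategies and their outcomes *)

Section almost_everywhere_product.
Context {R : realType} (P : probability (Omega R) R).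
Local Notation Omega := (Omega R).
Local Notation mu := (@lebesgue_measure R).

Lemma ae_prod_section (Q : R * Omega -> Prop) :
  {ae (mu \x P)%E, forall z, Q z} ->
  {ae P, forall w, {ae mu, forall s, Q (s, w)}}.
Proof.
move=> [N [mN N0 QN]].
have mxN : measurable_fun setT (fun w => mu (ysection N w)).
  exact: measurable_fun_ysection.
have IN : (mu \x P)%E N = (mu \x^ P)%E N.
  by apply: product_measure_unique => //= A B mA mB; rewrite product_measure2E.
have {}IN : (\int[P]_w `|mu (ysection N w)| = 0)%E.
  rewrite -[RHS]N0; apply/esym; rewrite [LHS]IN /product_measure2.
  by apply: eq_integral => w _; rewrite gee0_abs.
have /(_ IN) := (ae_eq_integral_abs P measurableT mxN).1.
apply: ae_impl => w /= /(_ Logic.I) Nw.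
exists (ysection N w); split => //; first exact: measurable_ysection.
by move=> s /= nQ; rewrite /ysection /= inE; apply: QN.
Qed.

Lemma ae_prod_pair (G : Omega -> Prop) (H : R -> Prop) :
  {ae P, forall w, G w} -> {ae mu, forall s, H s} ->
  {ae (mu \x P)%E, forall z, H z.1 /\ G z.2}.
Proof.
move=> [N [mN N0 GN]] [N' [mN' N'0 HN']].
have n1 : (mu \x P)%E.-negligible (setT `*` N).
  exists (setT `*` N); split => //; first exact: measurableX.
  by rewrite product_measure1E// [X in (_ * X)%E]N0 mule0.
have n2 : (mu \x P)%E.-negligible (N' `*` setT).
  exists (N' `*` setT); split => //; first exact: measurableX.
  by rewrite product_measure1E// [X in (X * _)%E]N'0 mul0e.
have := negligibleU n1 n2; apply: negligibleS => -[s w] /= /not_andP[nH|nG].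
  by right; split => //; exact: HN'.
by left; split => //; exact: GN.
Qed.

Lemma ae_neq (c : R) : {ae mu, forall s, s <> c}.
Proof.
exists [set c]; split => //; first exact: lebesgue_measure_set1.
by move=> s /= /contrapT.
Qed.

Lemma ae_neq_all (c : nat -> R) : {ae mu, forall s, forall k, s <> c k}.
Proof. by apply: ae_forall_nat => k; exact: ae_neq. Qed.

End almost_everywhere_product.

Section restricted_controls.
Context {R : realType} (n : nat) (p : nat -> R) (T : R).
Hypothesis p_partition : is_partition T n p.
Context {E : pmetricType R} (info : nat -> set_system (Omega R)).
Hypothesis info_coordinate : forall j, info j `<=` coordinate_event j.
Hypotheses (info_set0 : forall j, info j set0) (info_setT : forall j, info j setT).
Local Notation Omega := (Omega R).
Variables (a b : R).
Hypotheses (a_ge0 : 0 <= a) (b_leT : b <= T).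
Implicit Types (u : R -> Omega -> E).
Local Notation C := (controls n p info a b).

Lemma control_joint u : C u -> jointly_measurable a b u.
Proof.
move=> [u0 Au0 <-]; have [p0 pn _] := p_partition.
have := admissible_joint Au0; rewrite p0 pn => /(jointly_measurable_sub a_ge0 b_leT).
apply: eq_measurable_fun => -[s w]; rewrite inE /= in_itv/= => -[sab _].
by rewrite restrict_control.
Qed.

Lemma control_index u j : C u -> (j < n)%N ->
  exists (kappa : Omega -> nat) (c : nat -> R -> Omega -> E),
    [/\ forall k, filtration j (kappa @^-1` [set k]),
        forall k, L0 (info j) (p j) (p j.+1) (c k) &
        forall s w, a <= s <= b -> p j <= s < p j.+1 -> u s w = c (kappa w) s w].
Proof.
move=> [u0 Au0 <-] jn; have [kappa [c [Fk Lc uc]]] := admissible_index Au0 jn.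
by exists kappa, c; split => // s w sab sj; rewrite restrict_control// uc.
Qed.

Lemma control_depends u j s (w w' : Omega) : C u -> (j <= n)%N ->
  a <= s <= b -> s < p j -> (forall k, (k < j)%N -> w k = w' k) -> u s w = u s w'.
Proof.
move=> [u0 Au0 <-] jn sab sj ww'; rewrite !restrict_control//.
apply: (admissible_depends info_coordinate Au0 jn) => //.
have [-> _ _] := p_partition; rewrite sj andbT.
by apply: le_trans a_ge0 _; case/andP: sab.
Qed.

Lemma control_point : C ((fun _ _ => point : E) \_ `[a, b]).
Proof. by apply: controls_of_admissible; exact: admissible_point. Qed.

Definition replace_control j kappa c u := (replace_stage p j kappa c u) \_ `[a, b].

Lemma replace_controlE j kappa c u s w : a <= s <= b ->
  replace_control j kappa c u s w =
  if p j <= s < p j.+1 then c (kappa w) s w else u s w.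
Proof. by move=> sab; rewrite /replace_control restrict_control. Qed.

Lemma control_replace j (kappa : Omega -> nat) c u : (j < n)%N ->
  (forall k, filtration j (kappa @^-1` [set k])) ->
  (forall k, L0 (info j) (p j) (p j.+1) (c k)) ->
  C u -> C (replace_control j kappa c u).
Proof.
move=> jn Fk Lc [u0 Au0 <-]; exists (replace_stage p j kappa c u0).
  exact: (admissible_replace_stage p_partition).
apply/funext => s; rewrite /replace_control !patchE; case: ifPn => // sab.
by apply/funext => w; rewrite /replace_stage !patchE sab.
Qed.

End restricted_controls.

Lemma stopping_time_cst {R : realType} (k : nat) : stopping_time (fun _ : Omega R => k).
Proof.
move=> j; apply/filtrationP; split => //.
have [->|kj] := eqVneq k j.
  by rewrite (_ : _ @^-1` _ = setT)//; apply/seteqP; split.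
rewrite (_ : _ @^-1` _ = set0)//; apply/seteqP; split => // w /= /eqP.
by rewrite (negbTE kj).
Qed.

Section strategies.
Context {R : realType} (P : probability (Omega R) R) (n : nat) (p : nat -> R) (T : R).
Hypothesis p_partition : is_partition T n p.
Local Notation Omega := (Omega R).
Context {E1 E2 : Type} (a b : R) (C1 : set (R -> Omega -> E1)) (C2 : set (R -> Omega -> E2)).
Hypotheses (a_ge0 : 0 <= a) (b_leT : b <= T).

Lemma ae_equal_on_trans (E : Type) (D : set (R * Omega)) (u u' u'' : R -> Omega -> E) :
  ae_equal_on P D u u' -> ae_equal_on P D u' u'' -> ae_equal_on P D u u''.
Proof.
by move=> h h'; apply: ae_impl (ae_conj h h') => z [H H'] Dz; rewrite H// H'.
Qed.

Lemma ae_equal_on_sub (E : Type) (D D' : set (R * Omega)) (u u' : R -> Omega -> E) :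
  D' `<=` D -> ae_equal_on P D u u' -> ae_equal_on P D' u u'.
Proof. by move=> DD'; apply: ae_impl => z H /DD'. Qed.

Lemma ae_equal_on_sym (E : Type) (D : set (R * Omega)) (u u' : R -> Omega -> E) :
  ae_equal_on P D u u' -> ae_equal_on P D u' u.
Proof. by apply: ae_impl => z H /H. Qed.

(** The instance of a deterministic stopping time. *)
Lemma nad_stage alpha k u u' : nad_strategies P n p a b C1 C2 alpha ->
  (k < n)%N -> C1 u -> C1 u' ->
  ae_equal_on P [set z | a <= z.1 <= b /\ z.1 <= p k] u u' ->
  ae_equal_on P [set z | a <= z.1 <= b /\ z.1 <= p k.+1] (alpha u) (alpha u').
Proof.
move=> [_ H] kn Cu Cu' uu'.
by apply: (H (fun=> k)) => //; exact: stopping_time_cst.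
Qed.

Lemma nad_full alpha u u' : nad_strategies P n p a b C1 C2 alpha ->
  (0 < n)%N -> C1 u -> C1 u' -> ae_equal_on P (`[a, b] `*` setT) u u' ->
  ae_equal_on P (`[a, b] `*` setT) (alpha u) (alpha u').
Proof.
move=> Ha n0 Cu Cu' uu'.
have := @nad_stage alpha n.-1 u u' Ha; rewrite prednK// => /(_ (leqnn _) Cu Cu') H.
apply: ae_equal_on_sub (H _) => [[s w] /=|].
  rewrite in_itv/= => -[/andP[as_ sb] _]; split; first by rewrite as_.
  by have [_ -> _] := p_partition; exact: le_trans b_leT.
by apply: ae_equal_on_sub uu' => -[s w] /= [sab _]; rewrite in_itv.
Qed.

End strategies.

Section outcomes.
Context {R : realType} (P : probability (Omega R) R) (n : nat) (p : nat -> R) (T : R).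
Hypothesis p_partition : is_partition T n p.
Local Notation Omega := (Omega R).
Context {E1 E2 : Type} (a b : R) (C1 : set (R -> Omega -> E1)) (C2 : set (R -> Omega -> E2)).
Hypotheses (a_ge0 : 0 <= a) (b_leT : b <= T).

(** Running the two strategies against each other: after each round the controls
  are settled on one more interval of the partition. *)
Lemma outcome_exists alpha beta :
  nad_strategies P n p a b C2 C1 alpha -> nad_strategies P n p a b C1 C2 beta ->
  C1 !=set0 -> C2 !=set0 ->
  exists u v, [/\ C1 u, C2 v, ae_equal_on P (`[a, b] `*` setT) (alpha v) u &
                  ae_equal_on P (`[a, b] `*` setT) (beta u) v].
Proof.
move=> Ha Hb [u0 Cu0] [v0 Cv0].
pose uv := fix uv k := if k is k'.+1 then (alpha (uv k').2, beta (uv k').1) else (u0, v0).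
have Cuv k : C1 (uv k).1 /\ C2 (uv k).2.
  by elim: k => [//|k [? ?]]; split; [exact: Ha.1|exact: Hb.1].
have settled k : (k <= n)%N ->
    ae_equal_on P [set z | a <= z.1 <= b /\ z.1 <= p k] (uv k.+1).1 (uv k).1 /\
    ae_equal_on P [set z | a <= z.1 <= b /\ z.1 <= p k] (uv k.+1).2 (uv k).2.
  elim: k => [_|k IH kn].
    have [p0 _ _] := p_partition; rewrite p0.
    have H (E : Type) (c c' : R -> Omega -> E) :
        ae_equal_on P [set z | a <= z.1 <= b /\ z.1 <= 0] c c'.
      have aeT : {ae P, forall w : Omega, True} by exact: aeW.
      apply: ae_impl (ae_prod_pair aeT (ae_neq (0 : R))) => -[s w] /= [sN0 _].
      move=> [/andP[as_ _] s0]; exfalso; apply: sN0; apply/le_anti.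
      by rewrite s0 (le_trans a_ge0).
    by split; exact: H.
  have [IH1 IH2] := IH (ltnW kn).
  have [Cu Cv] := Cuv k; have [Cu' Cv'] := Cuv k.+1.
  split; first exact: (nad_stage Ha kn Cv' Cv IH2).
  exact: (nad_stage Hb kn Cu' Cu IH1).
have [Cu Cv] := Cuv n.
have sub : `[a, b] `*` setT `<=` [set z : R * Omega | a <= z.1 <= b /\ z.1 <= p n].
  move=> [s w] /= [+ _]; rewrite in_itv/= => /andP[as_ sb]; rewrite as_ sb.
  by split=> //; have [_ -> _] := p_partition; exact: le_trans b_leT.
have [H1 H2] := settled n (leqnn n).
exists (uv n).1, (uv n).2; split => //.
- exact: ae_equal_on_sub H1.
- exact: ae_equal_on_sub H2.
Qed.

End outcomes.

(** * Stage games *)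

Section matrix_game_value.
Context {R : realType} {I J : Type}.
Variables (C : set I) (D : set J) (B : R).
Hypotheses (C_neq0 : C !=set0) (D_neq0 : D !=set0).
Implicit Types (g : I -> J -> R).

Definition lower_game_value g : R := sup [set inf [set g c e | e in D] | c in C].

Let bounded g := forall c e, C c -> D e -> `|g c e| <= B.

Let inf_ge g c : bounded g -> C c -> - B <= inf [set g c e | e in D].
Proof.
move=> gB Cc; apply: lb_le_inf.
  by have [e De] := D_neq0; exists (g c e), e.
by move=> _ [e De <-]; have := gB c e Cc De; rewrite ler_norml => /andP[].
Qed.

Let inf_le g c e : bounded g -> C c -> D e -> inf [set g c e | e in D] <= g c e.
Proof.
move=> gB Cc De; apply: ge_inf; last by exists e.
by exists (- B) => _ [e' De' <-]; have := gB c e' Cc De'; rewrite ler_norml => /andP[].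
Qed.

Let inf_leB g c : bounded g -> C c -> inf [set g c e | e in D] <= B.
Proof.
move=> gB Cc; have [e De] := D_neq0; apply: le_trans (inf_le gB Cc De) _.
by have := gB c e Cc De; rewrite ler_norml => /andP[].
Qed.

Let has_sup_inf g : bounded g -> has_sup [set inf [set g c e | e in D] | c in C].
Proof.
move=> gB; split.
  by have [c Cc] := C_neq0; exists (inf [set g c e | e in D]), c.
by exists B => _ [c Cc <-]; exact: inf_leB.
Qed.

Lemma lower_game_value_bounded g : bounded g -> `|lower_game_value g| <= B.
Proof.
move=> gB; have [c Cc] := C_neq0; rewrite ler_norml; apply/andP; split.
  apply: le_trans (inf_ge gB Cc) _; apply: sup_upper_bound; first exact: has_sup_inf.
  by exists c.
apply: ge_sup; first by exists (inf [set g c e | e in D]), c.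
by move=> _ [c' Cc' <-]; exact: inf_leB.
Qed.

Lemma lower_game_value_respond g c (e : R) : bounded g -> C c -> 0 < e ->
  exists2 x, D x & g c x <= lower_game_value g + e.
Proof.
move=> gB Cc e0.
have hi : has_inf [set g c x | x in D].
  split; first by have [x Dx] := D_neq0; exists (g c x), x.
  by exists (- B) => _ [x Dx <-]; have := gB c x Cc Dx; rewrite ler_norml => /andP[].
have [_ [x Dx <-] gx] := inf_adherent e0 hi.
exists x => //; apply/ltW/(lt_le_trans gx); rewrite lerD2r.
by apply: sup_upper_bound; [exact: has_sup_inf|exists c].
Qed.

Lemma lower_game_value_secure g (e : R) : bounded g -> 0 < e ->
  exists2 c, C c & forall x, D x -> lower_game_value g - e <= g c x.
Proof.
move=> gB e0; have [_ [c Cc <-] gc] := sup_adherent e0 (has_sup_inf gB).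
exists c => // x Dx; apply/ltW/(lt_le_trans gc).
exact: inf_le.
Qed.

Lemma lower_game_value_le g g' (e : R) : bounded g -> bounded g' ->
  (forall c x, C c -> D x -> `|g c x - g' c x| <= e) ->
  lower_game_value g <= lower_game_value g' + e.
Proof.
move=> gB gB' gg'; apply/ler_addgt0Pr => d d0.
have d20 : 0 < d / 2 by rewrite divr_gt0.
have [c Cc cS] := lower_game_value_secure gB d20.
have [x Dx xR] := lower_game_value_respond gB' Cc d20.
have := gg' c x Cc Dx; rewrite ler_norml => /andP[_].
have := cS x Dx; lra.
Qed.

Lemma lower_game_value_close g g' (e : R) : bounded g -> bounded g' ->
  (forall c x, C c -> D x -> `|g c x - g' c x| <= e) ->
  `|lower_game_value g - lower_game_value g'| <= e.
Proof.
move=> gB gB' gg'.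
have h1 := lower_game_value_le gB gB' gg'.
have h2 : lower_game_value g' <= lower_game_value g + e.
  by apply: lower_game_value_le => // c x Cc Dx; rewrite distrC; exact: gg'.
by rewrite ler_norml; apply/andP; split; lra.
Qed.

End matrix_game_value.

(** Moving from the centre of a cell to another point of it costs at most [K1 * N] on
  the payoff and [K' * N] on the value. *)
Lemma cell_transfer {R : realFieldType} (A A' V V' N K1 K' eps : R) :
  `|A - A'| <= K1 * N -> `|V - V'| <= K' * N -> 0 <= N ->
  (K1 + K' + 1) * N <= eps / 2 ->
  (A <= V + eps / 2 -> A' <= V' + eps) /\ (V - eps / 2 <= A -> V' - eps <= A').
Proof.
rewrite !ler_norml => /andP[h1 h2] /andP[h3 h4] N0.
by rewrite !mulrDl mul1r => h5; split; lra.
Qed.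

Section staged_game.
Context {R : realType} {d : nat} {E1 E2 : pmetricType R} (P : probability (Omega R) R).
Hypothesis P_product : is_product_lebesgue P.
Local Notation Omega := (Omega R).
Local Notation mu := (@lebesgue_measure R).
Variables (n : nat) (p : nat -> R) (T : R).
Hypothesis p_partition : is_partition T n p.
Variables (info1 info2 : nat -> set_system Omega).
Hypotheses (info1P : information info1) (info2P : information info2).
Variables (M L : R) (F : R -> 'rV[R]_d -> E1 -> E2 -> 'rV[R]_d).
Hypothesis dynF : game_dynamics T M L F.
Implicit Types (a b s : R) (x y : 'rV[R]_d) (h : 'rV[R]_d -> R).
Implicit Types (c : R -> Omega -> E1) (e : R -> Omega -> E2).

Let p_ge0 j : (j <= n)%N -> 0 <= p j.
Proof.
by move=> jn; have [p0 _ _] := p_partition; rewrite -p0; exact: (partition_le p_partition).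
Qed.

Let p_leT j : (j <= n)%N -> p j <= T.
Proof.
by move=> jn; have [_ pn _] := p_partition; rewrite -pn; exact: (partition_le p_partition).
Qed.

Definition regular h := (exists B, forall y, `|h y| <= B) /\
  exists2 K, 0 <= K & forall y y', `|h y - h y'| <= K * `|y - y'|.

Lemma regular_state h a b x u v s : regular h -> 0 <= a -> b <= T ->
  jointly_measurable a b u -> jointly_measurable a b v -> a <= s <= b ->
  bounded_measurable (fun w => h (state F a b x u v w s)).
Proof.
move=> [[B hB] [K _ hK]] a0 bT mu_ mv sab; split; last by exists B.
apply: (@lipschitz_measurable _ _ _ _ _ _ (fun y _ => h y) K) => //.
by move=> k; exact: (state_measurable dynF).
Qed.

Definition stage_payoff a b h y c e := \int[P]_w h (state F a b y c e w b).

(** Player 1 commits to a random action that uses only its own information of the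
  stage, and player 2, who knows this action as a function, answers with one that
  uses its own; [h] is the reward at the end of the stage. *)
Definition stage_value j a b h y :=
  lower_game_value (L0 (info1 j) (p j) (p j.+1)) (L0 (info2 j) (p j) (p j.+1))
    (stage_payoff a b h y).

Section one_stage.
Variables (j : nat) (a b : R).
Hypotheses (j_lt_n : (j < n)%N) (ja : p j <= a) (ab : a <= b) (bj : b <= p j.+1).

Let a0 : 0 <= a. Proof. by apply: le_trans ja; apply: p_ge0; exact: ltnW. Qed.

Let bT : b <= T. Proof. by apply: le_trans bj _; exact: p_leT. Qed.

Let L0_joint (E : pmetricType R) (K : set_system Omega) (c : R -> Omega -> E) :
  L0 K (p j) (p j.+1) c -> jointly_measurable a b c.
Proof. by move=> [mc _]; exact: jointly_measurable_sub mc. Qed.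

Lemma stage_payoff_bounded h B y c e : regular h -> (forall y, `|h y| <= B) ->
  L0 (info1 j) (p j) (p j.+1) c -> L0 (info2 j) (p j) (p j.+1) e ->
  `|stage_payoff a b h y c e| <= B.
Proof.
move=> rh hB /L0_joint mc /L0_joint me; apply: bounded_integral_le => //.
by apply: regular_state; rewrite // ab lexx.
Qed.

Lemma stage_payoff_close h K y y' c e : regular h -> 0 <= K ->
  (forall y y', `|h y - h y'| <= K * `|y - y'|) ->
  L0 (info1 j) (p j) (p j.+1) c -> L0 (info2 j) (p j) (p j.+1) e ->
  `|stage_payoff a b h y c e - stage_payoff a b h y' c e|
     <= K * flow_lipschitz_constant T L * `|y - y'|.
Proof.
move=> rh K0 hK /L0_joint mc /L0_joint me.
have bab : a <= b <= b by rewrite ab lexx.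
have b1 := regular_state y rh a0 bT mc me bab.
have b2 := regular_state y' rh a0 bT mc me bab.
rewrite /stage_payoff -RintegralB//; [|exact: bounded_measurable_integrable..].
apply: bounded_integral_le.
  by apply: bounded_measurableD => //; exact: bounded_measurableN.
move=> w; apply: le_trans (hK _ _) _; rewrite -mulrA ler_wpM2l//.
apply: (state_stable dynF) => //.
exact: aeW.
Qed.

Let C_neq0 : L0 (E := E1) (info1 j) (p j) (p j.+1) !=set0.
Proof. by case: info1P => _ i0 iT; eexists; apply: L0_point. Qed.

Let D_neq0 : L0 (E := E2) (info2 j) (p j) (p j.+1) !=set0.
Proof. by case: info2P => _ i0 iT; eexists; apply: L0_point. Qed.

Lemma stage_value_regular h : regular h -> regular (stage_value j a b h).
Proof.
move=> rh; have [[B hB] [K K0 hK]] := rh; split.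
  exists B => y; apply: lower_game_value_bounded => // c e.
  exact: stage_payoff_bounded.
exists (K * flow_lipschitz_constant T L).
  by rewrite mulr_ge0// /flow_lipschitz_constant mulr_ge0// ltW// expR_gt0.
move=> y y'; apply: (@lower_game_value_close _ _ _ _ _ B) => // c e.
- exact: stage_payoff_bounded.
- exact: stage_payoff_bounded.
- exact: stage_payoff_close.
Qed.

(** Responses that are chosen for the centres of small cells remain good in the
  whole cell. *)
Lemma stage_respond h (eps : R) : regular h -> 0 < eps ->
  exists2 delta, 0 < delta & forall c y, L0 (info1 j) (p j) (p j.+1) c ->
    exists2 e, L0 (info2 j) (p j) (p j.+1) e & forall y', `|y - y'| <= delta ->
      stage_payoff a b h y' c e <= stage_value j a b h y' + eps.
Proof.
move=> rh eps0; have [[B hB] [K K0 hK]] := rh.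
have [_ [K' K'0 hK']] := stage_value_regular rh.
pose K1 := K * flow_lipschitz_constant T L.
have K10 : 0 <= K1.
  by rewrite mulr_ge0// /flow_lipschitz_constant mulr_ge0// ltW// expR_gt0.
exists (eps / 2 / (K1 + K' + 1)); first by rewrite !divr_gt0// ltr_wpDl// addr_ge0.
move=> c y Lc.
have gB : forall c e, L0 (info1 j) (p j) (p j.+1) c -> L0 (info2 j) (p j) (p j.+1) e ->
    `|stage_payoff a b h y c e| <= B by move=> c' e'; exact: stage_payoff_bounded.
have eps20 : 0 < eps / 2 by rewrite divr_gt0.
have [e Le He] := lower_game_value_respond C_neq0 D_neq0 gB Lc eps20.
exists e => // y' yy'.
apply: (cell_transfer (stage_payoff_close y y' rh K0 hK Lc Le) (hK' y y') _ _).1 => //.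
by rewrite -ler_pdivlMl ?ltr_wpDl ?addr_ge0// mulrC.
Qed.

Lemma stage_secure h (eps : R) : regular h -> 0 < eps ->
  exists2 delta, 0 < delta & forall y,
    exists2 c, L0 (info1 j) (p j) (p j.+1) c & forall e y',
      L0 (info2 j) (p j) (p j.+1) e -> `|y - y'| <= delta ->
      stage_value j a b h y' - eps <= stage_payoff a b h y' c e.
Proof.
move=> rh eps0; have [[B hB] [K K0 hK]] := rh.
have [_ [K' K'0 hK']] := stage_value_regular rh.
pose K1 := K * flow_lipschitz_constant T L.
have K10 : 0 <= K1.
  by rewrite mulr_ge0// /flow_lipschitz_constant mulr_ge0// ltW// expR_gt0.
exists (eps / 2 / (K1 + K' + 1)); first by rewrite !divr_gt0// ltr_wpDl// addr_ge0.
move=> y.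
have gB : forall c e, L0 (info1 j) (p j) (p j.+1) c -> L0 (info2 j) (p j) (p j.+1) e ->
    `|stage_payoff a b h y c e| <= B by move=> c' e'; exact: stage_payoff_bounded.
have eps20 : 0 < eps / 2 by rewrite divr_gt0.
have [c Lc Hc] := lower_game_value_secure C_neq0 D_neq0 gB eps20.
exists c => // e y' Le yy'; have He := Hc e Le.
apply: (cell_transfer (stage_payoff_close y y' rh K0 hK Lc Le) (hK' y y') _ _).2 => //.
by rewrite -ler_pdivlMl ?ltr_wpDl ?addr_ge0// mulrC.
Qed.

End one_stage.

End staged_game.

(** * The game along the partition *)

Section dynamic_programming.
Context {R : realType} {d : nat} {E1 E2 : pmetricType R} (P : probability (Omega R) R).
Hypothesis P_product : is_product_lebesgue P.
Local Notation Omega := (Omega R).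
Local Notation mu := (@lebesgue_measure R).
Variables (n : nat) (p : nat -> R) (T : R).
Hypothesis p_partition : is_partition T n p.
Variables (info1 info2 : nat -> set_system Omega).
Hypotheses (info1P : information info1) (info2P : information info2).
Variables (M L : R) (F : R -> 'rV[R]_d -> E1 -> E2 -> 'rV[R]_d).
Hypothesis dynF : game_dynamics T M L F.

Fixpoint value (q : nat -> R) m j (h : 'rV[R]_d -> R) : 'rV[R]_d -> R :=
  if m is m'.+1 then
    stage_value P p info1 info2 F j (q j) (q j.+1) (value q m' j.+1 h)
  else h.

Variables (i l : nat) (t0 : R) (x : 'rV[R]_d).
Hypotheses (i_lt_l : (i < l)%N) (l_le_n : (l <= n)%N) (t0_cell : p i <= t0 < p i.+1).

(** The starting time, followed by the later points of the partition. *)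
Definition node j := Num.max t0 (p j).
Let q := node.
Let b := p l.
Local Notation C1 := (controls n p info1 t0 b).
Local Notation C2 := (controls n p info2 t0 b).
Implicit Types (u : R -> Omega -> E1) (v : R -> Omega -> E2) (h : 'rV[R]_d -> R).

Lemma start_ge0 : 0 <= t0.
Proof.
have [p0 _ _] := p_partition; have /andP[pt _] := t0_cell.
apply: le_trans pt; rewrite -p0; apply: (partition_le p_partition) => //.
exact: leq_trans (ltnW i_lt_l) l_le_n.
Qed.

Lemma end_leT : b <= T.
Proof. by have [_ pn _] := p_partition; rewrite -pn; exact: (partition_le p_partition). Qed.

Let t0_ge0 : 0 <= t0 := start_ge0.

Let b_leT : b <= T := end_leT.

Let node_start : q i = t0.
Proof. by rewrite /q /node; apply/max_idPl; case/andP: t0_cell. Qed.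

Let node_later j : (i < j)%N -> (j <= l)%N -> q j = p j.
Proof.
move=> ij jl; apply/max_idPr; have /andP[_ /ltW tp] := t0_cell; apply: le_trans tp _.
by apply: (partition_le p_partition) => //; exact: leq_trans l_le_n.
Qed.

Let node_ge j : t0 <= q j. Proof. by rewrite le_max lexx. Qed.

Let node_ge' j : p j <= q j. Proof. by rewrite le_max lexx orbT. Qed.

Let node_le j : (i <= j)%N -> (j < l)%N -> q j <= q j.+1.
Proof.
move=> ij jl; rewrite ge_max node_ge /=; apply: le_trans (node_ge' j.+1).
by apply: (partition_le p_partition) => //; exact: leq_trans l_le_n.
Qed.

Let node_le_end j : (i <= j)%N -> (j <= l)%N -> q j <= b.
Proof.
move=> ij jl; rewrite ge_max; apply/andP; split.
  have /andP[_ /ltW tp] := t0_cell; apply: le_trans tp _.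
  exact: (partition_le p_partition).
exact: (partition_le p_partition).
Qed.

Lemma value_regular m j h : regular h -> (i <= j)%N -> (j + m <= l)%N ->
  regular (value q m j h).
Proof.
move=> rh; elim: m j => [//|m IH] j ij jl /=.
have jl' : (j < l)%N by apply: leq_trans jl; rewrite addnS ltnS leq_addr.
apply: (stage_value_regular P p_partition info1P info2P dynF).
- exact: leq_trans l_le_n.
- exact: node_ge'.
- exact: node_le.
- by rewrite node_later// lexx.
- by apply: IH; [exact: leqW|rewrite addSn -addnS].
Qed.

Definition position u v (w : Omega) j := state F t0 b x u v w (q j).

Let q_in j : (i <= j)%N -> (j <= l)%N -> t0 <= q j <= b.
Proof. by move=> ij jl; rewrite node_ge node_le_end. Qed.

Lemma position_congr u u' v v' (w w' : Omega) j : (i <= j)%N -> (j <= l)%N ->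
  C1 u -> C2 v -> C1 u' -> C2 v' ->
  {ae mu, forall r, t0 <= r -> r < q j -> u r w = u' r w' /\ v r w = v' r w'} ->
  position u v w j = position u' v' w' j.
Proof.
move=> ij jl.
move=> /(control_joint p_partition t0_ge0 b_leT) mu_ /(control_joint p_partition t0_ge0 b_leT) mv.
move=> /(control_joint p_partition t0_ge0 b_leT) mu' /(control_joint p_partition t0_ge0 b_leT) mv' H.
have qb := node_le_end ij jl.
have qq : t0 <= q j <= q j by rewrite node_ge lexx.
rewrite /position.
rewrite -(state_restrict dynF x w t0_ge0 b_leT qb mu_ mv qq).
rewrite -(state_restrict dynF x w' t0_ge0 b_leT qb mu' mv' qq).
apply: (state_congr dynF) => //.
- exact: (le_trans qb b_leT).
- exact: jointly_measurable_sub mu_.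
- exact: jointly_measurable_sub mv.
- exact: jointly_measurable_sub mu'.
- exact: jointly_measurable_sub mv'.
- apply: ae_impl (ae_conj H (ae_neq (q j))) => r [Hr rq] /andP[tr]; rewrite le_eqVlt.
  by move=> /predU1P[/rq//|]; exact: Hr.
Qed.

(** At each time before [q j] the controls read only the coordinates before [j]. *)
Lemma position_depends u v (w w' : Omega) j : (i <= j)%N -> (j <= l)%N ->
  C1 u -> C2 v -> (forall k, (k < j)%N -> w k = w' k) ->
  position u v w j = position u v w' j.
Proof.
move=> ij jl Cu Cv ww'; apply: position_congr => //; apply: aeW => r tr rq.
have jn := leq_trans jl l_le_n.
have rp : r < p j by move: rq; rewrite lt_max ltNge tr.
have rb : t0 <= r <= b by rewrite tr (le_trans (ltW rq))// node_le_end.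
have [ic1 _ _] := info1P; have [ic2 _ _] := info2P.
split; first exact: (control_depends p_partition ic1 t0_ge0 Cu jn rb rp ww').
exact: (control_depends p_partition ic2 t0_ge0 Cv jn rb rp ww').
Qed.

Lemma position_measurable u v j k : (i <= j)%N -> (j <= l)%N -> C1 u -> C2 v ->
  measurable_fun setT (fun w => position u v w j 0 k).
Proof.
move=> ij jl.
move=> /(control_joint p_partition t0_ge0 b_leT) mu_ /(control_joint p_partition t0_ge0 b_leT) mv.
by apply: (state_measurable dynF) => //; exact: q_in.
Qed.

Lemma position_bounded_measurable h u v j : regular h -> (i <= j)%N -> (j <= l)%N ->
  C1 u -> C2 v -> bounded_measurable (fun w => h (position u v w j)).
Proof.
move=> rh ij jl.
move=> /(control_joint p_partition t0_ge0 b_leT) mu_ /(control_joint p_partition t0_ge0 b_leT) mv.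
by apply: (regular_state dynF) => //; exact: q_in.
Qed.

Lemma position_start u v w : C1 u -> C2 v -> position u v w i = x.
Proof.
move=> /(control_joint p_partition t0_ge0 b_leT) mu_ /(control_joint p_partition t0_ge0 b_leT) mv.
rewrite /position node_start; apply: (state_start dynF) => //.
by rewrite -node_start; apply: node_le_end => //; exact: ltnW.
Qed.

(** During a stage the controls depend on the past through the indices [k1] and
  [k2] only, so resampling the future gives the payoff of the stage game. *)
Lemma one_step h u v j (k1 k2 : Omega -> nat) (c1 : nat -> R -> Omega -> E1)
    (c2 : nat -> R -> Omega -> E2) : regular h -> (i <= j)%N -> (j < l)%N ->
  C1 u -> C2 v ->
  (forall k, filtration j (k1 @^-1` [set k])) ->
  (forall k, filtration j (k2 @^-1` [set k])) ->
  (forall k, L0 (info1 j) (p j) (p j.+1) (c1 k)) ->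
  (forall k, L0 (info2 j) (p j) (p j.+1) (c2 k)) ->
  (forall s w, t0 <= s <= b -> p j <= s < p j.+1 -> u s w = c1 (k1 w) s w) ->
  (forall s w, t0 <= s <= b -> p j <= s < p j.+1 -> v s w = c2 (k2 w) s w) ->
  let Y w := stage_payoff P F (q j) (q j.+1) h (position u v w j) (c1 (k1 w)) (c2 (k2 w)) in
  bounded_measurable Y /\ forall A, filtration j A ->
  \int[P]_(w in A) h (position u v w j.+1) = \int[P]_(w in A) Y w.
Proof.
move=> rh ij jl Cu Cv Fk1 Fk2 Lc1 Lc2 uc vc Y.
have jn : (j < n)%N := leq_trans jl l_le_n.
have ij1 : (i <= j.+1)%N := leqW ij.
have bh := position_bounded_measurable rh ij1 jl Cu Cv.
have qp : q j.+1 = p j.+1 by rewrite node_later.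
have qb := node_le_end ij1 jl.
have c1_eq k (s : R) (w w' : Omega) : p j <= s <= p j.+1 -> w j = w' j -> c1 k s w = c1 k s w'.
  by move=> sj ww'; have [ic1 _ _] := info1P; exact: (L0_depends (ic1 j) (Lc1 k)).
have c2_eq k (s : R) (w w' : Omega) : p j <= s <= p j.+1 -> w j = w' j -> c2 k s w = c2 k s w'.
  by move=> sj ww'; have [ic2 _ _] := info2P; exact: (L0_depends (ic2 j) (Lc2 k)).
have k1_eq (w w' : Omega) : k1 (splice j w w') = k1 w.
  have /filtrationP[_ H] := Fk1 (k1 w).
  by apply: (H w) => // k kj; rewrite /splice kj.
have k2_eq (w w' : Omega) : k2 (splice j w w') = k2 w.
  have /filtrationP[_ H] := Fk2 (k2 w).
  by apply: (H w) => // k kj; rewrite /splice kj.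
have mu_ := control_joint p_partition t0_ge0 b_leT Cu.
have mv := control_joint p_partition t0_ge0 b_leT Cv.
have sub (E : pmetricType R) (K : set_system Omega) (c : R -> Omega -> E) :
    L0 K (p j) (p j.+1) c -> jointly_measurable (q j) (q j.+1) c.
  by move=> [mc _]; apply: jointly_measurable_sub mc => //; rewrite qp.
have sub' (E : pmetricType R) (c : R -> Omega -> E) :
    jointly_measurable t0 b c -> jointly_measurable (q j) (q j.+1) c.
  exact: jointly_measurable_sub.
have YE w : \int[P]_w' h (position u v (splice j w w') j.+1) = Y w.
  apply: eq_Rintegral => w' _; congr h.
  rewrite /position (state_flow dynF x _ t0_ge0 b_leT (node_ge j) _ mu_ mv); last first.
    by rewrite node_le.
  have qq : q j <= q j.+1 <= q j.+1 by rewrite node_le// lexx.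
  rewrite -(state_restrict dynF _ _ (le_trans t0_ge0 (node_ge j)) b_leT qb _ _ qq); last 2 first.
  - exact: jointly_measurable_sub mu_.
  - exact: jointly_measurable_sub mv.
  rewrite -/(position u v (splice j w w') j) (@position_depends u v _ w j ij (ltnW jl) Cu Cv); last first.
    by move=> k kj; rewrite /splice kj.
  apply: (state_congr dynF) => //.
  - exact: le_trans t0_ge0 (node_ge j).
  - exact: (le_trans qb b_leT).
  - exact: sub'.
  - exact: sub'.
  - exact: sub (Lc1 _).
  - exact: sub (Lc2 _).
  - apply: ae_impl (ae_neq (q j.+1)) => r rq /andP[qr]; rewrite le_eqVlt.
    move=> /predU1P[/rq//|]; rewrite qp => rp.
    have rb : t0 <= r <= b.
      by rewrite (le_trans (node_ge j) qr) (le_trans (ltW rp))// -qp.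
    have pr : p j <= r < p j.+1 by rewrite rp (le_trans (node_ge' j)).
    have pr' : p j <= r <= p j.+1 by rewrite (ltW rp) (le_trans (node_ge' j)).
    rewrite uc// vc// k1_eq k2_eq.
    by split; [apply: c1_eq|apply: c2_eq] => //; rewrite /splice ltnn.
have [mh [B hB]] := bh.
have bYs : bounded_measurable
    (fun w => \int[P]_w' h (position u v (splice j w w') j.+1)).
  apply: (@bounded_measurable_inner _ P
    (fun z => h (position u v (splice j z.1 z.2) j.+1))); split; last by exists B.
  by apply: (measurableT_comp mh); exact: measurable_splice.
split; first by rewrite -(funext YE).
move=> A FA; rewrite (integral_splice P_product FA bh).
by apply: eq_Rintegral => w _; exact: YE.
Qed.

Lemma index_pair_filtration j (k1 k2 : Omega -> nat) :
  (forall k, filtration j (k1 @^-1` [set k])) ->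
  (forall k, filtration j (k2 @^-1` [set k])) ->
  forall k, filtration j ((fun w => pickle (k1 w, k2 w)) @^-1` [set k]).
Proof.
move=> F1 F2 k.
case E : (@pickle_inv (nat * nat)%type k) => [[a c]|]; last first.
  rewrite (_ : _ @^-1` _ = set0); first by apply/filtrationP; split.
  apply/seteqP; split => // w /= Yk.
  by rewrite -Yk pickleK_inv in E.
have := @pickle_invK (nat * nat)%type k; rewrite E /= => Ek.
rewrite (_ : _ @^-1` _ = (k1 @^-1` [set a]) `&` (k2 @^-1` [set c])); last first.
  apply/seteqP; split => w /=; rewrite -Ek.
    by move=> /(pcan_inj pickleK)[-> ->].
  by move=> [-> ->].
have /filtrationP[m1 d1] := F1 a; have /filtrationP[m2 d2] := F2 c.
apply/filtrationP; split; first exact: measurableI.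
by move=> w w' ww' [H1 H2]; split; [exact: d1 H1|exact: d2 H2].
Qed.

Lemma cell_filtration delta u v j : 0 < delta -> (i <= j)%N -> (j <= l)%N ->
  C1 u -> C2 v -> forall k,
  filtration j ((fun w => grid_cell delta (position u v w j)) @^-1` [set k]).
Proof.
move=> d0 ij jl Cu Cv k; apply/filtrationP; split.
  rewrite -[X in measurable X]setTI; apply: measurable_grid_cell => // m.
  exact: position_measurable.
by move=> w w' ww' /= <-; rewrite (position_depends ij jl Cu Cv ww').
Qed.

Lemma ae_position_congr u u' v v' j : (i <= j)%N -> (j <= l)%N ->
  C1 u -> C2 v -> C1 u' -> C2 v' ->
  ae_equal_on P [set z | t0 <= z.1 <= b /\ z.1 <= q j] u u' ->
  ae_equal_on P [set z | t0 <= z.1 <= b /\ z.1 <= q j] v v' ->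
  {ae P, forall w, position u v w j = position u' v' w j}.
Proof.
move=> ij jl Cu Cv Cu' Cv' uu' vv'.
apply: ae_impl (ae_conj (ae_prod_section uu') (ae_prod_section vv')) => w [H H'].
apply: position_congr => //; apply: ae_impl (ae_conj H H') => r [/= h h'] tr rq.
have rb : t0 <= r <= b by rewrite tr (le_trans (ltW rq))// node_le_end.
by split; [apply: h|apply: h'] => /=; split => //; exact: ltW.
Qed.

Let value_step h j : (j < l)%N ->
  value q (l - j) j h = stage_value P p info1 info2 F j (q j) (q j.+1) (value q (l - j.+1) j.+1 h).
Proof. by move=> jl; rewrite -(subnSK jl). Qed.

Let value_tail_regular h j : regular h -> (i <= j)%N -> (j <= l)%N ->
  regular (value q (l - j) j h).
Proof. by move=> rh ij jl; apply: value_regular => //; rewrite subnKC. Qed.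

Let stage_bounds j : (i <= j)%N -> (j < l)%N ->
  [/\ (j < n)%N, p j <= q j, q j <= q j.+1 & q j.+1 <= p j.+1].
Proof.
move=> ij jl; split; [exact: leq_trans l_le_n|exact: node_ge'|exact: node_le|].
by rewrite node_later// lexx.
Qed.

(** The opponent knows [alpha], hence can anticipate its action on the next
  stage and answer it; as the past is settled, one control is built in this way,
  stage after stage. *)
Lemma best_response h alpha (eps : R) : regular h ->
  nad_strategies P n p t0 b C2 C1 alpha -> 0 < eps ->
  exists2 v, C2 v & forall A, filtration i A ->
    \int[P]_(w in A) h (position (alpha v) v w l) <=
      (value q (l - i) i h x + eps) * fine (P A).
Proof.
move=> rh Ha eps0; pose W j := value q (l - j) j h.
suff : exists2 v, C2 v & forall A, filtration i A ->
    \int[P]_(w in A) W (i + (l - i))%N (position (alpha v) v w (i + (l - i))%N) <=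
      (W i x + eps) * fine (P A).
  by rewrite subnKC ?(ltnW i_lt_l)// /W subnn.
have : (i + (l - i) <= l)%N by rewrite subnKC// ltnW.
elim: (l - i)%N eps eps0 => [|m IH] eps eps0 iml.
  have [_ z0 zT] := info2P.
  exists ((fun _ _ => point : E2) \_ `[t0, b]); first exact: control_point.
  move=> A FA; have /filtrationP[mA _] := FA.
  set v := (X in position (alpha X) X).
  have Cv : C2 v by exact: control_point.
  rewrite (_ : (fun w => _) = (fun=> W i x)); last first.
    by apply/funext => w; rewrite addn0 position_start//; exact: Ha.1.
  have PA0 : 0 <= fine (P A) by apply: fine_ge0; exact: measure_ge0.
  rewrite probability_integral_cst//; apply: ler_wpM2r; first exact: PA0.
  by rewrite lerDl ltW.
have eps20 : 0 < eps / 2 by rewrite divr_gt0.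
have jl : (i + m < l)%N by rewrite -addnS.
have [v Cv Hv] := IH _ eps20 (ltnW jl).
set j := (i + m)%N in jl Hv *; have ij : (i <= j)%N by exact: leq_addr.
have [jn pq qq qp] := stage_bounds ij jl.
have rW : regular (W j.+1) by apply: value_tail_regular => //; exact: leqW.
have [delta d0 resp] := stage_respond P p_partition info1P info2P dynF jn pq qq qp rW eps20.
have Cu := Ha.1 v Cv.
have [k1 [c1 [Fk1 Lc1 uc]]] := control_index Cu jn.
pose dec k := odflt (0%N, 0%N) (@unpickle (nat * nat)%type k).
have /choice[e eP] : forall k, exists e, L0 (info2 j) (p j) (p j.+1) e /\
    forall y', `|grid_point delta (dec k).2 - y'| <= delta ->
      stage_payoff P F (q j) (q j.+1) (W j.+1) y' (c1 (dec k).1) e <=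
      stage_value P p info1 info2 F j (q j) (q j.+1) (W j.+1) y' + eps / 2.
  move=> k; have [e Le He] := resp (c1 (dec k).1) (grid_point delta (dec k).2) (Lc1 _).
  by exists e.
pose k2 w := pickle (k1 w, grid_cell delta (position (alpha v) v w j)).
have Fk2 k : filtration j (k2 @^-1` [set k]).
  by apply: index_pair_filtration => //; apply: cell_filtration => //; exact: ltnW.
pose v' := replace_control p t0 b j k2 e v.
have Cv' : C2 v' by apply: (control_replace p_partition) => // k; exact: (eP k).1.
have v'E s w : t0 <= s <= b -> s < p j -> v' s w = v s w.
  by move=> sb sj; rewrite /v' replace_controlE// leNgt sj.
exists v' => // A FA; have Fj := filtration_le ij FA.
have /filtrationP[mA _] := FA.
have Cu' := Ha.1 v' Cv'.
have uu' : ae_equal_on P [set z | t0 <= z.1 <= b /\ z.1 <= p j.+1] (alpha v) (alpha v').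
  apply: (nad_stage Ha jn Cv Cv').
  have aeT : {ae P, forall w : Omega, True} by exact: aeW.
  apply: ae_impl (ae_prod_pair aeT (ae_neq (p j))) => -[s w] /= [sN _] [sb].
  by rewrite le_eqVlt => /predU1P[/sN//|sj]; rewrite v'E.
have pos_j w : position (alpha v) v' w j = position (alpha v) v w j.
  apply: position_congr => //; first exact: ltnW.
  apply: aeW => r tr rq; split => //; apply: v'E.
    by rewrite tr (le_trans (ltW rq))// node_le_end// ltnW.
  by move: rq; rewrite lt_max ltNge tr.
have ij1 : (i <= j.+1)%N by exact: leqW.
have pos_j1 : {ae P, forall w,
    position (alpha v') v' w j.+1 = position (alpha v) v' w j.+1}.
  apply: ae_position_congr => //.
    by rewrite node_later//; exact: ae_equal_on_sym.
  by apply: aeW => z _.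
have vc s w : t0 <= s <= b -> p j <= s < p j.+1 -> v' s w = e (k2 w) s w.
  by move=> sb sj; rewrite /v' replace_controlE// sj.
have [bY IY] := one_step rW ij jl Cu Cv' Fk1 Fk2 Lc1 (fun k => (eP k).1) uc vc.
rewrite addnS -/j.
have b1 := position_bounded_measurable rW ij1 jl Cu' Cv'.
have b2 := position_bounded_measurable rW ij1 jl Cu Cv'.
rewrite (ae_eq_bounded_integral mA b1.1 b2.1); last first.
  by apply: ae_impl pos_j1 => w ->.
rewrite IY//.
have rWj : regular (W j) by apply: value_tail_regular => //; exact: ltnW.
have b3 := position_bounded_measurable rWj ij (ltnW jl) Cu Cv.
apply: (@le_trans _ _ (\int[P]_(w in A) (W j (position (alpha v) v w j) + eps / 2))).
  apply: le_bounded_integral => //.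
    by apply: bounded_measurableD => //; exact: bounded_measurable_cst.
  move=> w _; rewrite pos_j [W j](value_step h jl).
  have := (eP (k2 w)).2 (position (alpha v) v w j).
  rewrite /dec /k2 pickleK /=; apply; exact: grid_point_near.
rewrite RintegralD//; [|exact: bounded_measurable_integrable|]; last first.
  by apply: bounded_measurable_integrable => //; exact: bounded_measurable_cst.
rewrite probability_integral_cst//.
have := Hv A FA; rewrite -/j !mulrDl => H.
apply: le_trans (lerD H (lexx _)) _.
by rewrite -addrA lerD2l -mulrDl -splitr.
Qed.

Section feedback.
Variables (delta : nat -> R) (c : nat -> nat -> R -> Omega -> E1).
Hypothesis delta_gt0 : forall j, 0 < delta j.
Hypothesis c_L0 : forall j k, (i <= j < l)%N -> L0 (info1 j) (p j) (p j.+1) (c j k).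

Fixpoint feedback v m : R -> Omega -> E1 :=
  if m is m'.+1 then
    replace_control p t0 b (i + m')
      (fun w => grid_cell (delta (i + m')) (position (feedback v m') v w (i + m')))
      (c (i + m')) (feedback v m')
  else (fun _ _ => point : E1) \_ `[t0, b].

Lemma feedback_at v m s w : t0 <= s <= b -> feedback v m.+1 s w =
  if p (i + m)%N <= s < p (i + m).+1 then
    c (i + m) (grid_cell (delta (i + m)) (position (feedback v m) v w (i + m))) s w
  else feedback v m s w.
Proof. exact: replace_controlE. Qed.

Lemma feedback_control v m : C2 v -> (i + m <= l)%N -> C1 (feedback v m).
Proof.
move=> Cv; elim: m => [_|m IH]; first by case: info1P => _ *; exact: control_point.
rewrite addnS => ml /=; have ijl : (i <= i + m < l)%N by rewrite leq_addr.
apply: (control_replace p_partition).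
- exact: leq_trans l_le_n.
- move=> k; apply: cell_filtration => //; [exact: leq_addr|exact: ltnW|].
  by apply: IH; exact: ltnW.
- by move=> k; exact: c_L0.
- by apply: IH; exact: ltnW.
Qed.

Lemma feedback_settled v m m' s w : (m <= m')%N -> (i + m' <= l)%N ->
  t0 <= s <= b -> s < p (i + m)%N -> feedback v m' s w = feedback v m s w.
Proof.
move=> + + sb sm; elim: m' => [|m' IH]; first by rewrite leqn0 => /eqP ->.
rewrite leq_eqVlt => /predU1P[->//|mm'] ml; rewrite feedback_at//.
have -> : (p (i + m')%N <= s) = false.
  apply/negbTE; rewrite -ltNge; apply: lt_le_trans sm _.
  apply: (partition_le p_partition); first by rewrite leq_add2l.
  by apply: leq_trans l_le_n; apply: leq_trans ml; rewrite leq_add2l.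
by apply: IH => //; apply: leq_trans ml; rewrite leq_add2l.
Qed.

Let alpha v := feedback v (l - i).

Let il : (i + (l - i))%N = l. Proof. by rewrite subnKC// ltnW. Qed.

(** The feedback control before time [p k.+1] is computed from the opponent's
  control before time [p k], path by path. *)
Lemma feedback_nonanticipative : nad_strategies P n p t0 b C2 C1 alpha.
Proof.
split=> [v Cv|tau _ tau_lt v v' Cv Cv' vv'].
  by apply: feedback_control => //; rewrite il.
have aes := ae_prod_section vv'.
suff H w : {ae mu, forall s, t0 <= s <= b /\ s <= p (tau w) -> v s w = v' s w} ->
    forall m, (i + m <= l)%N -> forall s, t0 <= s <= b -> s < p (tau w).+1 ->
    feedback v m s w = feedback v' m s w.
  apply: ae_impl (ae_prod_pair aes (ae_neq_all p)) => -[s w] /= [sN Hw] [sb sp].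
  apply: H => //; first by rewrite il.
  by rewrite lt_neqAle sp andbT; apply/eqP; exact: sN.
move=> Hw; elim=> [//|m IH] ml s sb sp.
have ml' : (i + m < l)%N by rewrite -addnS.
rewrite (feedback_at v m w sb) (feedback_at v' m w sb).
case: ifPn => [/andP[js _]|_]; last by apply: (IH (ltnW ml')).
have jtau : (i + m <= tau w)%N.
  rewrite leqNgt; apply/negP => tj.
  have := partition_le p_partition tj (ltnW (leq_trans ml' l_le_n)).
  by rewrite leNgt (le_lt_trans js sp).
suff -> : position (feedback v m) v w (i + m) = position (feedback v' m) v' w (i + m) by [].
apply: position_congr => //; try exact: leq_addr; try exact: ltnW;
  try by apply: feedback_control => //; exact: ltnW.
apply: ae_impl Hw => r Hr tr rq.
have rb : t0 <= r <= b.
  by rewrite tr (le_trans (ltW rq))// node_le_end ?leq_addr// ltnW.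
have rp : r < p (i + m)%N by move: rq; rewrite lt_max ltNge tr.
have ptau : p (i + m)%N <= p (tau w).
  by apply: (partition_le p_partition) => //; exact: ltnW.
split; last by apply: Hr; split => //; rewrite (le_trans (ltW rp)).
apply: (IH (ltnW ml')) => //; apply: lt_le_trans rp _.
apply: le_trans ptau _; apply: (partition_le p_partition) => //.
Qed.

Lemma feedback_stage v j s w : C2 v -> (i <= j < l)%N -> t0 <= s <= b ->
  p j <= s < p j.+1 ->
  alpha v s w = c j (grid_cell (delta j) (position (alpha v) v w j)) s w.
Proof.
move=> Cv /andP[ij jl] sb sj.
have [m jE] : exists m, j = (i + m)%N by exists (j - i)%N; rewrite subnKC.
have ml : (m.+1 <= l - i)%N by rewrite ltn_subRL -jE.
have sp : s < p (i + m.+1)%N by rewrite addnS -jE; case/andP: sj.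
rewrite /alpha (feedback_settled v w ml) ?il// feedback_at// -jE sj.
congr (c j (grid_cell _ _) s w); apply: position_congr => //; first exact: ltnW.
- by apply: feedback_control => //; rewrite -jE ltnW.
- by apply: feedback_control => //; rewrite il.
apply: aeW => r tr rq; split => //.
have rb : t0 <= r <= b by rewrite tr (le_trans (ltW rq))// node_le_end// ltnW.
have rp : r < p (i + m)%N by move: rq; rewrite -jE lt_max ltNge tr.
by rewrite (feedback_settled v w (ltnW ml)) ?il.
Qed.

End feedback.

(** Whatever the opponent plays, each stage yields its value up to [eps / l]: the
  feedback secures it at the centre of the cell and the position is close to it. *)
Lemma feedback_strategy h (eps : R) : regular h -> 0 < eps ->
  exists2 alpha, nad_strategies P n p t0 b C2 C1 alpha &
  forall v, C2 v -> forall A, filtration i A ->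
    (value q (l - i) i h x - eps) * fine (P A) <=
      \int[P]_(w in A) h (position (alpha v) v w l).
Proof.
move=> rh eps0; pose W j := value q (l - j) j h.
have l_gt0 : (0 < l)%N by exact: leq_ltn_trans i_lt_l.
pose e0 := eps / l%:R; have e00 : 0 < e0 by rewrite divr_gt0// ltr0n.
have /choice[dc dcP] : forall j, exists dc : R * (nat -> R -> Omega -> E1),
    0 < dc.1 /\ ((i <= j < l)%N -> forall k, L0 (info1 j) (p j) (p j.+1) (dc.2 k) /\
      forall e y, L0 (info2 j) (p j) (p j.+1) e -> `|grid_point dc.1 k - y| <= dc.1 ->
        W j y - e0 <= stage_payoff P F (q j) (q j.+1) (W j.+1) y (dc.2 k) e).
  move=> j; have [/andP[ij jl]|nij] := boolP (i <= j < l)%N; last first.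
    by exists (1, fun _ _ _ => point).
  have [jn pq qq qp] := stage_bounds ij jl.
  have rW : regular (W j.+1) by apply: value_tail_regular => //; exact: leqW.
  have [delta d0 sec] := stage_secure P p_partition info1P info2P dynF jn pq qq qp rW e00.
  have /choice[c cP] : forall k, exists c, L0 (info1 j) (p j) (p j.+1) c /\
      forall e y, L0 (info2 j) (p j) (p j.+1) e -> `|grid_point delta k - y| <= delta ->
        W j y - e0 <= stage_payoff P F (q j) (q j.+1) (W j.+1) y c e.
    move=> k; have [c Lc Hc] := sec (grid_point delta k).
    by exists c; split => // e y; rewrite [W j](value_step h jl); exact: Hc.
  by exists (delta, c).
pose delta j := (dc j).1; pose c j := (dc j).2.
have d0 j : 0 < delta j := (dcP j).1.
have cL j k : (i <= j < l)%N -> L0 (info1 j) (p j) (p j.+1) (c j k).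
  by move=> ijl; exact: ((dcP j).2 ijl k).1.
pose alpha v := feedback delta c v (l - i).
have Ha : nad_strategies P n p t0 b C2 C1 alpha by exact: feedback_nonanticipative.
exists alpha => // v Cv A FA; have Cu := Ha.1 v Cv.
have /filtrationP[mA _] := FA.
have PA0 : 0 <= fine (P A) by apply: fine_ge0; exact: measure_ge0.
suff H : forall m, (i + m <= l)%N -> (W i x - m%:R * e0) * fine (P A) <=
    \int[P]_(w in A) W (i + m)%N (position (alpha v) v w (i + m)%N).
  have := H (l - i)%N; rewrite subnKC ?(ltnW i_lt_l)// {2}/W subnn => /(_ (leqnn _)).
  apply: le_trans; apply: ler_wpM2r; first exact: PA0.
  rewrite lerD2l lerN2 /e0 mulrCA ler_piMr ?(ltW eps0)// ler_pdivrMr ?ltr0n// mul1r.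
  by rewrite ler_nat leq_subr.
elim=> [_|m IH ml].
  rewrite (_ : (fun w => _) = (fun=> W i x)); last first.
    by apply/funext => w; rewrite addn0 position_start.
  by rewrite probability_integral_cst// mul0r subr0.
have jl : (i + m < l)%N by rewrite -addnS.
have {IH} := IH (ltnW jl); rewrite addnS; set j := (i + m)%N in jl * => IH.
have ij : (i <= j)%N by exact: leq_addr.
have [jn pq qq qp] := stage_bounds ij jl.
have rW : regular (W j.+1) by apply: value_tail_regular => //; exact: leqW.
have [k2 [c2 [Fk2 Lc2 vc]]] := control_index Cv jn.
pose k1 w := grid_cell (delta j) (position (alpha v) v w j).
have ijl : (i <= j < l)%N by rewrite ij.
have Fk1 k : filtration j (k1 @^-1` [set k]) by apply: cell_filtration => //; exact: ltnW.
have uc s w : t0 <= s <= b -> p j <= s < p j.+1 -> alpha v s w = c j (k1 w) s w.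
  by move=> sb sj; exact: feedback_stage.
have Lc1 k : L0 (info1 j) (p j) (p j.+1) (c j k) by exact: cL.
have [bY IY] := one_step rW ij jl Cu Cv Fk1 Fk2 Lc1 Lc2 uc vc.
have Fj := filtration_le ij FA; rewrite IY//.
have rWj : regular (W j) by apply: value_tail_regular => //; exact: ltnW.
have b3 := position_bounded_measurable rWj ij (ltnW jl) Cu Cv.
apply: (@le_trans _ _ (\int[P]_(w in A) (W j (position (alpha v) v w j) - e0))).
  rewrite RintegralB//; [|exact: bounded_measurable_integrable|]; last first.
    by apply: bounded_measurable_integrable => //; exact: bounded_measurable_cst.
  rewrite probability_integral_cst//.
  have -> : m.+1%:R * e0 = m%:R * e0 + e0 by rewrite -natr1 mulrDl mul1r.
  by rewrite opprD addrA mulrBl lerD2r.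
apply: le_bounded_integral => //.
  by apply: bounded_measurableD => //; exact: bounded_measurable_cst.
move=> w _; apply: ((dcP j).2 ijl (k1 w)).2; first exact: Lc2.
exact: grid_point_near (d0 j).
Qed.

End dynamic_programming.

(** * Conditional payoffs and game outcomes *)

Section conditional_expectations.
Context {R : realType} (P : probability (Omega R) R).
Hypothesis P_product : is_product_lebesgue P.
Local Notation Omega := (Omega R).

Lemma filtration_measurable j : @filtration R j `<=` measurable.
Proof. by move=> A /filtrationP[]. Qed.

(** The version chosen for [X] is used through the bounded variable [X0], for which
  a conditional expectation exists. *)
Lemma cond_exp_ae j (X X0 : Omega -> R) : measurable_fun setT X ->
  bounded_measurable X0 -> {ae P, forall w, X w = X0 w} ->
  is_cond_exp P (filtration j) X0 (cond_exp P (filtration j) X).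
Proof.
move=> mX bX0 XX0.
have same Y : is_cond_exp P (filtration j) X Y <-> is_cond_exp P (filtration j) X0 Y.
  have E A : filtration j A ->
      (\int[P]_(w in A) (X w)%:E = \int[P]_(w in A) (X0 w)%:E)%E.
    move=> /filtration_measurable mA; apply: ae_eq_integral => //.
    - by apply/measurable_EFinP; exact: measurable_funTS.
    - by apply/measurable_EFinP; apply: measurable_funTS; case: bX0.
    - by apply: ae_impl XX0 => w + _ => ->.
  by split=> -[mY iY IY]; split => // A FA; rewrite IY// E.
apply/same; apply: getPex; eexists; apply/same.
exact: is_cond_exp_splice.
Qed.

Section bounds.
Variables (j : nat) (X Y : Omega -> R).
Hypotheses (XY : is_cond_exp P (filtration j) X Y).

Lemma cond_exp_measurable : measurable_fun setT Y.
Proof.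
case: XY => mY _ _ _ B mB; apply: filtration_measurable; apply: mY.
by exists B.
Qed.

Let integralE A : filtration j A -> \int[P]_(w in A) Y w = \int[P]_(w in A) X w.
Proof. by move=> FA; case: XY => _ _ H; rewrite /Rintegral H. Qed.

Lemma cond_exp_le c :
  (forall A, filtration j A -> \int[P]_(w in A) X w <= c * fine (P A)) ->
  {ae P, forall w, Y w <= c}.
Proof.
move=> H; case: XY => mY iY _.
apply: (@le_of_integral_le _ P (filtration j)) => //.
  exact: filtration_measurable.
by move=> A FA; rewrite integralE//; exact: H.
Qed.

Lemma cond_exp_ge c :
  (forall A, filtration j A -> c * fine (P A) <= \int[P]_(w in A) X w) ->
  {ae P, forall w, c <= Y w}.
Proof.
move=> H; case: XY => mY iY _.
suff : {ae P, forall w, -1 * Y w <= - c}.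
  by apply: ae_impl => w; rewrite mulN1r lerN2.
apply: (@le_of_integral_le _ P (filtration j)).
- exact: filtration_measurable.
- move=> _ [B mB <-]; apply: mY; exists ((fun y => -1 * y) @^-1` B) => //.
  rewrite -[X in measurable X]setTI.
  by apply: (@measurable_funM _ _ _ _ (cst (-1)) id) => //; exact: measurable_cst.
- rewrite (_ : EFin \o _ = (fun w => (-1)%:E * (EFin \o Y) w)%E); first exact: integrableZl.
  by apply/funext => w; rewrite /= -EFinM.
- move=> A FA; have mA := filtration_measurable FA.
  rewrite RintegralZl//; last exact: integrableS iY.
  by rewrite integralE// mulN1r mulNr lerN2; exact: H.
Qed.

Lemma cond_exp_bounded B : measurable_fun setT X -> (forall w, `|X w| <= B) ->
  {ae P, forall w, `|Y w| <= B}.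
Proof.
move=> mX XB; have bX : bounded_measurable X by split => //; exists B.
have h1 : {ae P, forall w, Y w <= B}.
  apply: cond_exp_le => A /filtration_measurable mA.
  rewrite -probability_integral_cst//; apply: le_bounded_integral => //.
    exact: bounded_measurable_cst.
  by move=> w _; have := XB w; rewrite ler_norml => /andP[].
have h2 : {ae P, forall w, - B <= Y w}.
  apply: cond_exp_ge => A /filtration_measurable mA.
  rewrite -probability_integral_cst//; apply: le_bounded_integral => //.
    exact: bounded_measurable_cst.
  by move=> w _; have := XB w; rewrite ler_norml => /andP[].
by apply: ae_impl (ae_conj h1 h2) => w [? ?]; rewrite ler_norml; apply/andP.
Qed.

End bounds.

Lemma essinf_exists_ae (I : Type) (A : set I) (Y : I -> Omega -> R) B :
  (forall a, A a -> measurable_fun setT (Y a)) ->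
  (forall a, A a -> {ae P, forall w, `|Y a w| <= B}) ->
  exists Z, is_essinf P A (fun a w => (Y a w)%:E) Z.
Proof.
move=> mY YB; pose x a w := Num.max (- `|B|) (Num.min (Y a w) `|B|).
apply: (@essinf_exists _ P _ _ _ x `|B|).
- move=> a Aa; apply: measurable_maxr; first exact: measurable_cst.
  by apply: measurable_minr; [exact: mY|exact: measurable_cst].
- move=> a w _; rewrite /x ler_norml le_max lexx /= ge_max ge_min lexx orbT andbT.
  by rewrite (@le_trans _ _ 0)// oppr_le0.
- move=> a Aa; apply: ae_impl (YB a Aa) => w YBw; congr (_%:E).
  have YB' : `|Y a w| <= `|B| := le_trans YBw (ler_norm B).
  by move: YB'; rewrite /x ler_norml => /andP[h1 h2]; rewrite (min_idPl h2) (max_idPr h1).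
Qed.

Lemma esssup_exists_ae (I : Type) (A : set I) (Y : I -> Omega -> R) B :
  (forall a, A a -> measurable_fun setT (Y a)) ->
  (forall a, A a -> {ae P, forall w, `|Y a w| <= B}) ->
  exists Z, is_esssup P A (fun a w => (Y a w)%:E) Z.
Proof.
move=> mY YB.
have [|a Aa|Z HZ] := @essinf_exists_ae _ A (fun a w => - Y a w) B.
- by move=> a Aa; apply: measurableT_comp => //; exact: mY.
- by apply: ae_impl (YB a Aa) => w; rewrite normrN.
by exists (fun w => - Z w)%E; apply: is_essinfN.
Qed.

End conditional_expectations.

Section game_outcomes.
Context {R : realType} {d : nat} {E1 E2 : pmetricType R} (P : probability (Omega R) R).
Hypothesis P_product : is_product_lebesgue P.
Local Notation Omega := (Omega R).
Variables (n : nat) (p : nat -> R) (T : R).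
Hypothesis p_partition : is_partition T n p.
Variables (info1 info2 : nat -> set_system Omega).
Hypotheses (info1P : information info1) (info2P : information info2).
Variables (M L : R) (F : R -> 'rV[R]_d -> E1 -> E2 -> 'rV[R]_d).
Hypothesis dynF : game_dynamics T M L F.
Variables (i l : nat) (t0 : R) (x : 'rV[R]_d).
Hypotheses (i_lt_l : (i < l)%N) (l_le_n : (l <= n)%N) (t0_cell : p i <= t0 < p i.+1).

Let b := p l.
Local Notation C1 := (controls n p info1 t0 b).
Local Notation C2 := (controls n p info2 t0 b).

Lemma start_le_end : t0 <= b.
Proof.
have /andP[_ /ltW tp] := t0_cell; apply: le_trans tp _.
exact: (partition_le p_partition).
Qed.

Definition is_outcome alpha beta (u : R -> Omega -> E1) (v : R -> Omega -> E2) :=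
  [/\ C1 u, C2 v, ae_equal_on P (`[t0, b] `*` setT) (alpha v) u &
      ae_equal_on P (`[t0, b] `*` setT) (beta u) v].

Implicit Types (u : R -> Omega -> E1) (v : R -> Omega -> E2).

Definition terminal u v (w : Omega) := state F t0 b x u v w b.

Let terminalE u v w : terminal u v w = position p F l t0 x u v w l.
Proof.
rewrite /terminal /position /node; congr (state _ _ _ _ _ _ _ _).
by apply/esym/max_idPr; exact: start_le_end.
Qed.

Let n_gt0 : (0 < n)%N. Proof. by apply: leq_trans l_le_n; exact: leq_ltn_trans i_lt_l. Qed.

Lemma terminal_bounded_measurable H u v : regular H -> C1 u -> C2 v ->
  bounded_measurable (fun w => H (terminal u v w)).
Proof.
move=> rH Cu Cv.
have -> : (fun w => H (terminal u v w)) = (fun w => H (position p F l t0 x u v w l)).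
  by apply/funext => w; rewrite terminalE.
exact: (position_bounded_measurable p_partition dynF x i_lt_l l_le_n t0_cell
  rH (ltnW i_lt_l) (leqnn l) Cu Cv).
Qed.

Lemma terminal_measurable u v k : C1 u -> C2 v ->
  measurable_fun setT (fun w => terminal u v w 0 k).
Proof.
move=> Cu Cv.
have -> : (fun w => terminal u v w 0 k) = (fun w => position p F l t0 x u v w l 0 k).
  by apply/funext => w; rewrite terminalE.
exact: (position_measurable p_partition dynF x i_lt_l l_le_n t0_cell
  k (ltnW i_lt_l) (leqnn l) Cu Cv).
Qed.

Let ae_terminal u u' v v' : C1 u -> C2 v -> C1 u' -> C2 v' ->
  ae_equal_on P (`[t0, b] `*` setT) u u' -> ae_equal_on P (`[t0, b] `*` setT) v v' ->
  {ae P, forall w, terminal u v w = terminal u' v' w}.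
Proof.
move=> Cu Cv Cu' Cv' uu' vv'.
have sub : [set z : R * Omega | t0 <= z.1 <= b /\ z.1 <= node p t0 l] `<=` `[t0, b] `*` setT.
  by move=> [s w] /= [sb _]; rewrite in_itv.
have := ae_position_congr p_partition dynF x i_lt_l l_le_n t0_cell
  (ltnW i_lt_l) (leqnn l) Cu Cv Cu' Cv'
  (ae_equal_on_sub sub uu') (ae_equal_on_sub sub vv').
by apply: ae_impl => w; rewrite !terminalE.
Qed.

Let game_value H := value P p info1 info2 F (node p t0) (l - i) i H x.

(** The response is the strategy that plays a fixed control: facing it, [alpha] has
  to play its own answer to this control, almost everywhere. *)
Lemma respond H alpha (eps : R) : regular H ->
  nad_strategies P n p t0 b C2 C1 alpha -> 0 < eps ->
  exists2 beta, nad_strategies P n p t0 b C1 C2 beta &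
    forall u v, is_outcome alpha beta u v -> forall A, filtration i A ->
      \int[P]_(w in A) H (terminal u v w) <= (game_value H + eps) * fine (P A).
Proof.
move=> rH Ha eps0.
have [v0 Cv0 Hv0] := best_response P_product p_partition info1P info2P dynF x
  i_lt_l l_le_n t0_cell rH Ha eps0.
exists (fun=> v0) => [|u v [Cu Cv auv bv] A FA].
  by split=> [//|tau _ _ u u' _ _ _]; apply: aeW.
have mA := filtration_measurable FA; have Cu0 := Ha.1 v0 Cv0.
have au := nad_full p_partition (end_leT p_partition l_le_n) Ha n_gt0 Cv0 Cv bv.
have tE := ae_terminal Cu0 Cv0 Cu Cv (ae_equal_on_trans au auv) bv.
have b1 := terminal_bounded_measurable rH Cu0 Cv0.
have b2 := terminal_bounded_measurable rH Cu Cv.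
rewrite -(ae_eq_bounded_integral mA b1.1 b2.1); last first.
  by apply: ae_impl tE => w ->.
under eq_Rintegral do rewrite terminalE.
exact: Hv0.
Qed.

Lemma secure H (eps : R) : regular H -> 0 < eps ->
  exists2 alpha, nad_strategies P n p t0 b C2 C1 alpha &
    forall beta u v, is_outcome alpha beta u v -> forall A, filtration i A ->
      (game_value H - eps) * fine (P A) <= \int[P]_(w in A) H (terminal u v w).
Proof.
move=> rH eps0.
have [alpha Ha Hv] := feedback_strategy P_product p_partition info1P info2P dynF x
  i_lt_l l_le_n t0_cell rH eps0.
exists alpha => // beta u v [Cu Cv auv bv] A FA.
have mA := filtration_measurable FA; have Cu0 := Ha.1 v Cv.
have vv : ae_equal_on P (`[t0, b] `*` setT) v v by apply: aeW.
have tE := ae_terminal Cu0 Cv Cu Cv auv vv.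
have b1 := terminal_bounded_measurable rH Cu0 Cv.
have b2 := terminal_bounded_measurable rH Cu Cv.
rewrite -(ae_eq_bounded_integral mA b1.1 b2.1); last first.
  by apply: ae_impl tE => w ->.
under eq_Rintegral do rewrite terminalE.
exact: Hv.
Qed.

Lemma is_outcome_exists alpha beta :
  nad_strategies P n p t0 b C2 C1 alpha -> nad_strategies P n p t0 b C1 C2 beta ->
  exists u v, is_outcome alpha beta u v.
Proof.
move=> Ha Hb; apply: (outcome_exists p_partition (start_ge0 p_partition i_lt_l l_le_n t0_cell)
  (end_leT p_partition l_le_n) Ha Hb).
- by case: info1P => _ z0 zT; eexists; exact: control_point.
- by case: info2P => _ z0 zT; eexists; exact: control_point.
Qed.

End game_outcomes.

(** * The lower and the upper value *)

Section information_instances.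
Context {R : realType}.

Lemma information_U : information (@infoU R).
Proof.
split=> [j A|j|j]; first exact: infoU_coordinate.
- by exists set0 => //; rewrite preimage_set0 setI0.
- by exists setT => //; rewrite preimage_setT setTI.
Qed.

Lemma information_V : information (@infoV R).
Proof.
split=> [j A|j|j]; first exact: infoV_coordinate.
- by exists set0 => //; rewrite preimage_set0 setI0.
- by exists setT => //; rewrite preimage_setT setTI.
Qed.

End information_instances.

Lemma regularN {R : realType} {d : nat} (h : 'rV[R]_d -> R) :
  regular h -> regular (fun y => - h y).
Proof.
move=> [[B hB] [K K0 hK]]; split; first by exists B => y; rewrite normrN.
by exists K => // y y'; rewrite -opprD normrN; exact: hK.
Qed.

Section value_of_the_game.
Context {R : realType} {d : nat} {U V : pmetricType R} (P : probability (Omega R) R).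
Hypothesis P_product : is_product_lebesgue P.
Local Notation Omega := (Omega R).
Variables (n : nat) (p : nat -> R) (T : R).
Hypothesis p_partition : is_partition T n p.
Variables (M L : R) (f : R -> 'rV[R]_d -> U -> V -> 'rV[R]_d).
Hypothesis dynf : game_dynamics T M L f.

Definition swap_players (r : R) y (c : V) (e : U) := f r y e c.

Lemma swap_dynamics : game_dynamics T M L swap_players.
Proof.
case: dynf => cU cV bf cf L0 lf; split => //.
- by move=> t x c e; exact: bf.
- apply/subspace_continuousP => -[[[t y] c] e] /= tT.
  pose g (z : R * 'rV[R]_d * V * U) := (z.1.1, z.2, z.1.2).
  pose F (z : R * 'rV[R]_d * U * V) := f z.1.1.1 z.1.1.2 z.1.2 z.2.
  have cF : F z @[z --> within [set z | 0 <= z.1.1.1 <= T] (nbhs (g (t, y, c, e)))]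
      --> F (g (t, y, c, e)).
    by move/subspace_continuousP : cf; exact.
  apply: (@within_cvg_comp _ _ _ _ _ g F _ _ _ _ cF) => //.
  have c11 : {for (t, y, c, e), continuous (fun z : R * 'rV[R]_d * V * U => z.1.1)}.
    apply: (@continuous_comp _ _ _ fst fst); first exact: cvg_fst.
    exact: cvg_fst.
  have c12 : {for (t, y, c, e), continuous (fun z : R * 'rV[R]_d * V * U => z.1.2)}.
    by apply: (@continuous_comp _ _ _ fst snd); [exact: cvg_fst|exact: cvg_snd].
  have c2 : {for (t, y, c, e), continuous (fun z : R * 'rV[R]_d * V * U => z.2)}.
    exact: cvg_snd.
  exact: continuous_pair_at (continuous_pair_at c11 c2) c12.
- by move=> t x y c e; exact: lf.
Qed.

Section interval.
Variables (i l : nat) (t0 : R) (x : 'rV[R]_d).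
Hypotheses (i_lt_l : (i < l)%N) (l_le_n : (l <= n)%N) (t0_cell : p i <= t0 < p i.+1).

Let b := p l.
Local Notation CU := (controlsU n p t0 b : set (R -> Omega -> U)).
Local Notation CV := (controlsV n p t0 b : set (R -> Omega -> V)).
Local Notation SA := (strategiesA P n p t0 b : set ((R -> Omega -> V) -> (R -> Omega -> U))).
Local Notation SB := (strategiesB P n p t0 b : set ((R -> Omega -> U) -> (R -> Omega -> V))).

(* The reward is a random field because the value at an intermediate time is only
   known up to null events; almost surely it is the deterministic [H]. *)
Variables (h : 'rV[R]_d -> Omega -> R) (H : 'rV[R]_d -> R).
Hypotheses (rH : regular H) (mh : forall y, measurable_fun setT (h y))
  (h_lip : exists K, forall w y y', `|h y w - h y' w| <= K * `|y - y'|)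
  (hH : {ae P, forall w, forall y, h y w = H y}).

Let outcome_of alpha beta : SA alpha -> SB beta ->
  is_outcome P n p infoU infoV l t0 alpha beta
    (outcome P n p t0 b alpha beta).1 (outcome P n p t0 b alpha beta).2.
Proof.
move=> Ha Hb; have [u [v [Cu Cv au bv]]] := is_outcome_exists p_partition
  information_U information_V i_lt_l l_le_n t0_cell Ha Hb.
suff : [set uv : (R -> Omega -> U) * (R -> Omega -> V) |
    [/\ CU uv.1, CV uv.2, ae_equal_on P (`[t0, b] `*` setT) (alpha uv.2) uv.1 &
        ae_equal_on P (`[t0, b] `*` setT) (beta uv.1) uv.2]] (outcome P n p t0 b alpha beta).
  by [].
by apply: getPex; exists (u, v).
Qed.

Let payoff_variable alpha beta :=
  cond_exp P (filtration i) (fun w => h (state_at_end P n p f t0 b x alpha beta w) w).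

Let final alpha beta (w : Omega) : 'rV[R]_d :=
  terminal p f l t0 x (outcome P n p t0 b alpha beta).1 (outcome P n p t0 b alpha beta).2 w.

Let payoff_cond_exp alpha beta : SA alpha -> SB beta ->
  is_cond_exp P (filtration i) (fun w => H (final alpha beta w)) (payoff_variable alpha beta).
Proof.
move=> Ha Hb; have [Cu Cv _ _] := outcome_of Ha Hb.
apply: cond_exp_ae => //.
- have [K hK] := h_lip.
  apply: (@lipschitz_measurable _ _ _ _ _ (final alpha beta) h K) => // k.
  exact: (terminal_measurable p_partition dynf x i_lt_l l_le_n t0_cell k Cu Cv).
- exact: (terminal_bounded_measurable p_partition dynf x i_lt_l l_le_n t0_cell rH Cu Cv).
- by apply: ae_impl hH => w; apply.
Qed.

Let payoff_bounded : exists B, forall alpha beta, SA alpha -> SB beta ->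
  {ae P, forall w, `|payoff_variable alpha beta w| <= B}.
Proof.
have [[B HB] _] := rH; exists B => alpha beta Ha Hb.
have [Cu Cv _ _] := outcome_of Ha Hb.
apply: (cond_exp_bounded (payoff_cond_exp Ha Hb)) => //.
by case: (terminal_bounded_measurable p_partition dynf x i_lt_l l_le_n t0_cell rH Cu Cv).
Qed.

(** The conditional expectations are compared with a constant after integration
  over the events of [filtration i]. *)
Lemma sup_inf_value :
  {ae P, forall w, sup_inf P n p f i t0 b x h w =
     (value P p infoU infoV f (node p t0) (l - i) i H x)%:E}.
Proof.
have [B YB] := payoff_bounded.
apply: esssup_essinf_cst.
- move=> alpha Ha.
  apply: (essinf_exists_ae (Y := payoff_variable alpha) (B := B)) => beta Hb.
    exact: cond_exp_measurable (payoff_cond_exp Ha Hb).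
  exact: YB.
- move=> alpha e Ha e0.
  have [beta Hb Hr] := respond P_product p_partition information_U information_V
    dynf x i_lt_l l_le_n t0_cell rH Ha e0.
  exists beta => //.
  have := cond_exp_le (payoff_cond_exp Ha Hb) (Hr _ _ (outcome_of Ha Hb)).
  by apply: ae_impl => w; rewrite lee_fin.
- move=> e e0.
  have [alpha Ha Hs] := secure P_product p_partition information_U information_V
    dynf x i_lt_l l_le_n t0_cell rH e0.
  exists alpha => // beta Hb.
  have := cond_exp_ge (payoff_cond_exp Ha Hb) (Hs _ _ _ (outcome_of Ha Hb)).
  by apply: ae_impl => w; rewrite lee_fin.
Qed.

(** The upper game is the lower game of the other player, for the opposite
  payoff. *)
Lemma inf_sup_value :
  {ae P, forall w, inf_sup P n p f i t0 b x h w =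
     (- value P p infoV infoU swap_players (node p t0) (l - i) i (fun y => - H y) x)%:E}.
Proof.
have [B YB] := payoff_bounded.
have rNH := regularN rH.
have outcome_swap alpha beta : SA alpha -> SB beta ->
    is_outcome P n p infoV infoU l t0 beta alpha
      (outcome P n p t0 b alpha beta).2 (outcome P n p t0 b alpha beta).1.
  by move=> Ha Hb; have [? ? ? ?] := outcome_of Ha Hb; split.
have intN alpha beta A : SA alpha -> SB beta -> filtration i A ->
    \int[P]_(w in A) - H (final alpha beta w) = - \int[P]_(w in A) H (final alpha beta w).
  move=> Ha Hb FA; have [Cu Cv _ _] := outcome_of Ha Hb.
  have mA := filtration_measurable FA.
  have bH := terminal_bounded_measurable p_partition dynf x i_lt_l l_le_n t0_cell rH Cu Cv.
  rewrite -mulN1r -RintegralZl//; last exact: bounded_measurable_integrable.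
  by apply: eq_Rintegral => w _; rewrite mulN1r.
apply: (@essinf_esssup_cst _ P _ _ SB SA _
  (fun beta alpha w => (payoff_variable alpha beta w)%:E)).
- move=> beta Hb.
  apply: (esssup_exists_ae (Y := payoff_variable^~ beta) (B := B)) => alpha Ha.
    exact: cond_exp_measurable (payoff_cond_exp Ha Hb).
  exact: YB.
- move=> beta e Hb e0.
  have [alpha Ha Hr] := respond P_product p_partition information_V information_U
    swap_dynamics x i_lt_l l_le_n t0_cell rNH Hb e0.
  exists alpha => //.
  have Hge A : filtration i A -> (- value P p infoV infoU swap_players (node p t0) (l - i) i
      (fun y => - H y) x - e) * fine (P A) <= \int[P]_(w in A) H (final alpha beta w).
    move=> FA; have := Hr _ _ (outcome_swap _ _ Ha Hb) A FA.
    by rewrite intN// lerNl -mulNr opprD.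
  have := cond_exp_ge (payoff_cond_exp Ha Hb) Hge.
  by apply: ae_impl => w; rewrite lee_fin.
- move=> e e0.
  have [beta Hb Hs] := secure P_product p_partition information_V information_U
    swap_dynamics x i_lt_l l_le_n t0_cell rNH e0.
  exists beta => // alpha Ha.
  have Hle A : filtration i A -> \int[P]_(w in A) H (final alpha beta w) <=
      (- value P p infoV infoU swap_players (node p t0) (l - i) i
      (fun y => - H y) x + e) * fine (P A).
    move=> FA; have := Hs _ _ _ (outcome_swap _ _ Ha Hb) A FA.
    by rewrite intN// lerNr -mulNr opprD opprK.
  have := cond_exp_le (payoff_cond_exp Ha Hb) Hle.
  by apply: ae_impl => w; rewrite lee_fin.
Qed.

End interval.

Section composition.
Context {E1 E2 : pmetricType R} (F : R -> 'rV[R]_d -> E1 -> E2 -> 'rV[R]_d).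
Variables (info1 info2 : nat -> set_system Omega).

Lemma value_add (q : nat -> R) m1 m2 j h :
  value P p info1 info2 F q (m1 + m2) j h =
  value P p info1 info2 F q m1 j (value P p info1 info2 F q m2 (j + m1) h).
Proof.
elim: m1 j => [|m1 IH] j; first by rewrite addn0.
by rewrite /= IH addSnnS.
Qed.

Lemma eq_value (q q' : nat -> R) m j h : (forall k, (j <= k)%N -> (k <= j + m)%N -> q k = q' k) ->
  value P p info1 info2 F q m j h = value P p info1 info2 F q' m j h.
Proof.
elim: m j => [//|m IH] j qq' /=; rewrite !qq' ?leqnn ?leq_addr ?leqnSn//; last first.
  by rewrite addnS ltnS leq_addr.
rewrite IH// => k jk km; apply: qq'; first exact: ltnW.
by rewrite addnS -addSn.
Qed.

(** After [p l] the nodes do not depend on the starting time, so the recursion can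
  be cut there. *)
Lemma value_split i l t h : (i < l)%N -> (l <= n)%N -> p i <= t < p i.+1 ->
  value P p info1 info2 F (node p t) (n - i) i h =
  value P p info1 info2 F (node p t) (l - i) i
    (value P p info1 info2 F (node p (p l)) (n - l) l h).
Proof.
move=> il ln /andP[_ tp].
have -> : (n - i = (l - i) + (n - l))%N by rewrite addnC addnBA ?(ltnW il)// subnK.
rewrite value_add subnKC ?(ltnW il)//; congr value.
apply: eq_value => k lk kn; rewrite /node.
have kn' : (k <= n)%N by rewrite (leq_trans kn)// subnKC.
rewrite (max_idPr _) ?(max_idPr _)//; first exact: (partition_le p_partition).
apply: le_trans (ltW tp) _; apply: (partition_le p_partition) => //.
exact: leq_trans il lk.
Qed.

End composition.

Lemma cellE i t : (i < n)%N -> p i <= t < p i.+1 -> cell n p t = i.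
Proof.
move=> i_n /andP[pt tp]; rewrite /cell.
have -> : n = (i + (n - i))%N by rewrite subnKC// ltnW.
rewrite iotaD find_cat; have -> : has (fun k => t < p k.+1) (iota 0 i) = false.
  apply/hasPn => k; rewrite mem_iota add0n => /andP[_ ki]; rewrite -leNgt.
  by apply: le_trans pt; apply: (partition_le p_partition) => //; exact: ltnW.
rewrite size_iota; have -> : (n - i = (n - i.+1).+1)%N by rewrite subnSK.
by rewrite /= add0n tp addn0.
Qed.

End value_of_the_game.

(** * The dynamic programming principle *)

Section lipschitz_versions.
Context {R : realType} {d : nat} (P : probability (Omega R) R).
Local Notation Omega := (Omega R).
Variables (Z : 'rV[R]_d -> Omega -> \bar R) (H : 'rV[R]_d -> R).
Hypotheses (rH : regular H) (ZH : forall y, {ae P, forall w, Z y w = (H y)%:E}).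

Let versionP : is_lip_version P Z (lip_version P Z).
Proof.
apply: getPex; exists (fun y _ => H y); have [_ [K _ hK]] := rH; split.
- by move=> y; exact: measurable_cst.
- by move=> y; apply: ae_impl (ZH y) => w ->.
- by exists K => w y y'; exact: hK.
Qed.

Lemma lip_version_measurable y : measurable_fun setT (lip_version P Z y).
Proof. by case: versionP. Qed.

Lemma lip_version_lipschitz :
  exists K, forall w y y', `|lip_version P Z y w - lip_version P Z y' w| <= K * `|y - y'|.
Proof. by case: versionP. Qed.

(** Lipschitz functions that agree at the points of arbitrarily fine grids are
  equal, and these points are countably many. *)
Lemma lip_version_ae : {ae P, forall w, forall y, lip_version P Z y w = H y}.
Proof.
have [_ eqZ [K hK]] := versionP; have [_ [K' K'0 hK']] := rH.
have : {ae P, forall w, forall m k : nat,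
    lip_version P Z (grid_point m.+1%:R^-1 k) w = H (grid_point m.+1%:R^-1 k)}.
  apply: ae_forall_nat => m; apply: ae_forall_nat => k.
  set y := grid_point _ _.
  by apply: ae_impl (ae_conj (eqZ y) (ZH y)) => w [E1 E2]; case: (etrans E1 E2).
apply: ae_impl => w Hw y; apply/eqP; rewrite -subr_eq0 -normr_le0.
apply/ler_addgt0Pl => e e0; rewrite addr0.
have K1 : 0 < `|K| + K' + 1 by rewrite ltr_wpDl// addr_ge0.
have e1 : 0 < e / (`|K| + K' + 1) by rewrite divr_gt0.
have [m _ me] := near_infty_natSinv_lt (PosNum e1).
have {}me : m.+1%:R^-1 < e / (`|K| + K' + 1) by apply: me => /=.
set z : 'rV[R]_d := grid_point m.+1%:R^-1 (grid_cell m.+1%:R^-1 y).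
have zy : `|z - y| <= m.+1%:R^-1 by apply: grid_point_near; rewrite invr_gt0.
have Hz : lip_version P Z z w = H z by exact: Hw.
have -> : lip_version P Z y w - H y =
    (lip_version P Z y w - lip_version P Z z w) + (H z - H y).
  by rewrite Hz addrA subrK.
apply: le_trans (ler_normD _ _) _; apply: le_trans (lerD (hK w y z) (hK' z y)) _.
rewrite distrC -mulrDl; apply: (@le_trans _ _ ((`|K| + K' + 1) * `|z - y|)).
  by rewrite ler_wpM2r// -addrA lerD ?ler_norm// lerDl.
by rewrite -ler_pdivlMl// mulrC (le_trans zy)// ltW.
Qed.

End lipschitz_versions.

Theorem theorem3p1 (R : realType) (d : nat) (U V : pmetricType R)
    (P : probability (Omega R) R) (T : R)
    (f : R -> 'rV[R]_d -> U -> V -> 'rV[R]_d) (g : 'rV[R]_d -> R)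
    (n : nat) (p : nat -> R)
    (P_product : is_product_lebesgue P)
    (T_gt0 : 0 < T)
    (U_compact : compact [set: U]) (V_compact : compact [set: V])
    (f_bounded : exists M : R, forall t x u v, 0 <= t <= T ->
       `|f t x u v| <= M)
    (f_continuous :
       {within [set z : R * 'rV[R]_d * U * V | 0 <= z.1.1.1 <= T],
         continuous (fun z => f z.1.1.1 z.1.1.2 z.1.2 z.2)})
    (f_lipschitz : exists L : R, forall t x y u v, 0 <= t <= T ->
       `|f t x u v - f t y u v| <= L * `|x - y|)
    (g_bounded : exists M : R, forall x, `|g x| <= M)
    (g_lipschitz : exists L : R, forall x y, `|g x - g y| <= L * `|x - y|)
    (p_partition : is_partition T n p)
    (t : R) (x : 'rV[R]_d) (t_range : 0 <= t <= T)
    (i l : nat) (i_lt_n : (i < n)%N) (l_le_n : (l <= n)%N)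
    (t_in_cell : p i <= t < p i.+1) (cell_le_l : p i.+1 <= p l) :
  {ae P, forall omega, lower_value P n p f g t x omega =
     sup_inf P n p f i t (p l) x
       (lip_version P (lower_value P n p f g (p l))) omega} /\
  {ae P, forall omega, upper_value P n p f g t x omega =
     inf_sup P n p f i t (p l) x
       (lip_version P (upper_value P n p f g (p l))) omega}.
Proof.
have [M f_M] := f_bounded; have [L f_L] := f_lipschitz.
have dynf : game_dynamics T M (`|L| + 1) f.
  have L1 : 0 < `|L| + 1 by rewrite ltr_wpDl.
  split => // s y y' c e sT; apply: le_trans (f_L _ _ _ _ _ sT) _.
  by rewrite ler_wpM2r// (le_trans (ler_norm L))// lerDl.
have rg : regular g.
  split=> //; have [K gK] := g_lipschitz; exists `|K| => // y y'.
  by apply: le_trans (gK y y') _; rewrite ler_wpM2r// ler_norm.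
have i_lt_l : (i < l)%N.
  rewrite ltnNge; apply/negP => li; have := partition_le p_partition li (ltnW i_lt_n).
  by rewrite leNgt (lt_le_trans _ cell_le_l)//; case/andP: t_in_cell => /le_lt_trans; apply.
have cst_ae : {ae P, forall w : Omega R, forall y, g y = g y} by apply: aeW.
have g_lip : exists K, forall (w : Omega R) y y', `|g y - g y'| <= K * `|y - y'|.
  by have [K gK] := g_lipschitz; exists K => _.
have end_cell k : (k < n)%N -> p k <= p k < p k.+1.
  by move=> kn; case: p_partition => _ _ plt; rewrite lexx plt.
have lt_end s k : (k < n)%N -> p k <= s < p k.+1 -> s < p n.
  by move=> kn /andP[_ /lt_le_trans]; apply; exact: (partition_le p_partition).
have lowerE k s y : (k < n)%N -> p k <= s < p k.+1 ->
    {ae P, forall w, lower_value P n p f g s y w =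
       (value P p infoU infoV f (node p s) (n - k) k g y)%:E}.
  move=> kn sk; rewrite /lower_value (lt_end s k kn sk) (cellE p_partition kn sk).
  apply: (sup_inf_value P_product p_partition dynf y kn (leqnn n) sk rg) => //.
have upperE k s y : (k < n)%N -> p k <= s < p k.+1 ->
    {ae P, forall w, upper_value P n p f g s y w =
       (- value P p infoV infoU (swap_players f) (node p s) (n - k) k (fun z => - g z) y)%:E}.
  move=> kn sk; rewrite /upper_value (lt_end s k kn sk) (cellE p_partition kn sk).
  apply: (inf_sup_value P_product p_partition dynf y kn (leqnn n) sk rg) => //.
split.
- pose H := value P p infoU infoV f (node p (p l)) (n - l) l g.
  have H_ae y : {ae P, forall w, lower_value P n p f g (p l) y w = (H y)%:E}.
    have [ln|] := boolP (l < n)%N; first by apply: lowerE => //; exact: end_cell.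
    rewrite -leqNgt /H => nl; have -> : l = n by apply/eqP; rewrite eqn_leq l_le_n.
    by rewrite /lower_value ltxx subnn; apply: aeW.
  have rH : regular H.
    have [ln|] := boolP (l < n)%N; last first.
      by rewrite -leqNgt -subn_eq0 /H => /eqP ->.
    rewrite /H; apply: (value_regular P p_partition information_U information_V dynf
      (leqnn n) (end_cell l ln)) => //.
    by rewrite subnKC.
  have := sup_inf_value P_product p_partition dynf x i_lt_l l_le_n t_in_cell rH
    (lip_version_measurable rH H_ae) (lip_version_lipschitz rH H_ae) (lip_version_ae rH H_ae).
  move=> /(ae_conj (lowerE i t x i_lt_n t_in_cell)); apply: ae_impl => w [-> ->].
  by rewrite (value_split P p_partition _ _ _ _ i_lt_l l_le_n t_in_cell).
- pose H' := value P p infoV infoU (swap_players f) (node p (p l)) (n - l) l (fun z => - g z).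
  pose H y := - H' y.
  have H_ae y : {ae P, forall w, upper_value P n p f g (p l) y w = (H y)%:E}.
    have [ln|] := boolP (l < n)%N; first by apply: upperE => //; exact: end_cell.
    rewrite -leqNgt /H /H' => nl; have -> : l = n by apply/eqP; rewrite eqn_leq l_le_n.
    by rewrite /upper_value ltxx subnn; apply: aeW => w; rewrite /= opprK.
  have rH : regular H.
    apply: regularN; have rNg := regularN rg.
    have [ln|] := boolP (l < n)%N; last first.
      by rewrite -leqNgt -subn_eq0 /H' => /eqP ->.
    rewrite /H'; apply: (value_regular P p_partition information_V information_U
      (swap_dynamics dynf) (leqnn n) (end_cell l ln)) => //.
    by rewrite subnKC.
  have := inf_sup_value P_product p_partition dynf x i_lt_l l_le_n t_in_cell rH
    (lip_version_measurable rH H_ae) (lip_version_lipschitz rH H_ae) (lip_version_ae rH H_ae).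
  move=> /(ae_conj (upperE i t x i_lt_n t_in_cell)); apply: ae_impl => w [-> ->].
  rewrite (value_split P p_partition _ _ _ _ i_lt_l l_le_n t_in_cell) //; do 2 congr (_ _).
  by congr value; apply/funext => y; rewrite /H opprK.
Qed.
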